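(* Let $\mathsf X$ be a compact Abelian group with Pontryagin dual $\Xi$, let $\Omega\subset\delta\Xi=\beta\Xi\setminus\Xi$ be a closed subset invariant under the extended translation action $\theta$ of $\Xi$, and let $f\in \mathsf{VO}^\Omega(\mathsf X\times\Xi)$. Then $$\big\|\pi_\Omega[\mathsf{Op}(f)]\big\|_{\mathbb D_\Omega}=\mathrm{dist}\big(\mathsf{Op}(f),\mathbb D^\Omega\big)\ \ge\ \mathsf D^\Omega(f),$$ where $\pi_\Omega:\mathbb D\to\mathbb D_\Omega:=\mathbb D/\mathbb D^\Omega$ is the canonical quotient epimorphism, $\mathrm{dist}(\mathsf{Op}(f),\mathbb D^\Omega)=\inf_{\mathsf L\in\mathbb D^\Omega}\|\mathsf{Op}(f)-\mathsf L\|_{\mathbb B(L^2(\mathsf X))}$, and $$\mathsf D^\Omega(f)=\limsup_{(x,\xi)\to\mathsf X\times\Omega}|f(x,\xi)|.$$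
   Context: Group and Fourier transform. $\mathsf X$ is a compact Abelian group, written multiplicatively, with normalized Haar measure $dx$; $\Xi=\widehat{\mathsf X}$ is its (discrete Abelian) Pontryagin dual, also written multiplicatively. $\mathcal F:L^2(\mathsf X)\to\ell^2(\Xi)$, $(\mathcal F\varphi)(\xi)=\int_{\mathsf X}\overline{\xi(x)}\varphi(x)\,dx$, is the unitary Fourier transformation, with inverse $(\mathcal F^{-1}\psi)(x)=\sum_{\xi\in\Xi}\xi(x)\psi(\xi)$. $\mathcal H=L^2(\mathsf X)$. Compactification and invariant sets. $\beta\Xi=\Xi\sqcup\delta\Xi$ is the Stone–Čech compactification of $\Xi$, so $\ell^\infty(\Xi)\cong C(\beta\Xi)$; $\tilde\psi$ is the continuous extension of $\psi\in\ell^\infty(\Xi)$ to $\beta\Xi$. $\theta$ is the canonical extension to $\beta\Xi$ of the action of $\Xi$ on itself by translations, and $\Theta_\eta(\psi)=\psi\circ\theta_\eta$ for $\eta\in\Xi$. For $\Omega\subset\delta\Xi$ closed and $\theta$-invariant, $\ell^{\infty,\Omega}(\Xi)=\{\psi\in\ell^\infty(\Xi):\tilde\psi|_\Omega=0\}$, a $\Theta$-invariant ideal of $\ell^\infty(\Xi)$. Crossed products. $\mathfrak C=\Xi\ltimes\ell^\infty(\Xi)$ is the crossed product for the action $\Theta$, i.e. the enveloping $C^*$-algebra of the Banach $*$-algebra $\ell^1(\Xi;\ell^\infty(\Xi))$ with (writing $\Psi(\xi,\zeta)=[\Psi(\xi)](\zeta)$) $$(\Phi\diamond\Psi)(\xi,\zeta)=\sum_{\eta\in\Xi}\Phi(\xi\eta^{-1},\zeta\eta)\Psi(\eta,\zeta),\qquad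 \Psi^\diamond(\xi,\zeta)=\overline{\Psi(\xi^{-1},\zeta\xi)}.$$ $\mathfrak C^\Omega=\Xi\ltimes\ell^{\infty,\Omega}(\Xi)$ is the corresponding ideal of $\mathfrak C$. The Schrödinger representation $\mathsf{sch}:\mathfrak C\to\mathbb B[\ell^2(\Xi)]$ is given for $\Psi\in\ell^1(\Xi;\ell^\infty(\Xi))$ by $[\mathsf{sch}(\Psi)w](\xi)=\sum_{\eta\in\Xi}\Psi(\xi\eta^{-1},\eta)w(\eta)$. Symbols. $\mathfrak D=(\mathcal F^{-1}\otimes\mathrm{id})\mathfrak C$ is the partial Fourier transform of the whole of $\mathfrak C$ (in the first variable), a $C^*$-algebra with the algebraic and topological structure transported from $\mathfrak C$, and $\mathfrak D^\Omega=(\mathcal F^{-1}\otimes\mathrm{id})\mathfrak C^\Omega$ is an ideal of $\mathfrak D$. The author asserts, from the Riemann–Lebesgue Lemma and the universal property of the crossed product, that $\mathfrak D\subset C(\mathsf X;\ell^\infty(\Xi))\cong C(\mathsf X\times\beta\Xi)$ (with different norms); elements of $\mathfrak D$ are accordingly treated as functions $f(x,\xi)$ on $\mathsf X\times\Xi$. The quantization is the representation of $\mathfrak D$ given by $\mathsf{Op}(f)=\mathcal F^{-1}\,\mathsf{sch}\big[(\mathcal F\otimes\mathrm{id})f\big]\,\mathcal F\in\mathbb B(\mathcal H)$; it is the pseudodifferential calculus $[\mathsf{Op}(f)u](x)=\sum_{\xi\in\Xi}\xi(x)f(x,\xi)(\mathcal Fu)(\xi)$. Vanishing oscillation symbols.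 For $\zeta\in\Xi$ put $\mathsf{OSC}^\zeta_f(x,\xi)=f(x,\xi\zeta)-f(x,\xi)$, and $$\mathsf{VO}^\Omega(\mathsf X\times\Xi)=\{f\in\mathfrak D:\ \mathsf{OSC}^\zeta_f\in\mathfrak D^\Omega\ \ \forall\zeta\in\Xi\}.$$ Operator algebras. $\mathbb D=\mathsf{Op}(\mathfrak D)\subset\mathbb B(\mathcal H)$ and $\mathbb D^\Omega=\mathsf{Op}(\mathfrak D^\Omega)$, an ideal in the $C^*$-algebra $\mathbb D$. $\mathbb D^\Omega$ is the closure in $\mathbb B(\mathcal H)$ of the subspace generated by the products $\varphi(Q)\psi(P)$ with $\varphi\in C(\mathsf X)$ and $\psi\in\ell^{\infty,\Omega}(\Xi)$, where $\varphi(Q)$ is multiplication by $\varphi$ and $\psi(P)=\mathcal F^{-1}\psi(Q_\Xi)\mathcal F$, with $\psi(Q_\Xi)$ the operator of multiplication by $\psi$ in $\ell^2(\Xi)$. Limsup. With $\mathscr V(\Omega)$ the filter of all neighborhoods of $\Omega$ in $\beta\Xi$, $$\limsup_{(x,\xi)\to\mathsf X\times\Omega}|f(x,\xi)|:=\lim_{V\in\mathscr V(\Omega)}\ \sup_{x\in\mathsf X,\ \xi\in V\cap\Xi}|f(x,\xi)|.$$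
   Formalization: The symbol f is additionally assumed to lie in C(X; ℓ^∞(Ξ)); the source asserts this for all of 𝔇, but it fails for infinite Ξ, and without it the inequality is false (Ω = δΞ and a suitable compact Op(f) give distance 0 and limsup 1). *)

(* Defs.v *)
From HB Require Import structures.
From mathcomp Require Import all_boot all_order all_algebra.
From mathcomp Require Import all_classical all_reals all_analysis.
From mathcomp Require Import measurable_realfun ring_quotient complex.
From mathcomp Require Import ring lra.

Set Implicit Arguments.
Unset Strict Implicit.
Unset Printing Implicit Defensive.

Import Order.TTheory GRing.Theory Num.Theory.
Import numFieldNormedType.Exports.

Local Open Scope classical_set_scope.
Local Open Scope ring_scope.

(* Abelian groups are written additively (zmodType), although [dual] below    *)
(* consists of multiplicative characters: the sum of two characters is their  *)
(* pointwise product.                                                         *)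

(* R[i] only inherits its normed-module structure through numFieldType. *)
Definition complex_numField (R : realType) : numFieldType := R[i].
HB.instance Definition _ (R : realType) :=
  NormedModule.copy R[i] (complex_numField R).

Notation modc := ComplexField.Normc.normc.

Section modulus.
Context {R : realType}.
Implicit Types z w : R[i].

Lemma modc_ge0 z : 0 <= modc z.
Proof. by case: z => a b; exact: sqrtr_ge0. Qed.

Lemma modc_normE z : (modc z)%:C%C = `|z|.
Proof. by []. Qed.

Lemma modc_sqr z : modc z ^+ 2 = complex.Re z ^+ 2 + complex.Im z ^+ 2.
Proof. by case: z => a b /=; rewrite sqr_sqrtr// addr_ge0 ?sqr_ge0. Qed.

Lemma le_modcD z w : modc (z + w) <= modc z + modc w.
Proof.
have := ler_normD z w.
by rewrite -!modc_normE -rmorphD lecR.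
Qed.

Lemma modcN z : modc (- z) = modc z.
Proof.
by case: z => a b /=; rewrite !sqrrN.
Qed.

End modulus.

(* Unconditional sums, meaningful for absolutely summable families only.      *)

Section unconditional_sum.
Context {I : choiceType} {R : realType}.

Definition rsum (a : I -> R) : R :=
  fine (esum setT (EFin \o a)^\+ - esum setT (EFin \o a)^\-)%E.

Definition csum (a : I -> R[i]) : R[i] :=
  (rsum (@complex.Re R \o a) +i* rsum (@complex.Im R \o a))%C.

End unconditional_sum.

(* The Stone-Cech compactification of a discrete space I, as the space of     *)
(* ultrafilters on I with the topology generated by the sets {p | A \in p}.   *)

Record beta (I : Type) := Beta {
  beta_sets :> set_system I ;
  beta_ultra : UltraFilter beta_sets }.

Section beta_topology.
Variable I : Type.

HB.instance Definition _ := gen_eqMixin (beta I).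
HB.instance Definition _ := gen_choiceMixin (beta I).
HB.instance Definition _ := isSubBaseTopological.Build (beta I)
  (setT : set (set I)) (fun A => [set p : beta I | beta_sets p A]).

Definition beta_pt (i : I) : beta I := Beta (principal_filter_ultra i).

Definition corona : set (beta I) := ~` range beta_pt.

End beta_topology.

Arguments beta_pt {I} i.
Arguments corona {I}.

Lemma ultra_fmap (I J : Type) (h : I -> J) (F : set_system I) :
  UltraFilter F -> UltraFilter (h @ F).
Proof.
move=> FU; split; first exact: fmap_proper_filter.
move=> G GP FG; rewrite eqEsubset; split=> // A GA.
case: (in_ultra_setVsetC (h @^-1` A) FU) => // FA.
have GnA : G (~` A) by apply: FG.
have G0 : G set0 by rewrite -(setICr A); exact: filterI.
by have := @filter_not_empty _ G GP G0.
Qed.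

Definition beta_map (I J : Type) (h : I -> J) (p : beta I) : beta J :=
  Beta (ultra_fmap h (beta_ultra p)).

Section bounded_functions.
Context {R : realType} {G : zmodType}.
Implicit Types (psi : G -> R[i]) (Omega : set (beta G)).

Definition supnorm psi : \bar R :=
  ereal_sup (range (fun xi => (modc (psi xi))%:E)).

Definition linfty : set (G -> R[i]) := [set psi | (supnorm psi < +oo)%E].

Definition is_beta_ext psi (tpsi : beta G -> R[i]) : Prop :=
  continuous tpsi /\ (forall xi, tpsi (beta_pt xi) = psi xi).

Definition linfty_ideal Omega : set (G -> R[i]) :=
  [set psi | linfty psi /\
    exists2 tpsi, is_beta_ext psi tpsi & forall p, Omega p -> tpsi p = 0].

Definition beta_trans (eta : G) : beta G -> beta G :=
  beta_map (fun zeta => zeta + eta).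

Definition theta_invariant Omega : Prop :=
  forall eta p, Omega p -> Omega (beta_trans eta p).

Lemma supnorm_ge0 psi : (0 <= supnorm psi)%E.
Proof.
apply: (@le_trans _ _ (modc (psi 0))%:E); first by rewrite lee_fin modc_ge0.
by apply: ereal_sup_ubound; exists 0.
Qed.

Lemma supnorm0 : supnorm 0 = 0%E.
Proof.
apply/eqP; rewrite eq_le supnorm_ge0 andbT.
apply: ge_ereal_sup => _ [xi _ <-].
by rewrite lee_fin -[X in modc X]/(0 : R[i]) ComplexField.Normc.normc0.
Qed.

Lemma supnormB psi phi : (supnorm (psi - phi)%R <= supnorm psi + supnorm phi)%E.
Proof.
apply: ge_ereal_sup => _ [xi _ <-].
apply: (@le_trans _ _ ((modc (psi xi))%:E + (modc (phi xi))%:E)%E).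
  by rewrite -EFinD lee_fin (le_trans (le_modcD _ _))// modcN.
by apply: leeD; apply: ereal_sup_ubound; exists xi.
Qed.

End bounded_functions.

Section l1.
Context {R : realType} {G : zmodType}.
Implicit Types Phi Psi : G -> G -> R[i].

Definition l1norm Psi : \bar R := \esum_(xi in setT) supnorm (Psi xi).

Definition l1_pred : {pred G -> G -> R[i]} :=
  fun Psi => `[< (l1norm Psi < +oo)%E >].

Lemma l1_zmod_closed : zmod_closed l1_pred.
Proof.
split.
  apply/asboolP; rewrite /l1norm esum1 ?ltry// => xi _; exact: supnorm0.
move=> Phi Psi /asboolP hPhi /asboolP hPsi; apply/asboolP.
apply: (@le_lt_trans _ _ (l1norm Phi + l1norm Psi)%E); last first.
  exact: lte_add_pinfty.
rewrite /l1norm -esumD; [|by move=> *; exact: supnorm_ge0..].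
by apply: le_esum => xi _; exact: supnormB.
Qed.

HB.instance Definition _ :=
  GRing.isZmodClosed.Build (G -> G -> R[i]) l1_pred l1_zmod_closed.

Definition l1_mul Phi Psi : G -> G -> R[i] := fun xi zeta =>
  csum (fun eta => Phi (xi - eta) (zeta + eta) * Psi eta zeta).

Definition l1_star Psi : G -> G -> R[i] := fun xi zeta =>
  (Psi (- xi) (zeta + xi))^*%C.

(* C*-seminorms on l^1(G; l^infty(G)); the values of p outside of l^1 are     *)
(* irrelevant.                                                                *)
Record cstar_seminorm (p : (G -> G -> R[i]) -> R) : Prop := CstarSeminorm {
  cstar_ge0 : forall Psi, Psi \in l1_pred -> 0 <= p Psi ;
  cstarD : forall Phi Psi, Phi \in l1_pred -> Psi \in l1_pred ->
    p (Phi + Psi) <= p Phi + p Psi ;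
  cstarZ : forall (z : R[i]) Psi, Psi \in l1_pred ->
    p (fun xi zeta => z * Psi xi zeta) = modc z * p Psi ;
  cstarM : forall Phi Psi, Phi \in l1_pred -> Psi \in l1_pred ->
    p (l1_mul Phi Psi) <= p Phi * p Psi ;
  cstar_eq : forall Psi, Psi \in l1_pred ->
    p (l1_mul (l1_star Psi) Psi) = p Psi ^+ 2 }.

(* The norm of the enveloping C*-algebra: the largest C*-seminorm, which is   *)
(* also the supremum of |pi(Psi)| over the *-representations pi.              *)
Definition env_norm Psi : \bar R :=
  ereal_sup [set (p Psi)%:E | p in cstar_seminorm].

Lemma cstar0 p : cstar_seminorm p -> p 0 = 0.
Proof.
move=> hp; have h0 : (0 : G -> G -> R[i]) \in l1_pred by exact: rpred0.
have := cstarZ hp 0 h0; rewrite ComplexField.Normc.normc0 mul0r => <-.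
by congr p; apply/funext => xi; apply/funext => zeta; rewrite mul0r.
Qed.

Lemma cstarN p Psi : cstar_seminorm p -> Psi \in l1_pred -> p (- Psi) = p Psi.
Proof.
move=> hp hPsi; have := cstarZ hp (-1) hPsi.
rewrite modcN ComplexField.Normc.normc1 mul1r => <-.
by congr p; apply/funext => xi; apply/funext => zeta; rewrite mulN1r.
Qed.

Lemma env_norm0 : (env_norm (0 : G -> G -> R[i])%R <= 0)%E.
Proof. by apply: ge_ereal_sup => _ [p /cstar0 -> <-]. Qed.

Lemma env_normB_le Phi Psi (a b : R) : Phi \in l1_pred -> Psi \in l1_pred ->
  (env_norm Phi <= a%:E)%E -> (env_norm Psi <= b%:E)%E ->
  (env_norm (Phi - Psi)%R <= (a + b)%:E)%E.
Proof.
move=> h1 h2 ha hb; apply: ge_ereal_sup => _ [p hp <-].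
have pa : p Phi <= a.
  by rewrite -lee_fin (le_trans _ ha)//; apply: ereal_sup_ubound; exists p.
have pb : p Psi <= b.
  by rewrite -lee_fin (le_trans _ hb)//; apply: ereal_sup_ubound; exists p.
have hN : - Psi \in l1_pred by rewrite rpredN.
rewrite lee_fin (le_trans (cstarD hp h1 hN))// (cstarN hp h2).
exact: lerD.
Qed.

End l1.

Arguments l1_pred : clear implicits.

Section crossed_product.
Variables (R : realType) (G : zmodType).

Record l1 := L1 { l1_val :> G -> G -> R[i] ; _ : l1_val \in l1_pred R G }.

HB.instance Definition _ := [isSub for l1_val].
HB.instance Definition _ := [Choice of l1 by <:].
HB.instance Definition _ := [SubChoice_isSubZmodule of l1 by <:].

Implicit Types u v : nat -> l1.

Definition env_cauchy : {pred nat -> l1} := fun u =>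
  `[< forall e : R, 0 < e -> exists N : nat, forall m n : nat,
      (N <= m)%N -> (N <= n)%N -> (env_norm (u m - u n : l1)%R <= e%:E)%E >].

Lemma env_cauchy_zmod_closed : zmod_closed env_cauchy.
Proof.
split.
  apply/asboolP => e e0; exists 0%N => m n _ _; rewrite subrr.
  by apply: le_trans env_norm0 _; rewrite lee_fin ltW.
move=> u v /asboolP hu /asboolP hv; apply/asboolP => e e0.
have e20 : 0 < e / 2 by rewrite divr_gt0.
have [N hN] := hu _ e20; have [M hM] := hv _ e20.
exists (maxn N M) => m n; rewrite !geq_max => /andP[Nm Mm] /andP[Nn Mn].
have -> : ((u - v) m - (u - v) n : l1) = (u m - u n) - (v m - v n).
  by rewrite /= opprD opprK !opprB addrACA [- v m + _]addrC.
rewrite [e]splitr; apply: env_normB_le; [exact: valP|exact: valP| |].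
  exact: hN.
exact: hM.
Qed.

HB.instance Definition _ :=
  GRing.isZmodClosed.Build (nat -> l1) env_cauchy env_cauchy_zmod_closed.

Record cauchy_seq :=
  CauchySeq { cauchy_val :> nat -> l1 ; _ : cauchy_val \in env_cauchy }.

HB.instance Definition _ := [isSub for cauchy_val].
HB.instance Definition _ := [Choice of cauchy_seq by <:].
HB.instance Definition _ := [SubChoice_isSubZmodule of cauchy_seq by <:].

Definition env_null : {pred cauchy_seq} := fun u : cauchy_seq =>
  `[< forall e : R, 0 < e -> exists N : nat, forall n : nat,
      (N <= n)%N -> (env_norm (u n) <= e%:E)%E >].

Lemma env_null_zmod_closed : zmod_closed env_null.
Proof.
split.
  apply/asboolP => e e0; exists 0%N => n _.
  by apply: le_trans env_norm0 _; rewrite lee_fin ltW.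
move=> u v /asboolP hu /asboolP hv; apply/asboolP => e e0.
have e20 : 0 < e / 2 by rewrite divr_gt0.
have [N hN] := hu _ e20; have [M hM] := hv _ e20.
exists (maxn N M) => n; rewrite !geq_max => /andP[Nn Mn].
rewrite [e]splitr; apply: env_normB_le; [exact: valP|exact: valP| |].
  exact: hN.
exact: hM.
Qed.

HB.instance Definition _ :=
  GRing.isZmodClosed.Build cauchy_seq env_null env_null_zmod_closed.

(* The enveloping C*-algebra of l^1(G; l^infty(G)) as a completion. *)
Definition crossed : zmodType := Quotient.quot env_null.

(* G |x l^{infty,Omega}(G) as an ideal of [crossed]: the closure of           *)
(* l^1(G; l^{infty,Omega}(G)).                                                *)
Definition crossed_ideal (Omega : set (beta G)) : set crossed :=
  [set a | exists2 u : cauchy_seq,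
    (forall n xi, linfty_ideal Omega (u n xi)) &
    a = (\pi_(Quotient.quot env_null) u)%qT].

(* The function of two variables attached to an element of [crossed]. *)
Definition crossed_coef (a : crossed) (xi zeta : G) : R[i] :=
  limn (fun n => (repr a : cauchy_seq) n xi zeta).

(* The Schrodinger representation on l^2(G); the value at w is meaningful     *)
(* for w in l^2(G).                                                           *)
Definition sch_l1 (Psi : G -> G -> R[i]) (w : G -> R[i]) : G -> R[i] :=
  fun xi => csum (fun eta => Psi (xi - eta) eta * w eta).

Definition sch (a : crossed) (w : G -> R[i]) : G -> R[i] :=
  fun xi => limn (fun n => sch_l1 ((repr a : cauchy_seq) n) w xi).

End crossed_product.

Section L2_space.
Context d (T : measurableType d) (R : realType).
Variable mu : {measure set T -> \bar R}.
Implicit Types f g : T -> R[i].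

Definition cintegral f : R[i] :=
  (Rintegral mu setT (@complex.Re R \o f) +i*
   Rintegral mu setT (@complex.Im R \o f))%C.

Definition sqint f : \bar R := (\int[mu]_x (modc (f x) ^+ 2)%:E)%E.

Definition L2_pred : {pred T -> R[i]} := fun f =>
  `[< [/\ measurable_fun setT (@complex.Re R \o f),
          measurable_fun setT (@complex.Im R \o f) &
          (sqint f < +oo)%E] >].

Lemma measurable_modc_sqr f :
  measurable_fun setT (@complex.Re R \o f) ->
  measurable_fun setT (@complex.Im R \o f) ->
  measurable_fun setT (fun x => modc (f x) ^+ 2).
Proof.
move=> mr mi; under eq_fun do rewrite modc_sqr.
by apply: measurable_funD; apply: measurable_funX.
Qed.

Lemma L2_zmod_closed : zmod_closed L2_pred.
Proof.
split.
  apply/asboolP; split.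
  - exact: (measurable_cst (0 : R)).
  - exact: (measurable_cst (0 : R)).
  - rewrite /sqint (eq_integral (cst 0%E)) ?integral0 ?ltry// => x _ /=.
    by rewrite expr0n/= addr0 sqrtr0 expr0n.
move=> f g /asboolP[fr fi fs] /asboolP[gr gi gs]; apply/asboolP.
have Er : @complex.Re R \o (f - g) = (@complex.Re R \o f) \- (@complex.Re R \o g).
  by apply/funext => x /=; rewrite /GRing.add/= /GRing.opp/=; case: (f x) (g x) => [? ?] [? ?].
have Ei : @complex.Im R \o (f - g) = (@complex.Im R \o f) \- (@complex.Im R \o g).
  by apply/funext => x /=; rewrite /GRing.add/= /GRing.opp/=; case: (f x) (g x) => [? ?] [? ?].
have mr : measurable_fun setT (@complex.Re R \o (f - g)).
  by rewrite Er; exact: measurable_funB.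
have mi : measurable_fun setT (@complex.Im R \o (f - g)).
  by rewrite Ei; exact: measurable_funB.
split=> //.
have nn h : forall x, setT x -> (0 <= (modc (h x : R[i]) ^+ 2)%:E)%E.
  by move=> x _; rewrite lee_fin sqr_ge0.
apply: (@le_lt_trans _ _ (\int[mu]_x
    (2%:E * ((modc (f x) ^+ 2)%:E + (modc (g x) ^+ 2)%:E)))%E).
  apply: ge0_le_integral => //.
  - exact: nn.
  - exact/measurable_EFinP/measurable_modc_sqr.
  - apply: measurable_funeM; apply: emeasurable_funD;
    exact/measurable_EFinP/measurable_modc_sqr.
  - move=> x _; rewrite -EFinD -EFinM lee_fin !modc_sqr.
    have := congr1 (fun h => h x) Er; have := congr1 (fun h => h x) Ei => /= -> ->.
    set a := complex.Re (f x); set b := complex.Im (f x).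
    set a' := complex.Re (g x); set b' := complex.Im (g x).
    have := sqr_ge0 (a + a'); have := sqr_ge0 (b + b'); nra.
rewrite ge0_integralZl//; last 2 first.
  - by apply: emeasurable_funD; exact/measurable_EFinP/measurable_modc_sqr.
  - by move=> x _; rewrite adde_ge0// nn.
rewrite ge0_integralD//; [|exact: nn|exact/measurable_EFinP/measurable_modc_sqr
  |exact: nn|exact/measurable_EFinP/measurable_modc_sqr].
by rewrite lte_mul_pinfty// lte_add_pinfty.
Qed.

HB.instance Definition _ :=
  GRing.isZmodClosed.Build (T -> R[i]) L2_pred L2_zmod_closed.

Record L2fun := L2Fun { L2fun_val :> T -> R[i] ; _ : L2fun_val \in L2_pred }.

HB.instance Definition _ := [isSub for L2fun_val].
HB.instance Definition _ := [Choice of L2fun by <:].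
HB.instance Definition _ := [SubChoice_isSubZmodule of L2fun by <:].

Definition L2_null : {pred L2fun} := fun f : L2fun =>
  `[< {ae mu, forall x, f x = 0} >].

Lemma L2_null_zmod_closed : zmod_closed L2_null.
Proof.
split; first by apply/asboolP; exact: aeW.
move=> f g /asboolP hf /asboolP hg; apply/asboolP.
by apply: filterS2 hf hg => x f0 g0; rewrite -[LHS]/(f x - g x) f0 g0 subr0.
Qed.

HB.instance Definition _ :=
  GRing.isZmodClosed.Build L2fun L2_null L2_null_zmod_closed.

Definition L2 : zmodType := Quotient.quot L2_null.

Definition L2norm (u : L2) : R := Num.sqrt (fine (sqint (repr u : L2fun))).

(* Operator norm on the (bounded) operators on L2; it is +oo on unbounded     *)
(* maps.                                                                      *)
Definition opnorm (A : L2 -> L2) : \bar R :=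
  ereal_sup [set (L2norm (A u))%:E | u in [set u | L2norm u <= 1]].

End L2_space.

HB.instance Definition _ (X : topologicalZmodType) := isPointed.Build X 0.

Notation borel X := (g_sigma_algebraType (@open X)).

Section dual_group.
Variables (X : topologicalZmodType) (R : realType).

(* A normalized Haar measure: an invariant Radon probability measure on the   *)
(* Borel sigma-algebra. (Regularity is not automatic when X is not            *)
(* metrizable.)                                                               *)
Definition is_haar (mu : probability (borel X) R) : Prop :=
  [/\ forall (x : X) (A : set (borel X)), measurable A ->
        mu ((fun y : X => x + y) @^-1` A) = mu A,
      forall A : set (borel X), measurable A ->
        mu A = ereal_inf [set mu U | U in [set U : set X | open U /\ A `<=` U]]
    & forall U : set X, open U ->
        mu U = ereal_sup [set mu K | K in [set K : set X | compact K /\ K `<=` U]]].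

Definition is_character (chi : X -> R[i]) : Prop :=
  [/\ continuous chi, forall x, modc (chi x) = 1
    & forall x y, chi (x + y) = chi x * chi y].

Definition character_pred : {pred X -> R[i]} := fun chi => `[< is_character chi >].

Record dual := Dual {
  dual_val :> X -> R[i] ; _ : dual_val \in character_pred }.

HB.instance Definition _ := [isSub for dual_val].
HB.instance Definition _ := [Choice of dual by <:].

Lemma dualP (chi : dual) : is_character chi.
Proof. exact/asboolP/(valP chi). Qed.

Lemma character1 : is_character (fun=> 1).
Proof.
split=> [x|x|x y]; [exact: cvg_cst|exact: ComplexField.Normc.normc1|].
by rewrite mulr1.
Qed.

Lemma characterM (chi psi : dual) : is_character (fun x => chi x * psi x).
Proof.
have [c1 m1 h1] := dualP chi; have [c2 m2 h2] := dualP psi.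
split=> [x|x|x y].
- by apply: cvgM; [exact: c1|exact: c2].
- by rewrite ComplexField.Normc.normcM m1 m2 mulr1.
- by rewrite h1 h2 mulrACA.
Qed.

Lemma character_neq0 (chi : dual) x : chi x != 0.
Proof.
have [_ m _] := dualP chi; apply/eqP => c0.
by have := m x; rewrite c0 ComplexField.Normc.normc0 => /esym/eqP; rewrite oner_eq0.
Qed.

Lemma characterV (chi : dual) : is_character (fun x => (chi x)^-1).
Proof.
have [c m h] := dualP chi; split=> [x|x|x y].
- by apply: cvgV; [exact: character_neq0|exact: c].
- by rewrite ComplexField.Normc.normcV m invr1.
- by rewrite h invfM.
Qed.

Definition dual_zero : dual := Dual (introT (asboolP _) character1).
Definition dual_add chi psi : dual :=
  Dual (introT (asboolP _) (characterM chi psi)).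
Definition dual_opp chi : dual := Dual (introT (asboolP _) (characterV chi)).

Lemma dual_addA : associative dual_add.
Proof. by move=> a b c; apply/val_inj/funext => x /=; rewrite mulrA. Qed.

Lemma dual_addC : commutative dual_add.
Proof. by move=> a b; apply/val_inj/funext => x /=; rewrite mulrC. Qed.

Lemma dual_add0 : left_id dual_zero dual_add.
Proof. by move=> a; apply/val_inj/funext => x /=; rewrite mul1r. Qed.

Lemma dual_addN : left_inverse dual_zero dual_opp dual_add.
Proof.
move=> a; apply/val_inj/funext => x /=.
by rewrite mulVf// character_neq0.
Qed.

HB.instance Definition _ :=
  GRing.isZmodule.Build dual dual_addA dual_addC dual_add0 dual_addN.

End dual_group.

Section quantization.
Context {R : realType} {X : topologicalZmodType}.
Variable mu : probability (borel X) R.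

Local Notation Xi := (dual X R).
Local Notation symbol := (X -> Xi -> R[i]).
Local Notation H := (L2 mu).

Implicit Types (f : symbol) (Omega : set (beta Xi)).

Definition fourier (u : X -> R[i]) (xi : Xi) : R[i] :=
  cintegral mu (fun x : borel X => (xi x)^*%C * u x).

Definition fourierL2 (u : H) : Xi -> R[i] := fourier (repr u : L2fun mu).

Definition fourierL2_inv (w : Xi -> R[i]) : H :=
  xget 0 [set u | fourierL2 u = w].

(* f is the partial inverse Fourier transform of a. For a general a, the      *)
(* function f^~ zeta is only square-integrable: its Fourier coefficients form *)
(* a column of the matrix of [sch a].                                         *)
Definition is_symbol_of (a : crossed R Xi) f : Prop :=
  (forall zeta, (f^~ zeta : borel X -> R[i]) \in L2_pred mu) /\
  (forall xi zeta, fourier (f^~ zeta) xi = crossed_coef a xi zeta).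

Definition frakD : set symbol := [set f | exists a, is_symbol_of a f].

Definition frakD_ideal Omega : set symbol :=
  [set f | exists2 a, crossed_ideal Omega a & is_symbol_of a f].

(* The element (F (x) id) f of the crossed product, for f in [frakD]. *)
Definition partial_fourier f : crossed R Xi :=
  xget 0 [set a | is_symbol_of a f].

Definition Op f : H -> H :=
  fun u => fourierL2_inv (sch (partial_fourier f) (fourierL2 u)).

Definition continuous_linfty f : Prop :=
  (forall x, linfty (f x)) /\ continuous (f : X -> {uniform Xi -> R[i]}).

Definition OSC (zeta : Xi) f : symbol :=
  fun x xi => f x (xi + zeta) - f x xi.

Definition VO Omega : set symbol :=
  [set f | frakD f /\ forall zeta, frakD_ideal Omega (OSC zeta f)].

Definition bbD : set (H -> H) := Op @` frakD.

Definition bbD_ideal Omega : set (H -> H) := Op @` frakD_ideal Omega.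

(* The class of A in bbD / bbD_ideal, as the coset A + bbD_ideal, and the     *)
(* quotient norm.                                                             *)
Definition quot_class Omega (A : H -> H) : set (H -> H) :=
  [set A + L | L in bbD_ideal Omega].

Definition quot_norm (Q : set (H -> H)) : \bar R :=
  ereal_inf [set opnorm A | A in Q].

Definition opdist (A : H -> H) (D : set (H -> H)) : \bar R :=
  ereal_inf [set opnorm (A - L) | L in D].

(* The suprema decrease along the filter of neighbourhoods of Omega, so their *)
(* limit is their infimum.                                                    *)
Definition limsup_at Omega f : \bar R :=
  ereal_inf [set ereal_sup [set (modc (f z.1 z.2))%:E | z in
                              [set z : X * Xi | V (beta_pt z.2)]]
            | V in set_nbhs Omega].

End quantization.

Arguments Op {R X} mu f.
Arguments bbD {R X} mu.
Arguments bbD_ideal {R X} mu Omega.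
Arguments quot_class {R X} mu Omega A.

(* Main.v *)
(* Let c >= |Op f - Op g| with g in the ideal of Omega.  In the basis of      *)
(* characters, Op f - Op g has the matrix                                     *)
(*   f(., eta)^(xi - eta) - g(., eta)^(xi - eta),                             *)
(* and translating both indices by zeta does not change the bound c.  Let     *)
(* zeta tend to a point p of Omega along the ultrafilter p.  As X is compact  *)
(* and x |-> f(x, .) is continuous for the uniform norm, f(., zeta) tends     *)
(* uniformly to a continuous function F; the oscillations of f and the        *)
(* coefficients of g vanish on Omega, so the limit matrix is F^(xi - eta).    *)
(* Hence |int F |W|^2| <= c int |W|^2 for every trigonometric polynomial W,   *)
(* and polynomials W that peak at a point give |F| <= c.  So |f(., zeta)| is  *)
(* at most c + e for zeta in a neighbourhood of Omega.                        *)
(*                                                                            *)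
(* Two facts make this work.  The matrix norm is a C*-seminorm on             *)
(* l^1, hence it is dominated by the enveloping norm; this makes sense of the *)
(* coefficients of an element of the crossed product.  The Fourier transform  *)
(* on L^2(X) is injective and characters separate points: for a continuous v  *)
(* with no Fourier coefficient, nearly optimal unit vectors w of the map      *)
(* w |-> |corr g g|_2 with g = corr v w have correlations corr g g that are   *)
(* nearly translation covariant, and a uniform limit of these is a multiple   *)
(* of a character, which is absurd.  No product measure is used, since the    *)
(* Borel algebra of X * X may be larger than the product algebra.             *)
Require Import Defs.
From HB Require Import structures.
From mathcomp Require Import all_boot all_order all_algebra.
From mathcomp Require Import all_classical all_reals all_analysis.
From mathcomp Require Import measurable_realfun ring_quotient complex.
From mathcomp Require Import finmap ring lra.
Set Implicit Arguments.
Unset Strict Implicit.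
Unset Printing Implicit Defensive.
Import Order.TTheory GRing.Theory Num.Theory.
Import numFieldNormedType.Exports.
Local Open Scope classical_set_scope.
Local Open Scope ring_scope.

(** * Complex numbers and square-integrable functions *)

(** The distance from Op f to the ideal is the infimum of |Op f - Op g| over g in the symbol ideal,
    so it suffices to show that any finite bound c of one such norm also bounds the limsup of |f| at
    Omega. In the orthonormal basis of characters the bound c is a property of finite pieces of a
    matrix ([opnorm_bounded_form]). It is unchanged when both indices are translated by zeta
    ([bounded_form_reindex]), and it survives entrywise limits ([bounded_form_cvg]).

    Let zeta run along an ultrafilter p in Omega. The contribution of g disappears ([ideal_coef]),
    the differences f(., zeta + eta) - f(., zeta) disappear because the oscillations of f lie in the
    ideal, and f(., zeta) converges uniformly to a continuous F ([slice_limit]). What is left is the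
    Toeplitz matrix of multiplication by F ([slice_limit_form]). A multiplication operator bounded
    by c has a symbol bounded by c: one tests it on trigonometric polynomials concentrated near a
    point ([trig_peak], [sup_le_trig], [slice_limit_le]). Since this holds at every p in Omega, |f|
    <= c + e on the trace of a neighbourhood of Omega ([limsup_le]).

    Two foundations are needed. Elements of the crossed product are classes of Cauchy sequences;
    they acquire coefficients and a matrix because the Schrodinger norm is a C*-seminorm
    ([sch_norm_cstar], [env_bounded], [repr_close], [pi_close], [sch_coef]). And Op involves the
    inverse Fourier transform, so injectivity on L^2 is required ([fourier_eq0]); with the
    separation of points ([characters_separate]) it is reduced to continuous functions
    ([continuous_fourier_eq0]), where a variational argument produces a character at which a nonzero
    v has a nonzero coefficient.

    The equality of quotient norm and distance is the symmetry of the ideal under L |-> -L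
    ([bbD_idealN]). *)

Section complex_facts.
Context {R : realType}.
Implicit Types z w : R[i].

Lemma cRe_D z w : complex.Re (z + w) = complex.Re z + complex.Re w.
Proof. by case: z w => [? ?] [? ?]. Qed.
Lemma cIm_D z w : complex.Im (z + w) = complex.Im z + complex.Im w.
Proof. by case: z w => [? ?] [? ?]. Qed.
Lemma cRe_N z : complex.Re (- z) = - complex.Re z.
Proof. by case: z. Qed.
Lemma cIm_N z : complex.Im (- z) = - complex.Im z.
Proof. by case: z. Qed.
Lemma cRe_M z w : complex.Re (z * w) =
  complex.Re z * complex.Re w - complex.Im z * complex.Im w.
Proof. by case: z w => [? ?] [? ?]. Qed.
Lemma cIm_M z w : complex.Im (z * w) =
  complex.Re z * complex.Im w + complex.Im z * complex.Re w.
Proof. by case: z w => [? ?] [? ?]. Qed.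
Lemma cRe_conj z : complex.Re (z^*)%C = complex.Re z.
Proof. by case: z. Qed.
Lemma cIm_conj z : complex.Im (z^*)%C = - complex.Im z.
Proof. by case: z. Qed.

Definition cE := (cRe_D, cIm_D, cRe_N, cIm_N, cRe_M, cIm_M, cRe_conj, cIm_conj).

Lemma complexP z w :
  complex.Re z = complex.Re w -> complex.Im z = complex.Im w -> z = w.
Proof. by case: z w => [? ?] [? ?] /= -> ->. Qed.

Lemma modcM z w : modc (z * w) = modc z * modc w.
Proof. exact: ComplexField.Normc.normcM. Qed.
Lemma modc0 : modc (0 : R[i]) = 0.
Proof. exact: ComplexField.Normc.normc0. Qed.
Lemma modc1 : modc (1 : R[i]) = 1.
Proof. exact: ComplexField.Normc.normc1. Qed.
Lemma modc_eq0 z : modc z = 0 -> z = 0.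
Proof. exact: ComplexField.Normc.eq0_normc. Qed.
Lemma modc_conj z : modc (z^*)%C = modc z.
Proof. by case: z => a b /=; rewrite sqrrN. Qed.
Lemma modcB z w : modc (z - w) = modc (w - z).
Proof. by rewrite -modcN opprB. Qed.
Lemma modc_real (r : R) : modc (r%:C)%C = `|r|.
Proof. by rewrite /= expr0n addr0 sqrtr_sqr. Qed.
Lemma le_modcB z w : modc (z - w) <= modc z + modc w.
Proof. by rewrite (le_trans (le_modcD _ _))// modcN. Qed.
Lemma le_modcBD w z z' : modc (z - z') <= modc (z - w) + modc (w - z').
Proof. by rewrite (_ : z - z' = (z - w) + (w - z')) ?le_modcD// addrA subrK. Qed.
Lemma le_modc_sub z w : modc z <= modc w + modc (z - w).
Proof. by rewrite -{1}(subrK w z) addrC le_modcD. Qed.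

Lemma ler_modc_Re z : `|complex.Re z| <= modc z.
Proof.
case: z => a b /=; rewrite -[leLHS]sqrtr_sqr ler_wsqrtr// lerDl; exact: sqr_ge0.
Qed.
Lemma ler_modc_Im z : `|complex.Im z| <= modc z.
Proof.
case: z => a b /=; rewrite -[leLHS]sqrtr_sqr ler_wsqrtr// lerDr; exact: sqr_ge0.
Qed.
Lemma le_modc_ReIm z : modc z <= `|complex.Re z| + `|complex.Im z|.
Proof.
rewrite -(@ler_pXn2r _ 2)// ?nnegrE ?modc_ge0 ?addr_ge0//.
rewrite modc_sqr sqrrD !real_normK ?num_real//.
have := mulr_ge0 (normr_ge0 (complex.Re z)) (normr_ge0 (complex.Im z)); lra.
Qed.
Lemma mulc_conj z : z * (z^*)%C = ((modc z ^+ 2)%:C)%C.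
Proof.
apply: complexP; rewrite !cE/= ?modc_sqr; first by ring.
by ring.
Qed.
(** Rotating an integral onto the positive axis turns its modulus into a real part;
    [le_modc_cintegral] rests on this. *)
Lemma modc_rotate z : exists2 c, modc c = 1 & c * z = ((modc z)%:C)%C.
Proof.
have [->|z0] := eqVneq z 0.
  by exists 1; rewrite ?modc1// mulr0 modc0.
have m0 : modc z != 0 by apply: contra_neq z0 => /modc_eq0.
exists ((z^*)%C * ((modc z)^-1%:C)%C).
  by rewrite modcM modc_conj modc_real ger0_norm ?invr_ge0 ?modc_ge0// mulfV.
rewrite mulrAC [_ * z]mulrC mulc_conj -rmorphM/=; congr (_%:C)%C.
by rewrite expr2 mulfK.
Qed.

Lemma modc_sum (I : Type) (s : seq I) (P : pred I) (F : I -> R[i]) :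
  modc (\sum_(i <- s | P i) F i) <= \sum_(i <- s | P i) modc (F i).
Proof.
elim/big_ind2 : _ => [|a b c d h1 h2|//]; first by rewrite modc0.
by rewrite (le_trans (le_modcD _ _))// lerD.
Qed.

End complex_facts.

Section cmeas.
Context d (T : measurableType d) (R : realType).
Implicit Types f g : T -> R[i].

Definition cmeasurable f :=
  measurable_fun setT (@complex.Re R \o f) /\
  measurable_fun setT (@complex.Im R \o f).

Lemma cmeasurable_cst z : cmeasurable (fun=> z).
Proof. by split; exact: measurable_cst. Qed.

Lemma cmeasurableD f g : cmeasurable f -> cmeasurable g ->
  cmeasurable (fun x => f x + g x).
Proof.
move=> [fr fi] [gr gi]; split; rewrite /comp; under eq_fun do rewrite cE;
  exact: measurable_funD.
Qed.

Lemma cmeasurableM f g : cmeasurable f -> cmeasurable g ->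
  cmeasurable (fun x => f x * g x).
Proof.
move=> [fr fi] [gr gi]; split; rewrite /comp; under eq_fun do rewrite cE.
  by apply: measurable_funB; exact: measurable_funM.
by apply: measurable_funD; exact: measurable_funM.
Qed.

Lemma cmeasurable_conj f : cmeasurable f -> cmeasurable (fun x => (f x)^*%C).
Proof.
move=> [fr fi]; split; rewrite /comp; under eq_fun do rewrite cE; first exact: fr.
exact: measurable_funN.
Qed.

Lemma cmeasurable_modc f : cmeasurable f ->
  measurable_fun setT (fun x => modc (f x)).
Proof.
move=> [fr fi].
have -> : (fun x => modc (f x)) = (@Num.sqrt R) \o (fun x => modc (f x) ^+ 2).
  by apply/funext => x /=; rewrite sqrtr_sqr ger0_norm// modc_ge0.
apply: measurableT_comp; last exact: measurable_modc_sqr.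
by apply: continuous_measurable_fun; exact: sqrt_continuous.
Qed.

End cmeas.

(** * Complex integrals, means and the L^2 inner product over a probability measure *)

Section cint.
Context d (T : measurableType d) (R : realType).
Variable mu : probability T R.
Implicit Types f g : T -> R[i].

Definition rint (f : T -> R) := mu.-integrable setT (EFin \o f).

Definition cint f := rint (@complex.Re R \o f) /\ rint (@complex.Im R \o f).

Lemma rint_measurable (f : T -> R) : rint f -> measurable_fun setT f.
Proof. by move=> /integrableP[/measurable_EFinP]. Qed.

Lemma cint_measurable f : cint f -> cmeasurable f.
Proof. by move=> [/rint_measurable ? /rint_measurable ?]. Qed.

Lemma rint_le (f g : T -> R) : measurable_fun setT f -> rint g ->
  (forall x, `|f x| <= g x) -> rint f.
Proof.
move=> mf ig fg; apply: (le_integrable measurableT _ _ ig).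
  exact/measurable_EFinP.
by move=> x _ /=; rewrite lee_fin (le_trans (fg x))// ler_norm.
Qed.

Lemma rintD (f g : T -> R) : rint f -> rint g -> rint (fun x => f x + g x).
Proof. by move=> hf hg; exact: (@integrableD _ _ _ mu setT measurableT _ _ hf hg). Qed.

Lemma rintZ (r : R) (f : T -> R) : rint f -> rint (fun x => r * f x).
Proof. by move=> hf; exact: (@integrableZl _ _ _ mu setT measurableT r _ hf). Qed.

Lemma rint_cst (r : R) : rint (fun=> r).
Proof.
apply: measurable_bounded_integrable => //.
- by apply: le_lt_trans (probability_le1 mu measurableT) _; rewrite ltry.
- exact: bounded_cst.
Qed.

Lemma cint_le f (g : T -> R) : cmeasurable f -> rint g ->
  (forall x, modc (f x) <= g x) -> cint f.
Proof.
move=> [fr fi] ig fg; split; apply: rint_le ig _ => //= x;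
  rewrite (le_trans _ (fg x))//; [exact: ler_modc_Re|exact: ler_modc_Im].
Qed.

Lemma cint_bounded f (B : R) : cmeasurable f ->
  (forall x, modc (f x) <= B) -> cint f.
Proof. by move=> mf; apply: cint_le => //; exact: rint_cst. Qed.

Lemma cint_modc f : cint f -> rint (fun x => modc (f x)).
Proof.
move=> hf; have mf := cint_measurable hf; case: hf => hr hi.
have h := @rint_le _ _ _ (rintD (integrable_abse hr) (integrable_abse hi)).
apply: h => [|x /=]; first exact: cmeasurable_modc.
by rewrite ger0_norm ?modc_ge0// le_modc_ReIm.
Qed.

Lemma cint_cst z : cint (fun=> z).
Proof. by split; exact: rint_cst. Qed.

Lemma cintD f g : cint f -> cint g -> cint (fun x => f x + g x).
Proof.
move=> [fr fi] [gr gi]; split; rewrite /rint /comp; under eq_fun do rewrite cE;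
  exact: rintD.
Qed.

Lemma cint_Mbounded f g (B : R) : cmeasurable f -> (forall x, modc (f x) <= B) ->
  cint g -> cint (fun x => f x * g x).
Proof.
move=> mf fB ig; have mg := cint_measurable ig.
apply: (@cint_le _ (fun x => B * modc (g x))).
- exact: cmeasurableM.
- by apply: rintZ; exact: cint_modc.
- by move=> x; rewrite modcM ler_wpM2r// modc_ge0.
Qed.

Lemma cintZ z f : cint f -> cint (fun x => z * f x).
Proof.
by move=> hf; apply: (@cint_Mbounded _ _ (modc z)) => //; exact: cmeasurable_cst.
Qed.

Lemma cintN f : cint f -> cint (fun x => - f x).
Proof. by move=> /(@cintZ (-1)); under eq_fun do rewrite mulN1r. Qed.

Lemma cintB f g : cint f -> cint g -> cint (fun x => f x - g x).
Proof. by move=> hf hg; apply: cintD => //; exact: cintN. Qed.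

Lemma cint_conj f : cint f -> cint (fun x => (f x)^*%C).
Proof.
move=> hf; apply: (@cint_le _ (fun x => modc (f x))).
- exact/cmeasurable_conj/cint_measurable.
- exact: cint_modc.
- by move=> x; rewrite modc_conj.
Qed.

Lemma cint_sum (I : Type) (s : seq I) (F : I -> T -> R[i]) :
  (forall i, cint (F i)) -> cint (fun x => \sum_(i <- s) F i x).
Proof.
move=> hF; elim: s => [|i s ih].
  by under eq_fun do rewrite big_nil; exact: cint_cst.
by under eq_fun do rewrite big_cons; exact: cintD.
Qed.

Lemma cintegral_cst z : cintegral mu (fun=> z) = z.
Proof.
apply: complexP => /=; rewrite /comp Rintegral_cst//= probability_setT mulr1//.
Qed.

Lemma cintegralD f g : cint f -> cint g ->
  cintegral mu (fun x => f x + g x) = cintegral mu f + cintegral mu g.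
Proof.
move=> [fr fi] [gr gi]; apply: complexP; rewrite cE /=;
  rewrite -RintegralD//; apply: eq_Rintegral => x _ /=; by rewrite cE.
Qed.

Lemma cintegralZ z f : cint f ->
  cintegral mu (fun x => z * f x) = z * cintegral mu f.
Proof.
move=> [fr fi]; apply: complexP; rewrite cE /=.
  rewrite -2?RintegralZl// -RintegralB//; [|exact: rintZ..].
  by apply: eq_Rintegral => x _ /=; rewrite cE.
rewrite -2?RintegralZl// -RintegralD//; [|exact: rintZ..].
by apply: eq_Rintegral => x _ /=; rewrite cE.
Qed.

Lemma cintegralN f : cint f ->
  cintegral mu (fun x => - f x) = - cintegral mu f.
Proof.
move=> hf; rewrite -mulN1r -cintegralZ//.
by congr cintegral; apply/funext => x; rewrite mulN1r.
Qed.

Lemma cintegralB f g : cint f -> cint g ->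
  cintegral mu (fun x => f x - g x) = cintegral mu f - cintegral mu g.
Proof. by move=> hf hg; rewrite cintegralD ?cintegralN//; exact: cintN. Qed.

Lemma cintegral_conj f : cint f ->
  cintegral mu (fun x => (f x)^*%C) = (cintegral mu f)^*%C.
Proof.
move=> [fr fi]; apply: complexP; rewrite cE /=.
  by apply: eq_Rintegral => x _ /=; rewrite cE.
rewrite -mulN1r -RintegralZl//; apply: eq_Rintegral => x _ /=.
by rewrite cE mulN1r.
Qed.

Lemma cintegral_sum (I : Type) (s : seq I) (F : I -> T -> R[i]) :
  (forall i, cint (F i)) ->
  cintegral mu (fun x => \sum_(i <- s) F i x) = \sum_(i <- s) cintegral mu (F i).
Proof.
move=> hF; elim: s => [|i s ih].
  by under eq_fun do rewrite big_nil; rewrite big_nil cintegral_cst.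
under eq_fun do rewrite big_cons.
by rewrite big_cons cintegralD ?ih//; exact: cint_sum.
Qed.

Definition mean (f : T -> R) : R := Rintegral mu setT f.

Lemma mean_le (f g : T -> R) : rint f -> rint g -> (forall x, f x <= g x) ->
  mean f <= mean g.
Proof. by move=> hf hg fg; apply: le_Rintegral => // x _; exact: fg. Qed.

Lemma mean_cst r : mean (fun=> r) = r.
Proof. by rewrite /mean Rintegral_cst//= probability_setT mulr1. Qed.

Lemma meanD (f g : T -> R) : rint f -> rint g ->
  mean (fun x => f x + g x) = mean f + mean g.
Proof. by move=> hf hg; exact: RintegralD. Qed.

Lemma meanZ r (f : T -> R) : rint f -> mean (fun x => r * f x) = r * mean f.
Proof. by move=> hf; exact: RintegralZl. Qed.

Lemma mean_ge0 (f : T -> R) : (forall x, 0 <= f x) -> 0 <= mean f.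
Proof. by move=> h; apply: Rintegral_ge0 => x _. Qed.

Lemma cintegral_mean (f : T -> R) : rint f ->
  cintegral mu (fun x => (f x)%:C%C) = ((mean f)%:C)%C.
Proof.
move=> hf; apply: complexP => //=; rewrite -[RHS](mean_cst 0).
by apply: eq_Rintegral.
Qed.

Lemma le_modc_cintegral f : cint f ->
  modc (cintegral mu f) <= mean (fun x => modc (f x)).
Proof.
move=> hf; have [c c1 cz] := modc_rotate (cintegral mu f).
have := cintegralZ c hf; rewrite cz => /(congr1 (@complex.Re R)) /= <-.
have hcf := cintZ c hf; apply: le_Rintegral => //; first exact: hcf.1.
  exact: cint_modc.
move=> x _ /=; rewrite (le_trans (ler_norm _))// (le_trans (ler_modc_Re _))//.
by rewrite modcM c1 mul1r.
Qed.

Lemma modc_cintegral_le f (g : T -> R) : cmeasurable f -> rint g ->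
  (forall x, modc (f x) <= g x) -> modc (cintegral mu f) <= mean g.
Proof.
move=> mf ig fg; have hf := cint_le mf ig fg.
by rewrite (le_trans (le_modc_cintegral hf))// mean_le//; exact: cint_modc.
Qed.

Lemma modc_cintegral_bound f (B : R) : cmeasurable f ->
  (forall x, modc (f x) <= B) -> modc (cintegral mu f) <= B.
Proof.
by move=> mf fB; rewrite -[leRHS]mean_cst modc_cintegral_le//; exact: rint_cst.
Qed.

Definition sqn f : R := mean (fun x => modc (f x) ^+ 2).

Definition ip f g : R[i] := cintegral mu (fun x => f x * (g x)^*%C).

Definition sqint_fun f := cmeasurable f /\ rint (fun x => modc (f x) ^+ 2).

Lemma sqn_ge0 f : 0 <= sqn f.
Proof. by apply: mean_ge0 => x; exact: sqr_ge0. Qed.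

Lemma sqint_bounded f (B : R) : cmeasurable f -> (forall x, modc (f x) <= B) ->
  sqint_fun f.
Proof.
move=> mf fB; split=> //; apply: (@rint_le _ (fun=> B ^+ 2)).
- by apply: measurable_funX; exact: cmeasurable_modc.
- exact: rint_cst.
- move=> x; rewrite ger0_norm ?sqr_ge0//.
  by rewrite ler_sqr ?nnegrE ?modc_ge0// (le_trans _ (fB x))// modc_ge0.
Qed.

Lemma sqint_M f g : sqint_fun f -> sqint_fun g -> cint (fun x => f x * g x).
Proof.
move=> [mf fs] [mg gs].
apply: (@cint_le _ (fun x => modc (f x) ^+ 2 + modc (g x) ^+ 2)).
- exact: cmeasurableM.
- exact: rintD.
- move=> x; rewrite modcM.
  have := sqr_ge0 (modc (f x) - modc (g x)); nra.
Qed.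

Lemma sqint_conj f : sqint_fun f -> sqint_fun (fun x => (f x)^*%C).
Proof.
move=> [mf fs]; split; first exact: cmeasurable_conj.
by under eq_fun do rewrite modc_conj.
Qed.

Lemma sqintD f g : sqint_fun f -> sqint_fun g -> sqint_fun (fun x => f x + g x).
Proof.
move=> [mf fs] [mg gs]; have mfg := cmeasurableD mf mg; split => //.
apply: (@rint_le _ (fun x => 2 * modc (f x) ^+ 2 + 2 * modc (g x) ^+ 2)).
- by apply: measurable_funX; exact: cmeasurable_modc.
- by apply: rintD; exact: rintZ.
- move=> x; rewrite ger0_norm ?sqr_ge0//.
  have := le_modcD (f x) (g x); have := modc_ge0 (f x + g x).
  have := sqr_ge0 (modc (f x) - modc (g x)); nra.
Qed.

Lemma sqint_Mbounded f g (B : R) : cmeasurable f -> (forall x, modc (f x) <= B) ->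
  sqint_fun g -> sqint_fun (fun x => f x * g x).
Proof.
move=> mf fB [mg gs]; have mfg := cmeasurableM mf mg; split => //.
apply: (@rint_le _ (fun x => B ^+ 2 * modc (g x) ^+ 2)).
- by apply: measurable_funX; exact: cmeasurable_modc.
- exact: rintZ.
- move=> x; rewrite ger0_norm ?sqr_ge0// modcM exprMn ler_wpM2r ?sqr_ge0//.
  by rewrite ler_sqr ?nnegrE ?modc_ge0// (le_trans _ (fB x))// modc_ge0.
Qed.

Lemma sqintZ z g : sqint_fun g -> sqint_fun (fun x => z * g x).
Proof. by apply: (@sqint_Mbounded _ _ (modc z)) => //; exact: cmeasurable_cst. Qed.

Lemma sqint_cst z : sqint_fun (fun=> z).
Proof. by apply: (@sqint_bounded _ (modc z)) => //; exact: cmeasurable_cst. Qed.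

Lemma sqintN g : sqint_fun g -> sqint_fun (fun x => - g x).
Proof. by move=> /(@sqintZ (-1)); under eq_fun do rewrite mulN1r. Qed.

Lemma sqintB f g : sqint_fun f -> sqint_fun g -> sqint_fun (fun x => f x - g x).
Proof. by move=> hf hg; apply: sqintD => //; exact: sqintN. Qed.

Lemma sqint_sum (I : Type) (s : seq I) (F : I -> T -> R[i]) :
  (forall i, sqint_fun (F i)) -> sqint_fun (fun x => \sum_(i <- s) F i x).
Proof.
move=> hF; elim: s => [|i s ih].
  by under eq_fun do rewrite big_nil; exact: sqint_cst.
by under eq_fun do rewrite big_cons; exact: sqintD.
Qed.

Lemma sqint_cint f : sqint_fun f -> cint f.
Proof.
move=> hf; have := sqint_M (sqint_cst 1) hf.
by under eq_fun do rewrite mul1r.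
Qed.

Lemma cint_ip f g : sqint_fun f -> sqint_fun g -> cint (fun x => f x * (g x)^*%C).
Proof. by move=> hf hg; apply: sqint_M => //; exact: sqint_conj. Qed.

Lemma ip_self f : sqint_fun f -> ip f f = ((sqn f)%:C)%C.
Proof.
move=> [mf hf]; rewrite /ip; under eq_fun do rewrite mulc_conj.
exact: cintegral_mean.
Qed.

Lemma ip_conj f g : sqint_fun f -> sqint_fun g -> (ip f g)^*%C = ip g f.
Proof.
move=> hf hg; rewrite /ip -cintegral_conj; last exact: cint_ip.
congr cintegral; apply/funext => x; apply: complexP; rewrite !cE; ring.
Qed.

Lemma ipDl f g h : sqint_fun f -> sqint_fun g -> sqint_fun h ->
  ip (fun x => f x + g x) h = ip f h + ip g h.
Proof.
move=> hf hg hh; rewrite /ip -cintegralD; [|exact: cint_ip..].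
by congr cintegral; apply/funext => x; rewrite mulrDl.
Qed.

Lemma ipZl z f h : sqint_fun f -> sqint_fun h ->
  ip (fun x => z * f x) h = z * ip f h.
Proof.
move=> hf hh; rewrite /ip -cintegralZ; last exact: cint_ip.
by congr cintegral; apply/funext => x; rewrite mulrA.
Qed.

Lemma ipDr f g h : sqint_fun f -> sqint_fun g -> sqint_fun h ->
  ip h (fun x => f x + g x) = ip h f + ip h g.
Proof.
move=> hf hg hh; rewrite /ip -cintegralD; [|exact: cint_ip..].
by congr cintegral; apply/funext => x; rewrite rmorphD mulrDr.
Qed.

Lemma ipZr z f h : sqint_fun f -> sqint_fun h ->
  ip h (fun x => z * f x) = (z^*)%C * ip h f.
Proof.
move=> hf hh; rewrite /ip -cintegralZ; last exact: cint_ip.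
by congr cintegral; apply/funext => x; rewrite rmorphM mulrCA.
Qed.

Lemma sqnD f g : sqint_fun f -> sqint_fun g ->
  sqn (fun x => f x + g x) = sqn f + sqn g + 2 * complex.Re (ip f g).
Proof.
move=> hf hg.
have h1 := ip_self (sqintD hf hg).
have -> : sqn (fun x => f x + g x) =
    complex.Re (ip (fun x => f x + g x) (fun x => f x + g x)) by rewrite h1.
rewrite ipDl// ?ipDr//; [|exact: sqintD..].
rewrite -(ip_conj hf hg) !ip_self// !cE/=; ring.
Qed.

Lemma sqnZ z f : sqint_fun f -> sqn (fun x => z * f x) = modc z ^+ 2 * sqn f.
Proof.
move=> [mf hf]; rewrite /sqn -meanZ//; congr mean; apply/funext => x.
by rewrite modcM exprMn.
Qed.

Lemma sqn_lin (a b : R[i]) f g : sqint_fun f -> sqint_fun g ->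
  sqn (fun x => a * f x + b * g x) = modc a ^+ 2 * sqn f + modc b ^+ 2 * sqn g +
    2 * complex.Re (a * (b^*)%C * ip f g).
Proof.
move=> hf hg; rewrite (sqnD (sqintZ a hf) (sqintZ b hg)) !sqnZ//.
by rewrite (ipZl a hf (sqintZ b hg)) (ipZr b hg hf) mulrA.
Qed.

(** The cross term is controlled by the positivity of the squared norm of f - b g. *)
Lemma sqn_le_lin (b : R[i]) f g : modc b = 1 -> sqint_fun f -> sqint_fun g ->
  sqn (fun x => f x + b * g x) <= 2 * sqn f + 2 * sqn g.
Proof.
move=> b1 hf hg; rewrite (sqnD hf (sqintZ b hg)) sqnZ// b1 (ipZr b hg hf).
have := sqn_ge0 (fun x => 1 * f x + (- b) * g x).
rewrite sqn_lin// modcN modc1 b1 mul1r rmorphN mulNr cRe_N; lra.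
Qed.

Lemma mean_modc_le f : sqint_fun f -> mean (fun x => modc (f x)) <= (1 + sqn f) / 2.
Proof.
move=> hf; have hc := cint_modc (sqint_cint hf); case: hf => mf hf.
rewrite ler_pdivlMr// mulrC -meanZ// -[X in X + _](mean_cst 1) -meanD//; last exact: rint_cst.
apply: mean_le.
- exact: rintZ.
- by apply: rintD => //; exact: rint_cst.
- by move=> x; have := sqr_ge0 (modc (f x) - 1); nra.
Qed.

End cint.

(** * Continuous functions on a compact group *)

(** The norm of R[i] takes its values in R[i]; here the tolerances are real, as in all later
    estimates. *)
Lemma cvgcP (R : realType) (T : Type) (F : set_system T) {FF : Filter F}
    (f : T -> R[i]) (z : R[i]) :
  f @ F --> z <-> forall e : R, 0 < e -> \forall t \near F, modc (z - f t) <= e.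
Proof.
split.
- move=> /cvgrPdist_le h e e0.
  have := h (e%:C)%C; rewrite ltcR => /(_ e0).
  by apply: filterS => t; rewrite -modc_normE lecR.
- move=> h; apply/cvgrPdist_le => -[a b].
  rewrite ltcE /= => /andP[/eqP -> a0].
  have := h _ a0; apply: filterS => t.
  by rewrite -modc_normE lecR.
Qed.

Lemma ultra_lim (R : realType) (I : Type) (F : set_system I) (FU : UltraFilter F)
    (a : I -> R[i]) (B : R) : (forall i, modc (a i) <= B) ->
  exists z, forall e : R, 0 < e -> \forall i \near F, modc (a i - z) <= e.
Proof.
move=> aB; have FF : Filter F by exact: @ultra_proper.
have realcase (b : I -> R) : (forall i, `|b i| <= B) ->
    exists r : R, forall e : R, 0 < e -> \forall i \near F, `|r - b i| <= e.
  move=> bB; have := @segment_compact R (- B) B; rewrite compact_ultra.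
  move=> /(_ _ (ultra_fmap b FU)) [|r [_ /cvgrPdist_le h]]; last by exists r.
  apply: (@filterE _ F FF) => i /=; rewrite in_itv/= -ler_norml; exact: bB.
have [|r hr] := realcase (fun i => complex.Re (a i)).
  by move=> i; rewrite (le_trans (ler_modc_Re _)).
have [|s hs] := realcase (fun i => complex.Im (a i)).
  by move=> i; rewrite (le_trans (ler_modc_Im _)).
exists (r +i* s)%C => e e0.
have e20 : 0 < e / 2 by rewrite divr_gt0.
near=> i.
rewrite modcB (le_trans (le_modc_ReIm _))// !cE [e]splitr lerD//=.
  by near: i; exact: hr.
by near: i; exact: hs.
Unshelve. all: by end_near. Qed.

(** Pins down X as the source, since the same functions are also read on [borel X], where
    measurability is stated. *)
Definition ccont (R : realType) (X : topologicalZmodType) (f : X -> R[i]) : Prop :=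
  continuous f.

Section compact_group.
Variables (R : realType) (X : topologicalZmodType).
Hypothesis compX : compact [set: X].
Implicit Types (f g v w : X -> R[i]).

Lemma ccontP f : ccont f <->
  forall x (e : R), 0 < e -> \forall y \near x, modc (f x - f y) <= e.
Proof.
split=> [h x e e0|h x].
  by have /cvgcP := h x; exact.
by apply/cvgcP => e e0; exact: h.
Qed.

Lemma ccont_cst (z : R[i]) : ccont (fun _ : X => z).
Proof. by move=> x; exact: cvg_cst. Qed.

Lemma ccontD f g : ccont f -> ccont g -> ccont (fun x => f x + g x).
Proof. by move=> cf cg x; apply: cvgD; [exact: cf|exact: cg]. Qed.

Lemma ccontM f g : ccont f -> ccont g -> ccont (fun x => f x * g x).
Proof. by move=> cf cg x; apply: cvgM; [exact: cf|exact: cg]. Qed.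

Lemma ccontZ (z : R[i]) f : ccont f -> ccont (fun x => z * f x).
Proof. by move=> cf x; apply: cvgM; [exact: cvg_cst|exact: cf]. Qed.

Lemma ccontB f g : ccont f -> ccont g -> ccont (fun x => f x - g x).
Proof. by move=> cf cg x; apply: cvgB; [exact: cf|exact: cg]. Qed.

Lemma ccont_conj f : ccont f -> ccont (fun x => (f x)^*%C).
Proof.
move=> /ccontP cf; apply/ccontP => x e e0; have := cf x e e0.
by apply: filterS => y; rewrite -rmorphB modc_conj.
Qed.

Lemma addr_cvg (y x : X) : (fun t => t + y) @ x --> x + y.
Proof.
apply: (@continuous_comp _ _ _ (fun t => (t, y)) (fun z : X * X => z.1 + z.2)).
  by apply: cvg_pair => /=; [exact: cvg_id|exact: cvg_cst].
exact: add_continuous.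
Qed.

Lemma ccont_shift y f : ccont f -> ccont (fun x => f (x + y)).
Proof.
move=> cf x; apply: (@continuous_comp _ _ _ (fun t => t + y) f); last exact: cf.
exact: addr_cvg.
Qed.

Lemma ccont_measurable f : ccont f ->
  cmeasurable (f : borel X -> R[i]).
Proof.
move=> /ccontP cf.
have key (g : X -> R) : continuous g -> measurable_fun setT (g : borel X -> R).
  move=> /continuousP cg; apply: (measurability _ (RGenOpens.measurableE R)).
  move=> _ [_ [a [b ->] <-]]; rewrite setTI.
  by apply: sub_sigma_algebra; apply: cg; exact: interval_open.
split; apply: key => x; apply/cvgrPdist_le => e e0; have := cf x e e0;
  apply: filterS => y; apply: le_trans => /=.
  by rewrite -cRe_N -cRe_D ler_modc_Re.
by rewrite -cIm_N -cIm_D ler_modc_Im.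
Qed.

Lemma ccont_bounded f : ccont f -> exists B, forall x, modc (f x) <= B.
Proof.
move=> /ccontP cf; have /compact_near_coveringP nc := compX.
have := nc nat \oo (fun n x => modc (f x) <= n%:R) _.
case.
- move=> x _; have := cf x 1 ltr01 => h.
  have hn : \forall n \near \oo, modc (f x) + 1 <= n%:R.
    by near=> n; near: n; exact: nbhs_infty_ger.
  exists ([set y | modc (f x - f y) <= 1], [set n | modc (f x) + 1 <= n%:R]) => //=.
  move=> [y n] /= [h1 h2]; rewrite (le_trans _ h2)//.
  by rewrite (le_trans (le_modc_sub _ (f x)))// lerD2l modcB.
- by move=> N _ /(_ N (leqnn N)) h; exists N%:R => x; exact: h.
Unshelve. all: by end_near. Qed.

(** Joint continuity of addition gives the estimate near each pair (z, x), and compactness makes the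
    neighbourhood of x independent of z. *)
Lemma unif_shift v : ccont v -> forall x (e : R), 0 < e ->
  \forall x' \near x, forall z, modc (v (z + x') - v (z + x)) <= e.
Proof.
move=> /ccontP cv x e e0; have /compact_near_coveringP nc := compX.
have := nc X (nbhs x) (fun x' z => modc (v (z + x') - v (z + x)) <= e) _.
have h : forall z, [set: X] z -> \forall z' \near z & x' \near x,
    modc (v (z' + x') - v (z' + x)) <= e.
  move=> z _; have e20 : 0 < e / 2 by rewrite divr_gt0.
  have := @add_continuous X (z, x) _ (cv (z + x) _ e20).
  case=> -[A B] /= [zA xB] AB.
  exists (A, B) => //= -[z' x'] /= [Az Bx].
  rewrite (le_trans (le_modcBD (v (z + x)) _ _))// [e]splitr lerD//.
    by rewrite modcB; exact: (AB (z', x')).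
  by apply: (AB (z', x)); split => //=; exact: nbhs_singleton.
by move=> /(_ _ h); apply: filterS => x' h' z; exact: h'.
Qed.

(** Arzela-Ascoli with an ultrafilter in place of a subsequence: boundedness gives pointwise limits,
    equicontinuity passes to the limit, and compactness makes the convergence uniform. *)
Lemma equicont_ultra_lim (I : Type) (F : set_system I) (FU : UltraFilter F)
    (phi : I -> X -> R[i]) :
  (forall x, exists B, forall i, modc (phi i x) <= B) ->
  (forall x (e : R), 0 < e -> \forall x' \near x, forall i,
     modc (phi i x' - phi i x) <= e) ->
  exists2 g, ccont g &
    forall e : R, 0 < e -> \forall i \near F, forall x, modc (phi i x - g x) <= e.
Proof.
move=> bphi ephi; have FP : ProperFilter F by exact: ultra_proper.
have /choice[g hg] x : exists z, forall e : R, 0 < e ->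
    \forall i \near F, modc (phi i x - z) <= e.
  by have [B hB] := bphi x; exact: (ultra_lim FU hB).
have cg x (e : R) : 0 < e -> \forall x' \near x, modc (g x - g x') <= e.
  move=> e0; have e30 : 0 < e / 3 by rewrite divr_gt0.
  apply: filterS (ephi x _ e30) => x' hx'.
  have [i [h1 h2]] := filter_ex (filterI (hg x _ e30) (hg x' _ e30)).
  have := hx' i; move: h1 h2; rewrite [modc (phi i x - _)]modcB => h1 h2 h3.
  have := le_modcBD (phi i x) (g x) (g x'); have := le_modcBD (phi i x') (phi i x) (g x').
  rewrite (modcB (phi i x) (phi i x')); lra.
exists g; first exact/ccontP.
move=> e e0; have /compact_near_coveringP nc := compX.
have h : forall x, [set: X] x -> \forall x' \near x & i \near F,
    modc (phi i x' - g x') <= e.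
  move=> x _; have e30 : 0 < e / 3 by rewrite divr_gt0.
  exists ([set x' | (forall i, modc (phi i x' - phi i x) <= e / 3) /\
      modc (g x - g x') <= e / 3], [set i | modc (phi i x - g x) <= e / 3]) => /=.
    by split; [exact: filterI (ephi x _ e30) (cg x _ e30)|exact: hg].
  move=> [x' i] /= [[h1 h2] h3]; have := h1 i.
  have := le_modcBD (phi i x) (phi i x') (g x'); have := le_modcBD (g x) (phi i x) (g x').
  lra.
have := nc I F (fun i x => modc (phi i x - g x) <= e) _ h.
by move=> /(_ _); apply: filterS => i hi x; exact: hi.
Qed.

End compact_group.

Arguments ccont_cst {R X} z.
Arguments ccontZ {R X} z {f}.
Arguments ccont_shift {R X} y {f}.

(** * Haar measure *)

Section haar.
Variables (R : realType) (X : topologicalZmodType) (mu : probability (borel X) R).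
Hypothesis compX : compact [set: X].
Hypothesis haar_mu : is_haar mu.
Implicit Types (f g v w : X -> R[i]).

Lemma ccont_cint f : ccont f -> cint mu f.
Proof.
move=> cf; have [B hB] := ccont_bounded compX cf.
exact: (cint_bounded _ (ccont_measurable cf) hB).
Qed.

Lemma ccont_sqint f : ccont f -> sqint_fun mu f.
Proof.
move=> cf; have [B hB] := ccont_bounded compX cf.
exact: (sqint_bounded _ (ccont_measurable cf) hB).
Qed.

Let shift (y : X) : borel X -> borel X := fun x : X => x + y.

Lemma shift_measurable y : measurable_fun setT (shift y).
Proof.
apply: (@measurability _ _ (borel X) (borel X) setT (shift y) (@open X) erefl).
move=> _ [A oA <-]; rewrite setTI; apply: sub_sigma_algebra.
by move: oA; apply: open_comp => x _; exact: addr_cvg.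
Qed.

Lemma haar_shift y (A : set (borel X)) : measurable A ->
  mu (shift y @^-1` A) = mu A.
Proof.
move=> mA; have [h _ _] := haar_mu; rewrite -[RHS](h y)//; congr (mu _).
by apply/seteqP; split=> x; rewrite /shift /= addrC.
Qed.

Lemma rint_shift y (f : borel X -> R) : rint mu f -> rint mu (f \o shift y).
Proof.
move=> hf; have mf := rint_measurable hf.
have ms := @shift_measurable y.
apply/integrableP; split; first exact/measurable_EFinP/measurableT_comp.
move/integrableP : hf => [_]; apply: le_lt_trans.
rewrite le_eqVlt; apply/orP; left; apply/eqP.
transitivity (\int[pushforward mu (shift y)]_x `|(EFin \o f) x|)%E.
  rewrite ge0_integral_pushforward//.
  by apply/measurableT_comp => //; exact/measurable_EFinP.
by apply: eq_measure_integral => A mA _; exact: haar_shift.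
Qed.

Lemma mean_shift y (f : borel X -> R) : rint mu f ->
  mean mu (f \o shift y) = mean mu f.
Proof.
move=> hf; have mf := rint_measurable hf; have ms := @shift_measurable y.
rewrite /mean /Rintegral; congr fine.
transitivity (\int[pushforward mu (shift y)]_x (EFin \o f) x)%E.
  rewrite integral_pushforward//.
  - exact/measurable_EFinP.
  - by rewrite preimage_setT; exact: (rint_shift y hf).
by apply: eq_measure_integral => A mA _; exact: haar_shift.
Qed.

Lemma cint_shift y f : cint mu f -> cint mu (fun x : X => f (x + y)).
Proof. by move=> [fr fi]; split; [exact: rint_shift fr|exact: rint_shift fi]. Qed.

Lemma cintegral_shift y f : cint mu f ->
  cintegral mu (fun x : X => f (x + y)) = cintegral mu f.
Proof.
by move=> [fr fi]; apply: complexP => /=; [exact: mean_shift fr|exact: mean_shift fi].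
Qed.

Lemma sqn_shift y f : sqint_fun mu f -> sqn mu (fun x : X => f (x + y)) = sqn mu f.
Proof. by move=> [_ hf]; exact: (mean_shift y hf). Qed.

(** If U were null, its translates would be null open sets covering X, and by compactness X itself
    would be null. *)
Lemma open_null (U : set X) x0 : open U -> U x0 -> mu U != 0%E.
Proof.
move=> oU Ux0; apply/eqP => U0.
have mshift y : measurable (shift y @^-1` (U : set (borel X))).
  rewrite -[_ @^-1` _]setTI; apply: shift_measurable => //.
  exact: sub_sigma_algebra.
have /compact_near_coveringP nc := compX.
(* Compactness is applied to the relation x' <> i with the almost-everywhere filter in i. Locally it
   holds because a translate of U is null; globally it would hold for all x' at almost every i,
   including x' = i. *)
have h : forall x, [set: X] x -> \forall x' \near x & i \near almost_everywhere mu,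
    x' <> i :> X.
  move=> x _.
  exists (shift (x0 - x) @^-1` U, ~` (shift (x0 - x) @^-1` U)) => /=.
    split; last first.
      rewrite /nbhs /= /almost_everywhere /= setCK.
      apply/negligibleP; first exact: mshift.
      apply: etrans U0; apply: haar_shift; exact: sub_sigma_algebra.
    have : nbhs (x + (x0 - x)) U by rewrite addrC subrK; exact: open_nbhs_nbhs.
    by move=> h; exact: (@addr_cvg X (x0 - x) x _ h).
  by move=> [x' i] /= [h1 h2] xi; rewrite xi in h1.
have := nc X (almost_everywhere mu) (fun i x' => x' <> i :> X) _ h.
have FA : Filter (almost_everywhere mu) by typeclasses eauto.
move=> /(_ FA) [N [mN N0 sN]].
have : N = setT.
  by apply/seteqP; split=> // x _; apply: sN => /= /(_ x I).
move=> NT; move: N0; rewrite NT probability_setT => /eqP.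
by rewrite onee_eq0.
Qed.

Lemma sqn_eq0 f : ccont f -> sqn mu f = 0 -> forall x, f x = 0.
Proof.
move=> cf f0 x; have [mf sf] := ccont_sqint cf.
apply: modc_eq0; apply/eqP; rewrite eq_le modc_ge0 andbT leNgt; apply/negP => fx.
have mfe : measurable_fun setT (EFin \o (fun x : borel X => modc (f x) ^+ 2)).
  by apply/measurable_EFinP; exact: rint_measurable sf.
have : (\int[mu]_x `|(modc (f x) ^+ 2)%:E| = 0)%E.
  under eq_integral do rewrite gee0_abs ?lee_fin ?sqr_ge0//.
  move: f0; rewrite /sqn /mean /Rintegral => /eqP; rewrite fine_eq0 => [/eqP//|].
  exact: integrable_fin_num.
move/(ae_eq_integral_abs mu measurableT mfe) => [N [mN N0 sN]].
have /ccontP ccf := cf.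
have := ccf x (modc (f x) / 2) (divr_gt0 fx (ltr0n _ 2)).
rewrite /prop_near1 nbhsE => -[U [oU Ux] sU].
have /eqP := open_null oU Ux; apply; apply/eqP.
rewrite eq_le measure_ge0 andbT -N0 le_measure//.
- by apply: mem_set; exact: sub_sigma_algebra.
- exact: mem_set.
- move=> y Uy; apply: sN => /= /(_ I) [] /eqP; rewrite sqrf_eq0 => /eqP fy0.
  have := sU _ Uy; rewrite (modc_eq0 fy0) subr0; lra.
Qed.

End haar.

(** * Riemann sums and correlations *)

Section convolution.
Variables (R : realType) (X : topologicalZmodType) (mu : probability (borel X) R).
Hypothesis compX : compact [set: X].
Hypothesis haar_mu : is_haar mu.
Implicit Types (f g v w phi : X -> R[i]).

Section step_functions.
Variable V : X -> set X.
Hypothesis oV : forall x, open (V x).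

Fixpoint step phi (s : seq X) (x : X) : R[i] :=
  if s is t :: s' then if x \in V t then phi t else step phi s' x else 0.

(** The weights are the measures of the pieces that the sets V t cut successively out of W, so they
    do not involve phi. The induction passes from W to W minus V t, hence the general W. *)
Lemma step_integral (s : seq X) (W : set (borel X)) : measurable W ->
  exists p : nat -> R[i], forall phi,
    cint mu (fun x : borel X => (\1_W x)%:C%C * step phi s x) /\
    cintegral mu (fun x : borel X => (\1_W x)%:C%C * step phi s x) =
      \sum_(k < size s) p k * phi (nth 0 s k).
Proof.
elim: s W => [|t s ih] W mW /=.
  exists (fun=> 0) => phi; rewrite big_ord0; under eq_fun do rewrite mulr0.
  by split; [exact: cint_cst|rewrite cintegral_cst].
have mV : measurable (V t : set (borel X)) by exact: sub_sigma_algebra.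
have [p hp] := ih _ (measurableD mW mV).
have mI : measurable (W `&` V t : set (borel X)) by exact: measurableI.
have ci : cint mu (fun x : borel X => (\1_(W `&` V t) x)%:C%C).
  apply: (@cint_bounded _ _ _ _ _ 1) => [|x].
    by split; [exact: measurable_indic|exact: measurable_cst].
  by rewrite modc_real indicE; case: (_ \in _); rewrite ?normr1 ?normr0.
exists (fun k => if k is k'.+1 then p k' else
  cintegral mu (fun x : borel X => (\1_(W `&` V t) x)%:C%C)) => phi.
have -> : (fun x : borel X => (\1_W x)%:C%C *
    (if x \in V t then phi t else step phi s x)) =
  (fun x : borel X => phi t * (\1_(W `&` V t) x)%:C%C +
    (\1_(W `\` V t) x)%:C%C * step phi s x).
  apply/funext => x; rewrite !indicE in_setI in_setD.
  by case: (x \in W); case: (x \in V t) => /=; rewrite ?rmorph1 ?rmorph0; ring.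
have [h1 h2] := hp phi; split; first by apply: cintD => //; exact: cintZ.
rewrite cintegralD//; last exact: cintZ.
by rewrite cintegralZ// h2 big_ord_recl /= mulrC.
Qed.

Lemma step_approx phi (s : seq X) x (d : R) :
  (forall t, V t x -> modc (phi x - phi t) <= d) ->
  (exists2 t, t \in s & V t x) -> modc (phi x - step phi s x) <= d.
Proof.
move=> hd; elim: s => [|t s ih] [t0]; first by rewrite in_nil.
rewrite inE => /= ts Vt0; case: ifPn => [/set_mem|nt]; first exact: hd.
apply: ih; exists t0 => //; move: ts => /orP[/eqP t0t|//].
by move: nt; rewrite -t0t notin_setE.
Qed.

(* The sum depends on the cover only, so that it can be taken uniformly in a  *)
(* parameter; this replaces Fubini's theorem below.                           *)
Lemma riemann : (forall x, V x x) -> exists (s : seq X) (p : nat -> R[i]),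
  forall phi (d : R), ccont phi ->
    (forall t x, V t x -> modc (phi x - phi t) <= d) ->
    modc (cintegral mu phi - \sum_(k < size s) p k * phi (nth 0 s k)) <= d.
Proof.
move=> Vx; have := compX; rewrite compact_cover => /(_ X setT V) [|x _|D _ cD].
- by move=> x _; exact: oV.
- by exists x.
have [p hp] := step_integral (enum_fset D) measurableT.
exists (enum_fset D), p => phi d cphi hd; have [h1 h2] := hp phi.
have c1 := ccont_cint mu compX cphi.
rewrite -h2 -cintegralB//; apply: modc_cintegral_bound.
  exact: cint_measurable (cintB c1 h1).
move=> x; rewrite indicE in_setT mul1r; apply: step_approx => [t|].
  exact: hd.
by have [t /= tD Vt] := cD x I; exists t.
Qed.

End step_functions.

Lemma small_eq0 (a K : R) : 0 <= a -> 0 <= K ->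
  (forall e, 0 < e -> e <= 1 -> a <= K * e) -> a = 0.
Proof.
move=> a0 K0 h; apply/eqP; rewrite eq_le a0 andbT leNgt; apply/negP => a1.
have e0 : 0 < a / (2 * (a + K + 1)) by rewrite divr_gt0// mulr_gt0//; lra.
have e1 : a / (2 * (a + K + 1)) <= 1 by rewrite ler_pdivrMr; nra.
have := h _ e0 e1; rewrite mulrA ler_pdivlMr; last by lra.
nra.
Qed.

(** Both sides are compared with the same Riemann sum in x. Equicontinuity of K, uniform in y, makes
    one choice of nodes and weights good for x |-> K x y at every y and for the inner integral G; a
    finite sum commutes with the integral in y. *)
Lemma fubini_equicont (K : X -> X -> R[i]) (u : X -> R[i]) (B : R) :
  (forall x (e : R), 0 < e ->
     \forall x' \near x, forall y, modc (K x' y - K x y) <= e) ->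
  (forall x, ccont (K x)) -> (forall x y, modc (K x y) <= B) ->
  ccont (fun y => cintegral mu (fun x : borel X => K x y)) ->
  cint mu u ->
  cintegral mu (fun x : borel X => cintegral mu (fun y : borel X => K x y * u y)) =
  cintegral mu (fun y : borel X => cintegral mu (fun x : borel X => K x y) * u y).
Proof.
move=> eqK cK bK cKi iu.
set U := mean mu (fun x => modc (u x)).
have U0 : 0 <= U by apply: mean_ge0 => x; exact: modc_ge0.
have iKu x : cint mu (fun y : borel X => K x y * u y).
  exact: cint_Mbounded (ccont_measurable (cK x)) (bK x) iu.
have KU f (e : R) : cmeasurable (f : borel X -> R[i]) -> (forall y, modc (f y) <= e) ->
    modc (cintegral mu (fun y : borel X => f y * u y)) <= e * U.
  move=> mf fe; rewrite -meanZ; last exact: cint_modc.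
  apply: modc_cintegral_le.
  - by apply: cmeasurableM => //; exact: cint_measurable iu.
  - by apply: rintZ; exact: cint_modc.
  - by move=> x; rewrite modcM ler_wpM2r// modc_ge0.
have cKx y : ccont (fun x => K x y).
  apply/ccontP => x e e0; apply: filterS (eqK x e e0) => x' h.
  by rewrite modcB; exact: h.
pose G x := cintegral mu (fun y : borel X => K x y * u y).
have GU x x' (e : R) : (forall y, modc (K x' y - K x y) <= e) ->
    modc (G x' - G x) <= e * U.
  move=> h; rewrite /G -cintegralB//.
  under eq_fun do rewrite -mulrBl.
  apply: (KU (fun y => K x' y - K x y)) => //.
  exact: ccont_measurable (ccontB (cK x') (cK x)).
have cG : ccont G.
  apply/ccontP => x e e0; have e1 : 0 < e / (U + 1) by rewrite divr_gt0//; lra.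
  apply: filterS (eqK x _ e1) => x' h; rewrite modcB (le_trans (GU _ _ _ h))//.
  by rewrite mulrAC ler_pdivrMr ?ler_wpM2l//; lra.
apply/eqP; rewrite -subr_eq0; apply/eqP; apply: modc_eq0.
apply: (@small_eq0 _ (2 * U)); [exact: modc_ge0|lra|] => e e0 _.
pose V x := interior [set x' | forall y, modc (K x' y - K x y) <= e].
have [||s [p hp]] := @riemann V.
- by move=> x; exact: open_interior.
- by move=> x; exact: eqK.
have VK t x : V t x -> forall y, modc (K x y - K t y) <= e.
  by move=> /interior_subset.
have h1 := hp G (e * U) cG (fun t x Vtx => GU _ _ _ (VK _ _ Vtx)).
have h2 y := hp (fun x => K x y) e (cKx y) (fun t x Vtx => VK _ _ Vtx y).
set S := \sum_(k < size s) p k * G (nth 0 s k) in h1.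
have eS : S = cintegral mu (fun y : borel X =>
    (\sum_(k < size s) p k * K (nth 0 s k) y) * u y).
  under eq_fun do rewrite mulr_suml.
  rewrite cintegral_sum => [|k].
    apply: eq_bigr => k _; rewrite -cintegralZ//.
    by congr cintegral; apply/funext => y; rewrite mulrA.
  by under eq_fun do rewrite -mulrA; exact: cintZ.
have mS : cmeasurable (fun y : borel X => \sum_(k < size s) p k * K (nth 0 s k) y).
  apply: (@cint_measurable _ _ _ mu); apply: cint_sum => k; apply: cintZ.
  exact: (ccont_cint mu compX (cK _)).
have mKi := ccont_measurable cKi.
have mD : cmeasurable (fun y : borel X => cintegral mu (fun x : borel X => K x y) -
    \sum_(k < size s) p k * K (nth 0 s k) y).
  apply: (@cint_measurable _ _ _ mu); apply: cintB; first exact: (ccont_cint mu compX cKi).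
  by apply: cint_sum => k; apply: cintZ; exact: (ccont_cint mu compX (cK _)).
have h3 : modc (S - cintegral mu (fun y : borel X =>
    cintegral mu (fun x : borel X => K x y) * u y)) <= e * U.
  have [B1 hB1] := ccont_bounded compX cKi.
  have ikk : cint mu (fun y : borel X => cintegral mu (fun x : borel X => K x y) * u y).
    exact: cint_Mbounded mKi hB1 iu.
  rewrite modcB eS -cintegralB//; last first.
    under eq_fun do rewrite mulr_suml; apply: cint_sum => k.
    by under eq_fun do rewrite -mulrA; exact: cintZ.
  by under eq_fun do rewrite -mulrBl; exact: KU mD h2.
rewrite (le_trans (le_modcBD S _ _))//.
by rewrite (le_trans (lerD h1 h3))//; lra.
Qed.

Definition shf (y : X) (f : X -> R[i]) : X -> R[i] := fun x => f (x + y).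

Definition corr v w (x : X) : R[i] := ip mu (shf x v : borel X -> R[i]) w.

Lemma shf_cont y f : ccont f -> ccont (shf y f).
Proof. exact: ccont_shift. Qed.
Arguments shf_cont y {f}.

(** The oscillation of v bounds that of [corr v w], with a constant depending only on the L^1 norm
    of w. The free translation t gives the conclusion the shape of the hypothesis, so that the
    estimate can be iterated. *)
Lemma corr_lip v w x x' (e : R) : ccont v -> cint mu w -> 0 <= e ->
  (forall z, modc (v (z + x') - v (z + x)) <= e) ->
  forall t, modc (corr v w (t + x') - corr v w (t + x)) <=
            e * mean mu (fun x => modc (w x)).
Proof.
move=> cv iw e0 h t; have [B hB] := ccont_bounded compX cv.
have iv y : cint mu (fun z : borel X => shf y v z * (w z)^*%C).
  apply: (cint_Mbounded (ccont_measurable (shf_cont y cv)) (fun z => hB (z + y))).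
  exact: cint_conj.
rewrite /corr /ip -cintegralB// -meanZ; last exact: cint_modc.
apply: modc_cintegral_le.
- exact: cint_measurable (cintB (iv (t + x')) (iv (t + x))).
- by apply: rintZ; exact: cint_modc.
- move=> z; rewrite -mulrBl modcM modc_conj ler_wpM2r ?modc_ge0//.
  by rewrite /shf !addrA.
Qed.

Lemma corr_cont v w : ccont v -> cint mu w -> ccont (corr v w).
Proof.
move=> cv iw; apply/ccontP => x e e0.
set M := mean mu (fun x => modc (w x)).
have M0 : 0 <= M by apply: mean_ge0 => y; exact: modc_ge0.
have e1 : 0 < e / (M + 1) by rewrite divr_gt0//; lra.
apply: filterS (unif_shift compX cv x e1) => x' h.
have := corr_lip cv iw (ltW e1) h 0; rewrite !add0r modcB -/M.
move/le_trans; apply; rewrite mulrAC ler_pdivrMr ?ler_wpM2l//; lra.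
Qed.

Lemma corr_bound v w (B : R) x : ccont v -> cint mu w ->
  (forall x, modc (v x) <= B) ->
  modc (corr v w x) <= B * mean mu (fun x => modc (w x)).
Proof.
move=> cv iw hB; rewrite -meanZ; last exact: cint_modc.
apply: modc_cintegral_le.
- apply: cmeasurableM; first exact: ccont_measurable (shf_cont x cv).
  exact: cmeasurable_conj (cint_measurable iw).
- by apply: rintZ; exact: cint_modc.
- by move=> z; rewrite modcM modc_conj ler_wpM2r ?modc_ge0//; exact: hB.
Qed.

Lemma corr_shfl y v w x : corr (shf y v) w x = corr v w (x + y).
Proof.
by rewrite /corr; congr ip; apply/funext => z; rewrite /shf addrA.
Qed.

Lemma corr_shfr y v w x : ccont v -> sqint_fun mu w ->
  corr v (shf y w) x = corr v w (x - y).
Proof.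
move=> cv sw; have cvy := shf_cont (x - y) cv.
rewrite /corr /ip -[RHS](cintegral_shift haar_mu y); last first.
  by apply: cint_ip => //; exact: ccont_sqint.
by congr cintegral; apply/funext => z; rewrite /shf -addrA [y + _]addrC subrK.
Qed.

Lemma corr0 w : ccont w -> corr w w 0 = ((sqn mu w)%:C)%C.
Proof.
move=> cw; rewrite -ip_self; last exact: ccont_sqint.
by rewrite /corr; congr ip; apply/funext => z; rewrite /shf addr0.
Qed.

(** Translating g does not change its autocorrelation, which gives the diagonal terms; the cross
    terms are translates of the autocorrelation. *)
Lemma corr_pert g (b : R[i]) y x : ccont g ->
  corr (fun x => g x + b * g (x + y)) (fun x => g x + b * g (x + y)) x =
  (1 + modc b ^+ 2)%:C%C * corr g g x +
    (b * corr g g (x + y) + (b^*)%C * corr g g (x - y)).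
Proof.
move=> cg; have sg := ccont_sqint mu compX cg.
have cyg := shf_cont y cg; have syg := ccont_sqint mu compX cyg.
have sxg := ccont_sqint mu compX (shf_cont x cg).
have sxyg := ccont_sqint mu compX (shf_cont x cyg).
have -> : corr (fun x => g x + b * g (x + y)) (fun x => g x + b * g (x + y)) x =
  ip mu (fun z : borel X => shf x g z + b * shf x (shf y g) z)
        (fun z : borel X => g z + b * shf y g z) by [].
have sb1 := sqintZ b sxyg; have sb2 := sqintZ b syg; have s1 := sqintD sg sb2.
rewrite (ipDl sxg sb1 s1) !(ipDr sg sb2) ?(ipZl _ sxyg) ?(ipZr _ syg)//.
rewrite -/(corr g g x) -/(corr (shf y g) g x) -/(corr (shf y g) (shf y g) x).
rewrite -/(corr g (shf y g) x) !corr_shfl !corr_shfr// addrK.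
have -> : ((1 + modc b ^+ 2)%:C)%C = 1 + b * (b^*)%C :> R[i].
  by rewrite mulc_conj rmorphD.
ring.
Qed.

(** Exchange the two integrals by [fubini_equicont]; by invariance, the inner integral over x equals
    the coefficient of v times chi(z). *)
Lemma fourier_corr v w (chi : dual X R) : ccont v -> cint mu w ->
  fourier mu (corr v w) chi = fourier mu v chi * (fourier mu w chi)^*%C.
Proof.
move=> cv iw; have [cchi m h] := dualP chi; rewrite -/(ccont chi) in cchi.
have [B hB] := ccont_bounded compX cv.
have cc : ccont (fun x => (chi x)^*%C) by exact: ccont_conj.
have icc f : ccont f -> cint mu (fun x : borel X => (chi x)^*%C * f x).
  by move=> cf; exact: (ccont_cint mu compX (ccontM cc cf)).
pose K (x z : X) := (chi x)^*%C * v (z + x).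
have iKz z : cintegral mu (fun x : borel X => K x z) = fourier mu v chi * chi z.
  rewrite /K /fourier -(cintegral_shift haar_mu z (icc v cv)).
  rewrite mulrC -cintegralZ; last first.
    exact: (cint_shift haar_mu z (icc v cv)).
  congr cintegral; apply/funext => x; rewrite mulrA; congr (_ * _); last by rewrite addrC.
  rewrite h rmorphM mulrCA mulc_conj m expr1n mulr1//.
have wc := cint_conj iw.
have eqK x (e : R) : 0 < e -> \forall x' \near x, forall z, modc (K x' z - K x z) <= e.
  move=> e0; have e1 : 0 < e / 2 by rewrite divr_gt0.
  have B0 : 0 <= B by apply: le_trans (hB 0); exact: modc_ge0.
  have e2 : 0 < e / (2 * (B + 1)) by rewrite divr_gt0//; lra.
  have /ccontP hc := cc.
  apply: filterS2 (hc x _ e2) (unif_shift compX cv x e1) => x' h1 h2 z.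
  have -> : K x' z - K x z = ((chi x')^*%C - (chi x)^*%C) * v (z + x') +
    (chi x)^*%C * (v (z + x') - v (z + x)) by rewrite /K; ring.
  rewrite (le_trans (le_modcD _ _))// [leRHS]splitr !modcM modc_conj m mul1r lerD//.
  rewrite modcB (le_trans (ler_pM (modc_ge0 _) (modc_ge0 _) h1 (hB _)))//.
  by rewrite mulrAC invfM mulrA ler_pdivrMr; nra.
have := @fubini_equicont K (fun z => (w z)^*%C) B eqK _ _ _ wc.
have -> : (fun y : X => cintegral mu (fun x : borel X => K x y)) =
  (fun z => fourier mu v chi * chi z) by apply/funext.
have hcc : ccont (fun z => fourier mu v chi * chi z).
  exact: (ccontZ (fourier mu v chi) cchi).
move=> /(_ _ _ hcc) fub.
transitivity (cintegral mu (fun x : borel X =>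
  cintegral mu (fun y : borel X => K x y * (w y)^*%C))).
  congr cintegral; apply/funext => x; rewrite /corr /ip -cintegralZ.
    by congr cintegral; apply/funext => z; rewrite /K /shf mulrA.
  exact: (cint_Mbounded (ccont_measurable (shf_cont x cv)) (fun z => hB (z + x))).
rewrite fub => [|x|x y].
- rewrite /fourier -cintegral_conj; last first.
    exact: (cint_Mbounded (ccont_measurable cc)
      (fun x => eq_ind_r (fun r => r <= 1) (lexx 1) (etrans (modc_conj _) (m x))) iw).
  rewrite -cintegralZ.
    congr cintegral; apply/funext => z; rewrite iKz /fourier.
    by apply: complexP; rewrite !cE; ring.
  apply: cint_conj; exact: (cint_Mbounded (ccont_measurable cc)
      (fun x => eq_ind_r (fun r => r <= 1) (lexx 1) (etrans (modc_conj _) (m x))) iw).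
- have cvx : ccont (fun z => v (z + x)) by exact: ccont_shift.
  exact: (ccontZ ((chi x)^*%C) cvx).
- by rewrite /K modcM modc_conj m mul1r.
Qed.

End convolution.

Arguments shf_cont {R X} y {f}.

(** * A continuous function with zero Fourier coefficients vanishes *)

Section peter_weyl.
Variables (R : realType) (X : topologicalZmodType) (mu : probability (borel X) R).
Hypothesis compX : compact [set: X].
Hypothesis haar_mu : is_haar mu.
Implicit Types (f g v w phi : X -> R[i]).

Lemma sqn_le2 f g (c : R) : ccont f -> ccont g ->
  (forall x, modc (f x - g x) <= c) -> sqn mu f <= 2 * sqn mu g + 2 * c ^+ 2.
Proof.
move=> cf cg h; have [_ sf] := ccont_sqint mu compX cf.
have [_ sg] := ccont_sqint mu compX cg.
rewrite /sqn -meanZ// -[X in _ + X](mean_cst mu) -meanD; [|exact: rintZ|exact: rint_cst].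
apply: mean_le => //; first by apply: rintD; [exact: rintZ|exact: rint_cst].
move=> x; have := h x; have := le_modc_sub (f x) (g x).
have := modc_ge0 (f x); have := modc_ge0 (g x); have := modc_ge0 (f x - g x).
have := sqr_ge0 (modc (g x) - c).
set a := modc (f x); set b := modc (g x); set d := modc (f x - g x) => h1 h2 h3 h4 h5 h6.
have : a <= b + c by lra.
nra.
Qed.

Lemma sqn_bound f (B : R) : ccont f -> (forall x, modc (f x) <= B) ->
  sqn mu f <= B ^+ 2.
Proof.
move=> cf h; have [_ sf] := ccont_sqint mu compX cf.
rewrite -[leRHS](mean_cst mu); apply: mean_le => //; first exact: rint_cst.
by move=> x; rewrite ler_sqr ?nnegrE ?modc_ge0// (le_trans (modc_ge0 (f x))).
Qed.

(* The two inequalities are combined with weights (m - s)/2m and (m + s)/2m. *)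
Lemma pinching (m s q qn e P J : R) : 0 < m -> m ^+ 2 <= 25 / 16 -> `|s| <= m ->
  qn <= q -> q - e <= qn ->
  m ^+ 2 * qn + P + 2 * m * J <= q * (m + s) ^+ 2 ->
  m ^+ 2 * qn + P - 2 * m * J <= q * (m - s) ^+ 2 ->
  P + s ^+ 2 * qn - 2 * s * J <= 25 / 16 * e.
Proof.
move=> m0 m2; rewrite ler_norml => /andP[sm1 sm2] hq he h1 h2.
have k1 : 0 <= m - s by lra.
have k2 : 0 <= m + s by lra.
have := ler_wpM2l k1 h1; have := ler_wpM2l k2 h2 => g1 g2.
have e0 : 0 <= q - qn by lra.
have : (2 * m) * (P + s ^+ 2 * qn - 2 * s * J) <=
  (2 * m) * ((m ^+ 2 - s ^+ 2) * (q - qn)) by nra.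
rewrite ler_pM2l; last by lra.
move/le_trans; apply.
have : (m ^+ 2 - s ^+ 2) * (q - qn) <= m ^+ 2 * (q - qn).
  by rewrite ler_wpM2r// lerBlDr lerDl sqr_ge0.
move/le_trans; apply.
have : m ^+ 2 * (q - qn) <= 25 / 16 * (q - qn) by rewrite ler_wpM2r.
lra.
Qed.

(** [pinching] for functions. The constant 5/4 is 1 + |a|^2 with |a| = 1/2, and N <= 1 allows N to
    be replaced by 1 in the upper bounds. *)
Lemma sqn_pinching (Phi Psi : X -> R[i]) (s q e N : R) :
  sqint_fun mu Phi -> sqint_fun mu Psi -> 0 <= q -> N <= 1 -> `|s| <= 5 / 4 * N ->
  q - e <= sqn mu Phi -> sqn mu Phi <= q ->
  sqn mu (fun x => (5 / 4)%:C%C * Phi x + 1 * Psi x) <= q * (5 / 4 * N + s) ^+ 2 ->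
  sqn mu (fun x => (5 / 4)%:C%C * Phi x + (-1) * Psi x) <= q * (5 / 4 * N - s) ^+ 2 ->
  sqn mu (fun x => 1 * Psi x + (- s%:C%C) * Phi x) <= 25 / 16 * e.
Proof.
move=> hf hg q0 N1; rewrite ler_norml => /andP[sN1 sN2] h1 h2.
have mm : modc ((5 / 4 : R)%:C)%C = 5 / 4 by rewrite modc_real ger0_norm//; lra.
rewrite !sqn_lin// -(ip_conj hf hg) !modcN modc1 mm modc_real real_normK ?num_real//.
move: (ip mu _ _) => z; rewrite !cE/= => Q1 Q2.
set J := complex.Re z in Q1 Q2 *; set I := complex.Im z in Q1 Q2 *.
have := @pinching (5 / 4) s q (sqn mu Phi) e (sqn mu Psi) J.
have k1 : q * (5 / 4 * N + s) ^+ 2 <= q * (5 / 4 + s) ^+ 2.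
  by rewrite ler_wpM2l// ler_sqr ?nnegrE; lra.
have k2 : q * (5 / 4 * N - s) ^+ 2 <= q * (5 / 4 - s) ^+ 2.
  by rewrite ler_wpM2l// ler_sqr ?nnegrE; lra.
have k3 : `|s| <= 5 / 4 by rewrite ler_norml; apply/andP; split; lra.
have k4 : (5 / 4 : R) ^+ 2 <= 25 / 16 by lra.
move=> /(_ _ k4 k3 h2 h1); lra.
Qed.

Lemma eigen_error (T P t c e : R) : T <= 25 / 4 * t -> t <= e -> P <= c * e ->
  2 * T + 2 * P <= (25 / 2 + 2 * c) * e.
Proof. lra. Qed.

Section maximal.
Variables (v : X -> R[i]) (q : R).
Hypothesis cv : ccont v.

(** By [fourier_corr] the coefficients of [auto w] are |v^|^2 |w^|^2, so one expects its squared
    norm to be the sum of |v^|^4 |w^|^4. On the unit ball such a quartic functional is largest at a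
    single character where |v^| is maximal. Near maximizers should therefore behave like characters,
    and this is proved without Plancherel. *)
Definition smooth w : X -> R[i] := corr mu v w.
Definition auto w : X -> R[i] := corr mu (smooth w) (smooth w).

Hypothesis q_max : forall w, ccont w -> sqn mu (auto w) <= q * sqn mu w ^+ 2.

Lemma smooth_cont w : ccont w -> ccont (smooth w).
Proof. by move=> cw; apply: (corr_cont compX cv); exact: ccont_cint. Qed.

Lemma auto_cont w : ccont w -> ccont (auto w).
Proof.
move=> cw; have cs := smooth_cont cw.
by apply: (corr_cont compX cs); exact: ccont_cint.
Qed.

Lemma smooth_pert w (a : R[i]) y x : ccont w ->
  smooth (fun x => w x + a * w (x + y)) x = smooth w x + (a^*)%C * smooth w (x - y).
Proof.
move=> cw; have sw := ccont_sqint mu compX cw.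
have syw := ccont_sqint mu compX (shf_cont y cw).
have sxv := ccont_sqint mu compX (shf_cont x cv).
rewrite /smooth -(corr_shfr compX haar_mu y x cv sw).
by rewrite -(ipZr _ syw sxv) -(ipDr sw (sqintZ a syw) sxv).
Qed.

Lemma auto_pert w (a : R[i]) y x : ccont w ->
  auto (fun x => w x + a * w (x + y)) x =
  (1 + modc a ^+ 2)%:C%C * auto w x +
  (a * auto w (x + y) + (a^*)%C * auto w (x - y)).
Proof.
move=> cw; rewrite /auto.
have -> : smooth (fun x => w x + a * w (x + y)) =
  (fun x => smooth w x + (a^*)%C * smooth w (x + - y)).
  by apply/funext => t; exact: smooth_pert.
rewrite (corr_pert compX haar_mu (a^*)%C (- y) x (smooth_cont cw)).
rewrite modc_conj conjcK opprK.
move: (corr mu _ _ x) (corr mu _ _ (x - y)) (corr mu _ _ (x + y)) => p1 p2 p3.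
by rewrite [(a^*)%C * _ + _]addrC.
Qed.

Lemma sqn_pert w (a : R[i]) y : ccont w ->
  sqn mu (fun x => w x + a * w (x + y)) =
  (1 + modc a ^+ 2) * sqn mu w + 2 * complex.Re (a * corr mu w w y).
Proof.
move=> cw; have sw := ccont_sqint mu compX cw.
have syw := ccont_sqint mu compX (shf_cont y cw).
rewrite (sqnD sw (sqintZ a syw)) (sqnZ a syw) (ipZr a syw sw).
rewrite (sqn_shift haar_mu y sw) -(ip_conj syw sw) -/(corr mu w w y) !cE; ring.
Qed.

(** Maximality is tested on w + a w(. + y) and w - a w(. + y). Their squared norms are 5/4 |w|^2 + s
    and 5/4 |w|^2 - s, their images under [auto] are 5/4 auto w + Psi and 5/4 auto w - Psi;
    comparing the two signs forces Psi to be close to s auto w. *)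
Lemma auto_step (w : X -> R[i]) (e : R) (a : R[i]) y : ccont w ->
  0 <= q -> sqn mu w <= 1 -> q - e <= sqn mu (auto w) -> modc a = 1 / 2 ->
  let s := 2 * complex.Re (a * corr mu w w y) in
  `|s| <= 5 / 4 /\
  sqn mu (fun x => (a * auto w (x + y) + (a^*)%C * auto w (x - y)) -
    s%:C%C * auto w x) <= 25 / 16 * e.
Proof.
move=> cw q0 N1 he ma s.
have ca := auto_cont cw.
set Psi := fun x => a * auto w (x + y) + (a^*)%C * auto w (x - y).
have cPsi : ccont Psi.
  exact: (ccontD (ccontZ a (shf_cont y ca)) (ccontZ (a^*)%C (shf_cont (- y) ca))).
have sPsi := ccont_sqint mu compX cPsi; have sPhi := ccont_sqint mu compX ca.
have N0 := sqn_ge0 mu w.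
have m54 : 1 + modc a ^+ 2 = 5 / 4 by rewrite ma; field.
have m54' : 1 + modc (- a) ^+ 2 = 5 / 4 by rewrite modcN.
have n1 := sqn_pert a y cw; have n2 := sqn_pert (- a) y cw.
have sE : 2 * complex.Re (- a * corr mu w w y) = - s by rewrite /s mulNr !cE; ring.
rewrite m54 -/s in n1; rewrite m54' sE in n2.
have p1 := sqn_ge0 mu (fun x => w x + a * w (x + y)).
have p2 := sqn_ge0 mu (fun x => w x + - a * w (x + y)).
rewrite n1 in p1; rewrite n2 in p2.
have sN : `|s| <= 5 / 4 by rewrite ler_norml; apply/andP; split; lra.
split=> //.
have cpert b : ccont (fun x => w x + b * w (x + y)).
  exact: (ccontD cw (ccontZ b (shf_cont y cw))).
have Q1 := q_max (cpert a); have Q2 := q_max (cpert (- a)).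
have qn : sqn mu (auto w) <= q.
  by rewrite (le_trans (q_max cw))// -[leRHS]mulr1 ler_wpM2l// expr_le1.
have E1 : auto (fun x => w x + a * w (x + y)) =
    (fun x => (5 / 4)%:C%C * auto w x + 1 * Psi x).
  by apply/funext => x; rewrite auto_pert// m54 mul1r.
have E2 : auto (fun x => w x + - a * w (x + y)) =
    (fun x => (5 / 4)%:C%C * auto w x + (-1) * Psi x).
  apply/funext => x; rewrite auto_pert// m54' /Psi rmorphN.
  move: (auto w x) (auto w (x - y)) (auto w (x + y)) => z1 z2 z3; ring.
rewrite E1 n1 in Q1; rewrite E2 n2 in Q2.
have sN' : `|s| <= 5 / 4 * sqn mu w by rewrite ler_norml; apply/andP; split; lra.
have := sqn_pinching sPhi sPsi q0 N1 sN' he qn Q1 Q2.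
by under eq_fun do rewrite mul1r mulNr.
Qed.

(** [auto_step] with a = 1/2 and a = i/2 yields the real and the imaginary part of the multiplier.
    The bounds add up: 5/4 + 5/4 for the multiplier, and 2 * 25/16 twice for the error. *)
Lemma auto_eigen (w : X -> R[i]) (e : R) y : ccont w ->
  0 <= q -> sqn mu w <= 1 -> q - e <= sqn mu (auto w) ->
  modc (corr mu w w y) <= 5 / 2 /\
  sqn mu (fun x => auto w (x + y) - corr mu w w y * auto w x) <= 25 / 4 * e.
Proof.
move=> cw q0 N1 he; have ca := auto_cont cw.
have m1 : modc ((1 / 2 : R)%:C)%C = 1 / 2 by rewrite modc_real ger0_norm; lra.
have m2 : modc (0 +i* (1 / 2 : R))%C = 1 / 2.
  by rewrite /= expr0n add0r sqrtr_sqr ger0_norm; lra.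
have /= [b1 h1] := @auto_step w e _ y cw q0 N1 he m1.
have /= [b2 h2] := @auto_step w e _ y cw q0 N1 he m2.
set S := corr mu w w y in b1 b2 h1 h2 *.
have r1 : 2 * complex.Re ((1 / 2)%:C%C * S) = complex.Re S by rewrite cE/=; field.
have r2 : 2 * complex.Re ((0 +i* (1 / 2))%C * S) = - complex.Im S by rewrite cE/=; field.
rewrite r1 in b1 h1; rewrite r2 in b2 h2.
split.
  by rewrite normrN in b2; apply: le_trans (le_modc_ReIm S) _; lra.
have cE1 (a : R[i]) (s : R) : ccont (fun x =>
    (a * auto w (x + y) + (a^*)%C * auto w (x - y)) - s%:C%C * auto w x).
  exact: (ccontB (ccontD (ccontZ a (shf_cont y ca))
    (ccontZ (a^*)%C (shf_cont (- y) ca))) (ccontZ s%:C%C ca)).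
set A := (fun x => (_ * auto w (x + y) + _) - _) in h1.
set B := (fun x => (_ * auto w (x + y) + _) - _) in h2.
have sA := ccont_sqint mu compX (cE1 _ _ : ccont A).
have sB := ccont_sqint mu compX (cE1 _ _ : ccont B).
(* The factor -i cancels the translates by -y and assembles the real multipliers Re S and -Im S into
   S. *)
have -> : (fun x => auto w (x + y) - S * auto w x) = (fun x => A x + (0 -i* 1)%C * B x).
  apply/funext => x; rewrite /A /B; clear.
  move: (auto w x) (auto w (x + y)) (auto w (x - y)) => z1 z2 z3.
  by move: S => S0; apply: complexP; rewrite !cE/=; field.
have mi : modc (0 -i* 1 : R[i])%C = 1 by rewrite /= expr0n add0r sqrtr_sqr normrN normr1.
have := sqn_le_lin mi sA sB; lra.
Qed.

End maximal.

Section no_characters.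
Variable v : X -> R[i].
Hypothesis cv : ccont v.
Hypothesis v_hat : forall chi : dual X R, fourier mu v chi = 0.

(* The ratio of Q w to the square of sqn mu w is bounded: Q is maximized on   *)
(* the unit ball, and a perturbation w + a w(. + y) with |a| = 1/2 gives the  *)
(* approximate covariance of auto v w for w nearly optimal.                   *)
Let Q w := sqn mu (auto v w).
Let values := [set Q w | w in [set w | ccont w /\ sqn mu w <= 1]].

Let c0 : ccont (fun _ : X => 0 : R[i]). Proof. exact: ccont_cst. Qed.

Let mean_le1 w : ccont w -> sqn mu w <= 1 -> mean mu (fun x => modc (w x)) <= 1.
Proof. by move=> cw w1; have := mean_modc_le (ccont_sqint mu compX cw); lra. Qed.

Lemma smooth_bound : exists2 B, 0 <= B & forall w, ccont w -> sqn mu w <= 1 ->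
  (forall x, modc (smooth v w x) <= B) /\ (forall x, modc (auto v w x) <= B).
Proof.
have [B hB] := ccont_bounded compX cv.
have B0 : 0 <= B by apply: le_trans (hB 0); exact: modc_ge0.
exists (Num.max B (B * B)) => [|w cw w1]; first by rewrite le_max B0.
have h1 x : modc (smooth v w x) <= B.
  rewrite (le_trans (corr_bound x cv (ccont_cint mu compX cw) hB))//.
  by rewrite -[leRHS]mulr1 ler_wpM2l// mean_le1.
have cs := smooth_cont cv cw; have is_ := ccont_cint mu compX cs.
split=> x; rewrite le_max; apply/orP; [by left|right].
rewrite (le_trans (corr_bound x cs is_ h1))// ler_wpM2l//.
rewrite -[leRHS](mean_cst mu); apply: mean_le => //; last exact: rint_cst.
exact: cint_modc.
Qed.

Let values0 : values !=set0.
Proof.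
exists (Q (fun=> 0)), (fun=> 0) => //; split=> //.
rewrite (le_trans (sqn_bound (B := 0) c0 _)) ?expr0n// => x.
by rewrite modc0.
Qed.

Let values_ub : has_ubound values.
Proof.
have [B B0 hB] := smooth_bound.
exists (B ^+ 2) => _ [w [cw w1] <-]; apply: sqn_bound.
  exact: auto_cont.
exact: (hB w cw w1).2.
Qed.

Let q := sup values.

Lemma autoZ w (c : R) x : ccont w ->
  auto v (fun x => c%:C%C * w x) x = (c ^+ 2)%:C%C * auto v w x.
Proof.
move=> cw; rewrite /auto.
have -> : smooth v (fun x => c%:C%C * w x) = fun x => c%:C%C * smooth v w x.
  apply/funext => t; rewrite /smooth /corr.
  have sw := ccont_sqint mu compX cw.
  by rewrite (ipZr _ sw (ccont_sqint mu compX (shf_cont t cv))) conjc_real.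
have cs := smooth_cont cv cw; have ss := ccont_sqint mu compX cs.
have sx := ccont_sqint mu compX (shf_cont x cs).
rewrite {1}/corr (_ : shf x _ = fun z => c%:C%C * shf x (smooth v w) z)//.
rewrite (ipZl _ sx (sqintZ _ ss)) (ipZr _ ss sx) conjc_real mulrA.
by rewrite -rmorphM -expr2.
Qed.

Lemma QZ w (c : R) : ccont w -> Q (fun x => c%:C%C * w x) = c ^+ 4 * Q w.
Proof.
move=> cw; rewrite /Q.
have -> : auto v (fun x => c%:C%C * w x) = (fun x => (c ^+ 2)%:C%C * auto v w x).
  by apply/funext => x; exact: autoZ.
rewrite (sqnZ _ (ccont_sqint mu compX (auto_cont cv cw))) modc_real.
by rewrite real_normK ?num_real// -exprM.
Qed.

Lemma Q_max w : ccont w -> Q w <= q * sqn mu w ^+ 2.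
Proof.
move=> cw; have sw := ccont_sqint mu compX cw.
have [w0|w0] := eqVneq (sqn mu w) 0.
  rewrite w0 expr0n mulr0.
  have -> : w = (fun x => (0 : R)%:C%C * w x).
    by apply/funext => x; rewrite (sqn_eq0 compX haar_mu cw w0) mulr0.
  by rewrite QZ// expr0n mul0r.
have wp : 0 < sqn mu w by rewrite lt0r w0 sqn_ge0.
set c := (Num.sqrt (sqn mu w))^-1.
have c2 : c ^+ 2 = (sqn mu w)^-1 by rewrite /c exprVn sqr_sqrtr// ltW.
have : Q (fun x => c%:C%C * w x) <= q.
  apply: (sup_ubound values_ub); exists (fun x => c%:C%C * w x); last by [].
  split; first exact: (ccontZ _ cw).
  by rewrite (sqnZ _ sw) modc_real real_normK ?num_real// c2 mulVf.
rewrite QZ// (_ : c ^+ 4 = (c ^+ 2) ^+ 2); last by rewrite -exprM.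
by rewrite c2 exprVn mulrC ler_pdivrMr// exprn_gt0.
Qed.

Lemma q_ge0 : 0 <= q.
Proof.
apply: le_trans (sup_ubound values_ub _); first exact: (sqn_ge0 mu (auto v (fun=> 0))).
exists (fun=> 0) => //; split=> //.
rewrite (le_trans (sqn_bound (B := 0) c0 _)) ?expr0n// => x.
by rewrite modc0.
Qed.

(** If q = 0 then [auto v v] vanishes. Its value at 0 is the squared norm of [smooth v v], whose
    value at 0 is in turn the squared norm of v. *)
Lemma q_gt0 : (exists x, v x <> 0) -> 0 < q.
Proof.
move=> [x vx]; rewrite lt0r q_ge0 andbT; apply/eqP => q0.
have := Q_max cv; rewrite q0 mul0r => Q0.
have /(sqn_eq0 compX haar_mu (auto_cont cv cv)) /(_ 0) : Q v = 0.
  by apply/eqP; rewrite eq_le Q0 sqn_ge0.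
have cs := smooth_cont cv cv.
rewrite /auto corr0// => /(congr1 (@complex.Re R)) /= h.
have := sqn_eq0 compX haar_mu cs h 0.
rewrite /smooth corr0// => /(congr1 (@complex.Re R)) /= h'.
exact/vx/(sqn_eq0 compX haar_mu cv h').
Qed.

(* A maximizing sequence is asymptotically translation covariant, so a limit *)
(* of its autocorrelations is a multiple of a character.                     *)
Theorem continuous_fourier_eq0 : forall x, v x = 0.
Proof.
apply: contrapT => /existsNP nv; have q0 := q_gt0 nv.
have hs : has_sup values by split.
have /choice[w hw] n : exists w, [/\ ccont w, sqn mu w <= 1 & q - n.+1%:R^-1 < Q w].
  have e0 : 0 < n.+1%:R^-1 :> R by rewrite invr_gt0.
  by have [_ [w [cw w1] <-] h] := sup_adherent e0 hs; exists w.
have [F [FU subF]] := ultraFilterLemma (_ : ProperFilter \oo).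
have FP : ProperFilter F := @ultra_proper _ _ FU.
have [B B0 hB] := smooth_bound.
have Finv (e : R) : 0 < e -> \forall n \near F, n.+1%:R^-1 <= e.
  move=> e0; apply: subF; apply: filterS (near_infty_natSinv_lt (PosNum e0)) => n.
  exact: ltW.
have [] := @equicont_ultra_lim _ _ compX _ F FU (fun n => auto v (w n)).
- by move=> x; exists B => n; have [cw w1 _] := hw n; have [_] := hB _ cw w1; exact.
- move=> x e e0; have e1 : 0 < e / (B + 1) by rewrite divr_gt0//; lra.
  apply: filterS (unif_shift compX cv x e1) => x' h n.
  have [cw w1 _] := hw n; have [hb _] := hB _ cw w1.
  have iw := ccont_cint mu compX cw; have cs := smooth_cont cv cw.
  have h2 t : modc (smooth v (w n) (t + x') - smooth v (w n) (t + x)) <= e / (B + 1).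
    rewrite (le_trans (corr_lip compX cv iw (ltW e1) h t))//.
    by rewrite -[leRHS]mulr1 ler_wpM2l ?(ltW e1)// mean_le1.
  have := corr_lip compX cs (ccont_cint mu compX cs) (ltW e1) h2 0; rewrite !add0r.
  move/le_trans; apply.
  have : mean mu (fun x => modc (smooth v (w n) x)) <= B.
    rewrite -[leRHS](mean_cst mu); apply: mean_le => //; last exact: rint_cst.
    exact: cint_modc (ccont_cint mu compX cs).
  rewrite mulrAC ler_pdivrMr; nra.
move=> Phi cPhi hPhi.
have eig n y : modc (corr mu (w n) (w n) y) <= 5 / 2 /\
    sqn mu (fun x => auto v (w n) (x + y) - corr mu (w n) (w n) y * auto v (w n) x)
      <= 25 / 4 * n.+1%:R^-1.
  have [cw w1 qw] := hw n.
  exact: (@auto_eigen v q cv Q_max (w n) n.+1%:R^-1 y cw (ltW q0) w1 (ltW qw)).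
have /choice[s hs'] y : exists z, forall e : R, 0 < e ->
    \forall n \near F, modc (corr mu (w n) (w n) y - z) <= e.
  exact: (ultra_lim FU (fun n => (eig n y).1)).
(* The approximate covariance given by [auto_eigen] becomes exact in the limit, with multiplier s y;
   C collects the errors of replacing Phi and s y by their approximants. *)
have tr x y : Phi (x + y) = s y * Phi x.
  have cT : ccont (fun x => Phi (x + y) - s y * Phi x).
    exact: (ccontB (ccont_shift y cPhi) (ccontZ (s y) cPhi)).
  apply/eqP; rewrite -subr_eq0; apply/eqP; move: x.
  apply: (sqn_eq0 compX haar_mu cT).
  set C := 1 + modc (s y) + B.
  have C0 : 0 <= C by have := modc_ge0 (s y); rewrite /C; lra.
  apply: (@small_eq0 _ _ (25 / 2 + 2 * C ^+ 2)).
  - exact: sqn_ge0.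
  - by have := sqr_ge0 C; lra.
  move=> e e0 e1.
  have [n [[h1 h2] h3]] := filter_ex (filterI (filterI (hPhi e e0) (hs' y e e0)) (Finv e e0)).
  have [cw w1 _] := hw n; have [_ hb] := hB _ cw w1; have [_ h4] := eig n y.
  have ca := auto_cont cv cw.
  move: (auto v (w n)) (corr mu (w n) (w n) y) h1 hb h4 ca h2.
  move=> A S h1 hb h4 ca h2.
  have cTn : ccont (fun x => A (x + y) - S * A x).
    exact: (ccontB (ccont_shift y ca) (ccontZ S ca)).
  have key x : modc ((Phi (x + y) - s y * Phi x) - (A (x + y) - S * A x)) <= C * e.
    have -> : (Phi (x + y) - s y * Phi x) - (A (x + y) - S * A x) =
      (Phi (x + y) - A (x + y)) + (s y * (A x - Phi x) + (S - s y) * A x) by ring.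
    rewrite (le_trans (le_modcD _ _))//.
    have k1 := h1 (x + y); rewrite modcB in k1.
    have k2 := le_modcD (s y * (A x - Phi x)) ((S - s y) * A x).
    rewrite !modcM in k2.
    have k3 := ler_wpM2l (modc_ge0 (s y)) (h1 x).
    have k4 := ler_pM (modc_ge0 _) (modc_ge0 _) h2 (hb x).
    rewrite /C; lra.
  have := sqn_le2 cT cTn key; move/le_trans; apply.
  have ee : e ^+ 2 <= e by rewrite expr2 ler_piMl// ltW.
  by apply: (eigen_error h4 h3); rewrite exprMn ler_wpM2l ?sqr_ge0.
(* Otherwise Phi = 0 by covariance, and Q (w n) would be at most q / 4 for some n with Q (w n) > q -
   q / 4. *)
have Phi0 : Phi 0 != 0.
  apply/eqP => P0; have Pz x : Phi x = 0 by rewrite -[x]add0r tr P0 mulr0.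
  set e := Num.min 1 (q / 4).
  have e0 : 0 < e by rewrite lt_min ltr01 divr_gt0.
  have e1 : e <= 1 by rewrite ge_min lexx.
  have eq : e <= q / 4 by rewrite ge_min lexx orbT.
  have [n [h1 h3]] := filter_ex (filterI (hPhi e e0) (Finv e e0)).
  have [cw w1 qw] := hw n.
  have : Q (w n) <= e ^+ 2.
    apply: sqn_bound; first exact: auto_cont.
    by move=> x; have := h1 x; rewrite Pz subr0.
  have ee : e ^+ 2 <= e by rewrite expr2 ler_piMl// ltW.
  move: (n.+1%:R^-1) (Q (w n)) h3 qw => t Qn h3 qw; lra.
have s1 y : modc (s y) = 1.
  have sP := ccont_sqint mu compX cPhi.
  have := sqn_shift haar_mu y sP.
  under eq_fun do rewrite tr.
  rewrite (sqnZ _ sP) => /eqP; rewrite -subr_eq0 -[X in _ - X]mul1r -mulrBl mulf_eq0.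
  case/orP => [|/eqP /(sqn_eq0 compX haar_mu cPhi) /(_ 0) P0]; last first.
    by rewrite P0 eqxx in Phi0.
  by rewrite subr_eq0 pexpr_eq1// ?modc_ge0// => /eqP.
have sE y : s y = (Phi 0)^-1 * Phi y.
  by rewrite -{2}[y]add0r tr mulrCA mulVf// mulr1.
have cs : ccont s.
  by rewrite (_ : s = fun y => (Phi 0)^-1 * Phi y); [exact: (ccontZ _ cPhi)|apply/funext].
have chs : is_character s.
  split=> // x y; apply: (mulIf Phi0).
  by rewrite -tr addrA tr tr mulrCA mulrA.
pose chi : dual X R := Dual (introT (asboolP _) chs).
(* The contradiction: the approximants have no coefficient at chi, while their uniform limit Phi is
   Phi 0 times chi. *)
have hn n : fourier mu (auto v (w n)) chi = 0.
  have [cw _ _] := hw n; have csm := smooth_cont cv cw.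
  rewrite /auto (fourier_corr compX haar_mu chi csm (ccont_cint mu compX csm)).
  rewrite /smooth (fourier_corr compX haar_mu chi cv (ccont_cint mu compX cw)).
  by rewrite v_hat !mul0r.
have hP : fourier mu Phi chi = Phi 0.
  rewrite -[RHS](cintegral_cst mu); congr cintegral; apply/funext => x.
  have -> : Phi x = s x * Phi 0 by rewrite -tr add0r.
  by rewrite mulrA [(chi x)^*%C]/= [(s x)^*%C * _]mulrC mulc_conj s1 expr1n mul1r.
move/eqP: Phi0; apply; rewrite -hP; apply: modc_eq0.
apply: (@small_eq0 _ _ 1) => //; first exact: modc_ge0.
move=> e e0 _; have [n h1] := filter_ex (hPhi e e0).
have [cw _ _] := hw n; have ca := auto_cont cv cw.
have ccs := ccont_conj cs.
rewrite -[fourier mu Phi chi]subr0 -(hn n) /fourier mul1r.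
rewrite -cintegralB; [|exact: (ccont_cint mu compX (ccontM ccs cPhi))|
  exact: (ccont_cint mu compX (ccontM ccs ca))].
apply: modc_cintegral_bound.
  exact: (ccont_measurable (ccontB (ccontM ccs cPhi) (ccontM ccs ca))).
by move=> x; rewrite -mulrBr modcM modc_conj s1 mul1r modcB; exact: h1.
Qed.
End no_characters.
End peter_weyl.

(** * Injectivity of the Fourier transform and peaking trigonometric polynomials *)

Lemma modc_sqr1D (R : realType) (z : R[i]) : modc z = 1 ->
  modc (1 + z) ^+ 2 = 2 + 2 * complex.Re z.
Proof. by move=> h; have := modc_sqr z; rewrite h modc_sqr !cE/=; lra. Qed.

Section fourier_injective.
Variables (R : realType) (X : topologicalZmodType) (mu : probability (borel X) R).
Hypothesis compX : compact [set: X].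
Hypothesis hausX : hausdorff_space X.
Hypothesis haar_mu : is_haar mu.
Implicit Types (f g v w : X -> R[i]).

Lemma urysohn_real (A B : set X) : closed A -> closed B -> A `&` B = set0 ->
  exists k : X -> R, [/\ continuous k, forall x, 0 <= k x <= 1,
    forall x, A x -> k x = 0 & forall x, B x -> k x = 1].
Proof.
move=> cA cB AB; have nX := compact_normal hausX compX.
have /(uniform_separatorP (R := R))[k [ck k01 kA kB]] :=
  normal_uniform_separator nX cA cB AB.
exists k; split => //.
- by move=> x; have /= := k01 (k x); rewrite in_itv/=; apply; exists x.
- by move=> x Ax; apply: kA; exists x.
- by move=> x Bx; apply: kB; exists x.
Qed.

Lemma ccont_real (k : X -> R) : continuous k -> ccont (fun x => (k x)%:C%C).
Proof.
move=> ck; apply/ccontP => x e e0; have /cvgrPdist_le/(_ e e0) := ck x.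
by apply: filterS => y; rewrite -rmorphB modc_real.
Qed.

Lemma open_measurable_borel (U : set X) : open U -> measurable (U : set (borel X)).
Proof. by move=> oU; exact: sub_sigma_algebra. Qed.

Lemma closed_measurable_borel (U : set X) : closed U -> measurable (U : set (borel X)).
Proof.
by move=> cU; rewrite -[U]setCK; apply: measurableC; apply: open_measurable_borel;
  rewrite openC.
Qed.

Lemma mu_fin (A : set (borel X)) : measurable A -> mu A \is a fin_num.
Proof. by move=> mA; exact: fin_num_measure. Qed.

(** Outer regularity gives an open U around A, inner regularity of U a compact K in U. A Urysohn
    function equal to 1 on K and 0 off U differs from the indicator of A only on U \ A and U \ K.
    The set K approximates U and need not lie in A. *)
Lemma indic_approx (A : set (borel X)) (e : R) : measurable A -> 0 < e ->
  exists (k : X -> R) (E : set (borel X)), [/\ continuous k, measurable E,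
    (mu E <= e%:E)%E & forall x, `|\1_A x - k x| <= \1_E x].
Proof.
move=> mA e0; have e20 : 0 < e / 2 by rewrite divr_gt0.
have [_ outer inner] := haar_mu.
have fA := mu_fin mA.
have [_ [U [oU AU] <-] hU] := lb_ereal_inf_adherent e20
  (eq_ind_r (fun y => y \is a fin_num) fA (esym (outer A mA))).
rewrite -outer// in hU.
have mU := open_measurable_borel oU; have fU := mu_fin mU.
have [_ [K [cK KU] <-] hK] := ub_ereal_sup_adherent e20
  (eq_ind_r (fun y => y \is a fin_num) fU (esym (inner U oU))).
rewrite -inner// in hK.
have clK := compact_closed hausX cK.
have mK := closed_measurable_borel clK; have fK := mu_fin mK.
have [k [ck k01 k0 k1]] : exists k : X -> R, [/\ continuous k,
    forall x, 0 <= k x <= 1, forall x, (~` U) x -> k x = 0 & forall x, K x -> k x = 1].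
  apply: urysohn_real => //; first by rewrite closedC.
  by rewrite -subset0 => x [nUx /KU].
have mUA : measurable (U `\` A : set (borel X)) by exact: measurableD.
have mUK : measurable (U `\` K : set (borel X)) by exact: measurableD.
exists k, ((U `\` A) `|` (U `\` K)); split => //.
- exact: measurableU.
- have h1 : (mu (U `\` A) <= (e / 2)%:E)%E.
    rewrite measureD// ?setIidr//; last by rewrite -ge0_fin_numE.
    by rewrite leeBlDl// ltW.
  have h2 : (mu (U `\` K) <= (e / 2)%:E)%E.
    rewrite measureD// ?setIidr//; last by rewrite -ge0_fin_numE.
    by rewrite leeBlDl// -leeBlDr// ltW.
  rewrite (le_trans (measureU2 mu mUA mUK))// [e]splitr EFinD leeD//.
- move=> x; have /andP[k0x k1x] := k01 x.
  have [Ux|nUx] := pselect (U x); last first.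
    rewrite k0// subr0 indicE memNset; first by rewrite normr0 indicE ler0n.
    by move/AU.
  have [Kx|nKx] := pselect (K x); last first.
    rewrite [leRHS]indicE mem_set; last by right.
    by rewrite indicE; case: (_ \in _); rewrite /= ler_norml; apply/andP; split; lra.
  rewrite k1// !indicE; have [Ax|nAx] := pselect (A x).
    by rewrite (mem_set Ax) subrr normr0 ler0n.
  rewrite (memNset nAx) mem_set; last by left.
  by rewrite sub0r normrN normr1.
Qed.

Lemma cintegral_indic_eq0 (u : X -> R[i]) : sqint_fun mu u ->
  (forall k, ccont k -> cintegral mu (fun x : borel X => k x * (u x)^*%C) = 0) ->
  forall A : set (borel X), measurable A ->
  cintegral mu (fun x : borel X => (\1_A x)%:C%C * (u x)^*%C) = 0.
Proof.
move=> su hk A mA; apply: modc_eq0.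
set M := sqn mu u; have M0 : 0 <= M by exact: sqn_ge0.
apply: (@small_eq0 _ _ (M + 1)) => //; [exact: modc_ge0|lra|] => e e0 e1.
have [k [E [ck mE hE hkE]]] := indic_approx mA (mulr_gt0 e0 e0).
have cck := ccont_real ck; have [B hB] := ccont_bounded compX cck.
have iu := cint_conj (sqint_cint su).
have mind (D : set (borel X)) : measurable D ->
    cmeasurable (fun x : borel X => ((\1_D x : R)%:C)%C).
  by move=> mD; split; [exact: measurable_indic|exact: measurable_cst].
have i1 : cint mu (fun x : borel X => (\1_A x)%:C%C * (u x)^*%C).
  apply: (@cint_Mbounded _ _ _ _ _ _ 1) => //; first exact: mind.
  by move=> x; rewrite modc_real indicE; case: (_ \in _); rewrite ?normr1 ?normr0.
have i2 := cint_Mbounded (ccont_measurable cck) hB iu.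
rewrite -[X in modc X]subr0 -(hk _ cck) -cintegralB//.
have su2 : rint mu (fun x : borel X => modc (u x) ^+ 2) by case: su.
have iE : rint mu (fun x : borel X => \1_E x).
  have [+ _] : cint mu (fun x : borel X => ((\1_E x : R)%:C)%C) => //.
  apply: (@cint_bounded _ _ _ _ _ 1); first exact: mind.
  by move=> x; rewrite modc_real indicE; case: (_ \in _); rewrite ?normr1 ?normr0.
(* On E one uses |u| <= 1/e + e |u|^2. As E has measure at most e^2, both terms integrate to a
   multiple of e. *)
have : modc (cintegral mu (fun x : borel X =>
    (\1_A x)%:C%C * (u x)^*%C - (k x)%:C%C * (u x)^*%C)) <=
    mean mu (fun x : borel X => e^-1 * \1_E x + e * modc (u x) ^+ 2).
  apply: modc_cintegral_le.
  - exact: cint_measurable (cintB i1 i2).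
  - by apply: rintD; exact: rintZ.
  - move=> x; rewrite -mulrBl modcM modc_conj -rmorphB modc_real.
    have h := hkE x; have n0 := normr_ge0 (\1_A x - k x); have m0 := modc_ge0 (u x).
    rewrite (le_trans (ler_wpM2r m0 h))//.
    rewrite indicE; case: (_ \in _); last by rewrite mul0r mulr0 add0r mulr_ge0 ?sqr_ge0// ltW.
    rewrite mul1r mulr1 -(ler_pM2l e0) mulrDr mulfV ?gt_eqF// mulrA -expr2 -exprMn.
    by have := sqr_ge0 (e * modc (u x) - 1); have := mulr_ge0 (ltW e0) m0; nra.
move/le_trans; apply.
rewrite meanD; [|exact: rintZ..].
rewrite !meanZ// -/(sqn mu u) -/M mulrDl mul1r addrC mulrC lerD2l.
rewrite mulrC ler_pdivrMr// /mean /Rintegral.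
have -> : (\int[mu]_x (\1_E x)%:E = mu E)%E by rewrite integral_indic// setIT.
by rewrite -lee_fin fineK// mu_fin.
Qed.

(** For k continuous, [corr k u] is continuous and has no Fourier coefficient, hence vanishes; its
    value at 0 is the inner product of k and u. So u is orthogonal to continuous functions, then to
    indicators, and is zero almost everywhere. *)
Theorem fourier_eq0 (u : X -> R[i]) : sqint_fun mu u ->
  (forall chi : dual X R, fourier mu u chi = 0) -> {ae mu, forall x, u x = 0}.
Proof.
move=> su uhat; have iu := sqint_cint su.
have hk k : ccont k -> cintegral mu (fun x : borel X => k x * (u x)^*%C) = 0.
  move=> ck; have cc := corr_cont compX ck iu.
  have := continuous_fourier_eq0 compX haar_mu cc _ 0.
  rewrite {2}/corr /ip => <-; last first.
    move=> chi; rewrite (fourier_corr compX haar_mu chi ck iu) uhat.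
    by rewrite conjc0 mulr0.
  by congr cintegral; apply/funext => x; rewrite /shf addr0.
have h0 := cintegral_indic_eq0 su hk.
have key (g : borel X -> R) : rint mu g ->
    (forall A : set (borel X), measurable A -> mean mu (fun x => \1_A x * g x) = 0) ->
    ae_eq mu setT (EFin \o g) (cst 0%E).
  move=> ig hg; apply: integral_ae_eq => //.
  move=> A _ mA; rewrite integral0; have := hg A mA.
  rewrite /mean /Rintegral => /eqP; rewrite fine_eq0; last first.
    apply: integrable_fin_num => //; apply: (@rint_le _ _ _ mu _ (fun x => `|g x|)).
    - apply: measurable_funM; [exact: measurable_indic|exact: rint_measurable ig].
    - exact: integrable_abse ig.
    - move=> x; rewrite normrM indicE; case: (_ \in _); rewrite ?normr1 ?mul1r//.
      by rewrite normr0 mul0r.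
  move=> /eqP <-; rewrite integral_mkcond; apply: eq_integral => x _.
  by rewrite patchE indicE; case: (_ \in _); rewrite ?mul1r ?mul0r.
have hr : ae_eq mu setT (EFin \o (@complex.Re R \o u)) (cst 0%E).
  apply: key; first exact: iu.1.
  move=> A mA; have /(congr1 (@complex.Re R)) /= := h0 A mA.
  move=> <-; apply: eq_Rintegral => x _ /=; rewrite !cE/=; ring.
have hi : ae_eq mu setT (EFin \o (@complex.Im R \o u)) (cst 0%E).
  apply: key; first exact: iu.2.
  move=> A mA; have /(congr1 (@complex.Im R)) /= := h0 A mA.
  move=> /(congr1 (fun r => - r)); rewrite oppr0 => <-.
  rewrite -mulN1r -meanZ.
    by apply: eq_Rintegral => x _ /=; rewrite !cE/=; ring.
  have i1 : cint mu (fun x : borel X => (\1_A x)%:C%C * (u x)^*%C).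
    apply: (@cint_Mbounded _ _ _ _ _ _ 1).
    - by split; [exact: measurable_indic|exact: measurable_cst].
    - by move=> x; rewrite modc_real indicE; case: (_ \in _); rewrite ?normr1 ?normr0.
    - exact: cint_conj.
  exact: i1.2.
apply: filterS2 hr hi => x /(_ I) [r0] /(_ I) [i0]; exact: complexP.
Qed.

Lemma fourier_shf f (chi : dual X R) y : ccont f ->
  fourier mu (shf y f) chi = chi y * fourier mu f chi.
Proof.
move=> cf; have [cchi m h] := dualP chi; rewrite -/(ccont chi) in cchi.
have icc := ccont_cint mu compX (ccontM (ccont_conj cchi) cf).
rewrite /fourier -[in RHS](cintegral_shift haar_mu y icc).
rewrite -cintegralZ; last exact: (cint_shift haar_mu y icc).
congr cintegral; apply/funext => x; rewrite mulrA; congr (_ * _).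
by rewrite h rmorphM mulrCA mulc_conj m expr1n mulr1.
Qed.

(** If all characters agree at x0 and x1, then b and its translate by x1 - x0 have the same
    coefficients for every continuous b, so they coincide. A Urysohn function with b x0 = 0 and b x1
    = 1 contradicts this. *)
Lemma characters_separate x0 x1 : (forall chi : dual X R, chi x0 = chi x1) -> x0 = x1.
Proof.
move=> hchi; apply: contrapT => x01.
have c1 x : closed [set x : X] by apply: accessible_closed_set1; exact: hausdorff_accessible.
have [k [ck _ k0 k1]] : exists k : X -> R, [/\ continuous k, forall x, 0 <= k x <= 1,
    forall x, [set x0] x -> k x = 0 & forall x, [set x1] x -> k x = 1].
  apply: urysohn_real => //; rewrite -subset0 => x [/= -> //].
have cb := ccont_real ck; set b := (fun x => _) in cb.
have cv := ccontB cb (shf_cont (x1 - x0) cb).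
have := continuous_fourier_eq0 compX haar_mu cv _ x0.
rewrite /shf [x0 + _]addrC subrK /b k0// k1// => h.
have /h : forall chi : dual X R, fourier mu (fun x => b x - shf (x1 - x0) b x) chi = 0.
  move=> chi; have [cchi m hh] := dualP chi; rewrite -/(ccont chi) in cchi.
  have icc f (cf : ccont f) := ccont_cint mu compX (ccontM (ccont_conj cchi) cf).
  have -> : fourier mu (fun x => b x - shf (x1 - x0) b x) chi =
    fourier mu b chi - fourier mu (shf (x1 - x0) b) chi.
    rewrite /fourier -cintegralB; [|exact: icc cb|exact: icc (shf_cont _ cb)].
    by congr cintegral; apply/funext => x; rewrite mulrBr.
  have c0 := character_neq0 chi x0.
  have hx : chi (x1 - x0) = 1.
    by apply: (mulIf c0); rewrite -hh subrK mul1r.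
  by rewrite (fourier_shf chi (x1 - x0) cb) hx mul1r subrr.
by move=> /(congr1 (@complex.Re R)) /=; lra.
Qed.

(** * Trigonometric polynomials that peak at a point *)

Inductive trig : (X -> R[i]) -> Prop :=
| trig_char (chi : dual X R) : trig chi
| trigD f g : trig f -> trig g -> trig (fun x => f x + g x)
| trigZ (z : R[i]) f : trig f -> trig (fun x => z * f x).

Lemma trig_ccont f : trig f -> ccont f.
Proof.
elim=> [chi|{}f g _ cf _ cg|z {}f _ cf].
- by have [c _ _] := dualP chi.
- exact: ccontD cf cg.
- exact: (ccontZ z cf).
Qed.

Lemma trigM f g : trig f -> trig g -> trig (fun x => f x * g x).
Proof.
move=> hf; elim: hf g => [chi|f1 f2 _ h1 _ h2|z f1 _ h1] g hg.
- elim: hg => [psi|g1 g2 _ k1 _ k2|z g1 _ k1].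
  + have -> : (fun x => chi x * psi x) = (chi + psi : dual X R) by apply/funext.
    exact: trig_char.
  + have -> : (fun x => chi x * (g1 x + g2 x)) = fun x => chi x * g1 x + chi x * g2 x.
      by apply/funext => x; rewrite mulrDr.
    exact: trigD.
  + have -> : (fun x => chi x * (z * g1 x)) = fun x => z * (chi x * g1 x).
      by apply/funext => x; rewrite mulrCA.
    exact: trigZ.
- have -> : (fun x => (f1 x + f2 x) * g x) = fun x => f1 x * g x + f2 x * g x.
    by apply/funext => x; rewrite mulrDl.
  by apply: trigD; [exact: h1|exact: h2].
- have -> : (fun x => z * f1 x * g x) = fun x => z * (f1 x * g x).
    by apply/funext => x; rewrite mulrA.
  by apply: trigZ; exact: h1.
Qed.

Lemma trig1 : trig (fun=> 1).
Proof.
have -> : (fun _ : X => 1 : R[i]) = (0 : dual X R) by apply/funext.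
exact: trig_char.
Qed.

Lemma trigX n f : trig f -> trig (fun x => f x ^+ n).
Proof.
move=> hf; elim: n => [|n ih]; first exact: trig1.
under eq_fun do rewrite exprS.
exact: trigM.
Qed.

(** Equal frequencies are collected so that the list has no duplicates, as Parseval's identity
    [sqn_trig] requires. *)
Lemma trig_sum f : trig f -> exists (s : seq (dual X R)) (w : dual X R -> R[i]),
  uniq s /\ f = (fun x => \sum_(xi <- s) w xi * xi x).
Proof.
elim=> [chi|{}f g _ [s [w [us ->]]] _ [t [v [ut ->]]]|z {}f _ [s [w [us ->]]]].
- exists [:: chi], (fun=> 1); split=> //.
  by apply/funext => x; rewrite big_seq1 mul1r.
- exists (undup (s ++ t)), (fun xi => (if xi \in s then w xi else 0) +
    (if xi \in t then v xi else 0)); split; first exact: undup_uniq.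
  apply/funext => x; under [RHS]eq_bigr do rewrite mulrDl.
  have part (r : seq (dual X R)) (c : dual X R -> R[i]) : uniq r ->
      {subset r <= undup (s ++ t)} ->
      \sum_(xi <- r) c xi * xi x =
      \sum_(xi <- undup (s ++ t)) (if xi \in r then c xi else 0) * xi x.
    move=> ur sr; rewrite [RHS](bigID (mem r)) /= [X in _ + X]big1 ?addr0; last first.
      by move=> xi /negbTE ->; rewrite mul0r.
    rewrite [RHS](eq_bigr (fun xi => c xi * xi x)); last by move=> xi ->.
    rewrite -[RHS]big_filter.
    apply: perm_big; apply: uniq_perm => //; first by rewrite filter_uniq// undup_uniq.
    by move=> xi; rewrite mem_filter; case: (boolP (xi \in r)) => //= /sr ->.
  rewrite big_split /=; congr (_ + _); apply: part => // xi;
    by rewrite mem_undup mem_cat => ->; rewrite ?orbT.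
- exists s, (fun xi => z * w xi); split=> //.
  by apply/funext => x; rewrite mulr_sumr; apply: eq_bigr => xi _; rewrite mulrA.
Qed.

Let unit_at x0 : set (X -> R[i]) :=
  [set h | [/\ trig h, h x0 = 1 & forall x, modc (h x) <= 1]].

(** Take (1 + z) / 2 with z = conj(chi x0) chi for a character chi separating x and x0: an average
    of two unimodular numbers has modulus below 1 unless they are equal. *)
Lemma unit_at_separates x0 x : x <> x0 ->
  exists2 h, unit_at x0 h & modc (h x) < 1.
Proof.
move=> xx0; have [chi hchi] : exists chi : dual X R, chi x <> chi x0.
  apply: contrapT => /forallNP h; apply: xx0; apply: characters_separate => chi.
  exact: contrapT (h chi).
have [_ m _] := dualP chi.
pose z y := (chi x0)^*%C * chi y.
have mz y : modc (z y) = 1 by rewrite modcM modc_conj !m mulr1.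
have half : modc (2^-1 : R[i]) = 2^-1.
  by rewrite (_ : (2^-1 : R[i]) = ((2^-1 : R)%:C)%C) ?modc_real ?ger0_norm// fmorphV rmorph_nat.
exists (fun y => 2^-1 * (1 + z y)).
  split.
  - by apply: trigZ; apply: trigD; [exact: trig1|apply: trigZ; exact: trig_char].
  - by rewrite /z mulrC [_ * chi x0]mulrC mulc_conj m expr1n; field.
  - move=> y; rewrite modcM half; have := le_modcD 1 (z y); rewrite modc1 mz; lra.
rewrite modcM half.
have z1 : z x <> 1.
  move=> h; apply: hchi; apply: (mulfI (x := (chi x0)^*%C)).
    by apply/eqP => /(congr1 (fun z => modc z)); rewrite modc_conj m modc0; lra.
  by rewrite -/(z x) h mulrC mulc_conj m expr1n.
have h2 : modc (1 + z x) ^+ 2 = 2 + 2 * complex.Re (z x).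
  exact: modc_sqr1D.
have Re1 : complex.Re (z x) < 1.
  rewrite lt_neqAle; apply/andP; split; last first.
    by rewrite (le_trans (ler_norm _))// (le_trans (ler_modc_Re _))// mz.
  apply/eqP => Re1; apply: z1; apply: complexP => //=.
  have := modc_sqr (z x); rewrite mz Re1 => h.
  by apply/eqP; rewrite -sqrf_eq0; apply/eqP; lra.
have m0 := modc_ge0 (1 + z x); nra.
Qed.

Lemma unit_atM x0 h h' : unit_at x0 h -> unit_at x0 h' ->
  unit_at x0 (fun x => h x * h' x).
Proof.
move=> [t1 e1 b1] [t2 e2 b2]; split; first exact: trigM.
- by rewrite e1 e2 mulr1.
- by move=> x; rewrite modcM mulr_ile1 ?modc_ge0.
Qed.

Lemma unit_at_peak x0 (U : set X) : open U -> U x0 ->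
  exists2 h, unit_at x0 h & forall x, ~ U x -> modc (h x) <= 1 / 2.
Proof.
move=> oU Ux0.
have cU : closed (~` U) by rewrite closedC.
have /compact_near_coveringP nc : compact (~` U).
  by apply: (subclosed_compact cU compX).
(* The filter of functions dominated by a given member of [unit_at x0]; it is directed because a
   product is dominated by each factor. Smallness near each point off U, obtained from powers of a
   separating function, then becomes uniform by compactness. *)
pose F : set_system (X -> R[i]) := filter_from (unit_at x0)
  (fun h => [set h' | unit_at x0 h' /\ forall x, modc (h' x) <= modc (h x)]).
have FF : Filter F.
  apply: filter_from_filter.
    exists (fun=> 1); split=> //; first exact: trig1.
    by move=> x; rewrite modc1.
  move=> h1 h2 u1 u2; exists (fun x => h1 x * h2 x); first exact: unit_atM.
  move=> h [uh hh]; have [_ _ b1] := u1; have [_ _ b2] := u2.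
  split; split=> // x; rewrite (le_trans (hh x))// modcM.
    by rewrite ler_piMr ?modc_ge0.
  by rewrite ler_piMl ?modc_ge0.
have cov x : (~` U) x -> \forall x' \near x & h \near F, modc (h x') <= 1 / 2.
  move=> nUx; have [|h uh hx] := @unit_at_separates x0 x.
    by move=> xx0; apply: nUx; rewrite xx0.
  set r := (modc (h x) + 1) / 2.
  have r0 : 0 <= r by have := modc_ge0 (h x); rewrite /r; lra.
  have r1 : r < 1 by rewrite /r; lra.
  have [n hn] : exists n, r ^+ n <= 1 / 2.
    have : (fun n => r ^+ n) @ \oo --> (0 : R) by apply: cvg_expr; rewrite ger0_norm.
    move=> /cvgrPdist_le /(_ (1 / 2)) [|N _ hN]; first by lra.
    exists N; have := hN N (leqnn N); rewrite /= sub0r normrN ger0_norm// exprn_ge0//.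
  have uhn : unit_at x0 (fun x => h x ^+ n).
    have [t e b] := uh; split; first exact: trigX.
    - by rewrite e expr1n.
    - move=> y; rewrite [modc _](_ : _ = modc (h y) ^+ n); first by rewrite exprn_ile1 ?modc_ge0.
      by elim: {+}n => [|k ih]; rewrite ?modc1// !exprS modcM ih.
  have [th _ _] := uh; have /ccontP ch := trig_ccont th.
  have d0 : 0 < (1 - modc (h x)) / 2 by rewrite divr_gt0// subr_gt0.
  exists ([set x' | modc (h x - h x') <= (1 - modc (h x)) / 2],
    [set h' | unit_at x0 h' /\ forall y, modc (h' y) <= modc (h y ^+ n)]) => /=.
    by split; [exact: ch|exists (fun x => h x ^+ n)].
  move=> [x' h'] /= [h1 [_ h2]]; apply: le_trans (h2 x') _.
  rewrite [modc _](_ : _ = modc (h x') ^+ n); last first.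
    by elim: {+}n => [|k ih]; rewrite ?modc1// !exprS modcM ih.
  apply: le_trans hn; apply: lerXn2r; rewrite ?nnegrE ?modc_ge0//.
  by rewrite modcB in h1; have := le_modc_sub (h x') (h x); rewrite /r; lra.
have [h uh hh] := nc _ F (fun h x => modc (h x) <= 1 / 2) FF cov.
exists h => // x nUx; apply: hh => //; split=> //.
Qed.

Lemma rint_indic (A : set (borel X)) : measurable A -> rint mu (fun x => \1_A x : R).
Proof.
move=> mA; have [+ _] : cint mu (fun x : borel X => ((\1_A x : R)%:C)%C) => //.
apply: (@cint_bounded _ _ _ _ _ 1).
  by split; [exact: measurable_indic|exact: measurable_cst].
by move=> x; rewrite modc_real indicE; case: (_ \in _); rewrite ?normr1 ?normr0.
Qed.

Lemma mean_indic (A : set (borel X)) : measurable A ->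
  mean mu (fun x => \1_A x : R) = fine (mu A).
Proof.
by move=> mA; rewrite /mean /Rintegral integral_indic// setIT.
Qed.

Lemma rint_indicM (A : set (borel X)) (f : borel X -> R) : measurable A ->
  rint mu f -> rint mu (fun x => \1_A x * f x).
Proof.
move=> mA hf; apply: (@rint_le _ _ _ mu _ (fun x => `|f x|)).
- by apply: measurable_funM; [exact: measurable_indic|exact: rint_measurable hf].
- exact: integrable_abse hf.
- move=> x; rewrite normrM indicE; case: (_ \in _); rewrite ?normr1 ?mul1r//.
  by rewrite normr0 mul0r.
Qed.

(** W is a power h^n of a peaking polynomial: |h|^2 >= 9/16 on a neighbourhood N of x0 and |h|^2 <=
    1/4 off U, so the relative mass off U is at most (4/9)^n / mu N. *)
Lemma trig_peak x0 (U : set X) (e : R) : open U -> U x0 -> 0 < e ->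
  exists W, [/\ trig W, 0 < sqn mu W &
    mean mu (fun x : borel X => \1_(~` U) x * modc (W x) ^+ 2) <= e * sqn mu W].
Proof.
move=> oU Ux0 e0; have [h [th h1 hb] hU] := unit_at_peak oU Ux0.
have ch := trig_ccont th; have /ccontP/(_ x0 (1 / 4)) cch := ch.
have : \forall y \near x0, modc (h x0 - h y) <= 1 / 4 by apply: cch; lra.
rewrite /prop_near1 nbhsE => -[N [oN Nx0] hN].
have mN := open_measurable_borel oN.
have mUc : measurable (~` U : set (borel X)).
  by apply: measurableC; exact: open_measurable_borel.
have muN : 0 < fine (mu N).
  rewrite fine_gt0// lt0e measure_ge0 andbT (open_null compX haar_mu oN Nx0)/=.
  by rewrite -ge0_fin_numE// mu_fin.
set m := fine (mu N) in muN.
have [n hn] : exists n, (4 / 9) ^+ n <= e * m.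
  have em : 0 < e * m by rewrite mulr_gt0.
  have : (fun n => (4 / 9) ^+ n) @ \oo --> (0 : R).
    by apply: cvg_expr; rewrite ger0_norm; lra.
  move=> /cvgrPdist_le /(_ _ em) [N' _ hN']; exists N'.
  by have := hN' N' (leqnn N'); rewrite /= sub0r normrN ger0_norm// exprn_ge0//; lra.
set W := fun x => h x ^+ n.
have mW x : modc (W x) ^+ 2 = (modc (h x) ^+ 2) ^+ n.
  rewrite -exprM mulnC exprM; congr (_ ^+ _); rewrite /W.
  by elim: {+}n => [|k ih]; rewrite ?modc1// !exprS modcM ih.
have tW : trig W by exact: trigX.
have [_ sW] := ccont_sqint mu compX (trig_ccont tW).
have lo : (9 / 16) ^+ n * m <= sqn mu W.
  rewrite /m -mean_indic// -meanZ; last exact: rint_indic.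
  apply: mean_le => //; first by apply: rintZ; exact: rint_indic.
  move=> x; rewrite mW indicE; have [Nx|nNx] := pselect (N x).
    rewrite (mem_set Nx) mulr1; have := hN _ Nx; rewrite h1 => hx.
    have := le_modc_sub 1 (h x); rewrite modc1 => h3.
    have h4 : 3 / 4 <= modc (h x) by lra.
    have h5 : 9 / 16 <= modc (h x) ^+ 2 by nra.
    by apply: lerXn2r h5; rewrite nnegrE ?sqr_ge0//; lra.
  by rewrite (memNset nNx) mulr0 exprn_ge0// sqr_ge0.
have p0 : 0 < (9 / 16) ^+ n * m by rewrite mulr_gt0// exprn_gt0//; lra.
exists W; split=> //; first exact: lt_le_trans lo.
have up : mean mu (fun x : borel X => \1_(~` U) x * modc (W x) ^+ 2) <= (1 / 4) ^+ n.
  rewrite -[leRHS](mean_cst mu); apply: mean_le; [exact: rint_indicM|exact: rint_cst|].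
  move=> x; rewrite mW indicE; have [nUx|Ux] := pselect ((~` U) x).
    rewrite (mem_set nUx) [leLHS]mul1r; have h5 : modc (h x) ^+ 2 <= 1 / 4.
      by have := hU _ nUx; have := modc_ge0 (h x); nra.
    by apply: lerXn2r h5; rewrite nnegrE ?sqr_ge0//; lra.
  by rewrite (memNset Ux) mul0r exprn_ge0//; lra.
apply: le_trans up _; apply: le_trans (ler_wpM2l (ltW e0) lo).
rewrite mulrCA; have -> : (1 / 4 : R) = 9 / 16 * (4 / 9) by field.
by rewrite exprMn ler_wpM2l// exprn_ge0//; lra.
Qed.

Lemma sup_le_trig F (C : R) : ccont F -> 0 <= C ->
  (forall W, trig W ->
    modc (cintegral mu (fun x : borel X => F x * (W x * (W x)^*%C))) <= C * sqn mu W) ->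
  forall x, modc (F x) <= C.
Proof.
move=> cF C0 hC x0; have [B hB] := ccont_bounded compX cF.
have B0 : 0 <= B by apply: le_trans (hB x0); exact: modc_ge0.
suff : modc (F x0) - C <= 0 by rewrite subr_le0.
rewrite leNgt; apply/negP => d0; set d := modc (F x0) - C in d0.
(* The error below is e (1 + 2 B) |W|^2, that is d/2 times |W|^2, whereas an excess d over C needs
   at least d |W|^2. *)
set e := d / (2 * (1 + 2 * B)).
have e0 : 0 < e by rewrite divr_gt0// mulr_gt0//; lra.
have /ccontP/(_ x0 e e0) := cF.
rewrite /prop_near1 nbhsE => -[U [oU Ux0] hU].
have [W [tW W0 hW]] := trig_peak oU Ux0 e0.
have cW := trig_ccont tW; have [_ sW] := ccont_sqint mu compX cW.
have cWW := ccontM cW (ccont_conj cW).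
have i1 := ccont_cint mu compX (ccontM cF cWW).
have i2 := ccont_cint mu compX (ccontZ (F x0) cWW).
have mUc : measurable (~` U : set (borel X)).
  by apply: measurableC; exact: open_measurable_borel.
have mWW x : modc (W x * (W x)^*%C) = modc (W x) ^+ 2 by rewrite modcM modc_conj expr2.
have key : modc (cintegral mu (fun x : borel X => F x0 * (W x * (W x)^*%C)) -
    cintegral mu (fun x : borel X => F x * (W x * (W x)^*%C))) <=
    e * sqn mu W + 2 * B * (e * sqn mu W).
  rewrite -cintegralB//.
  apply: (@le_trans _ _ (mean mu (fun x : borel X =>
    e * modc (W x) ^+ 2 + 2 * B * (\1_(~` U) x * modc (W x) ^+ 2)))).
    apply: modc_cintegral_le.
    - exact: cint_measurable (cintB i2 i1).
    - by apply: rintD; apply: rintZ => //; exact: rint_indicM.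
    - move=> x; rewrite -mulrBl modcM mWW indicE.
      have s0 := sqr_ge0 (modc (W x)).
      have [nUx|Ux] := pselect ((~` U) x).
        rewrite (mem_set nUx) mul1r -mulrDl ler_wpM2r//.
        have := le_modcB (F x0) (F x); have := hB x; have := hB x0; lra.
      rewrite (memNset Ux) mul0r mulr0 addr0 ler_wpM2r//; apply: hU.
      exact: contrapT.
  rewrite meanD; [|exact: rintZ|by apply: rintZ; exact: rint_indicM].
  rewrite !meanZ//; last exact: rint_indicM.
  by rewrite lerD2l ler_wpM2l//; lra.
have eq1 : cintegral mu (fun x : borel X => F x0 * (W x * (W x)^*%C)) =
    F x0 * ((sqn mu W)%:C)%C.
  rewrite cintegralZ; last exact: (ccont_cint mu compX cWW).
  by congr (_ * _); exact: ip_self (ccont_sqint mu compX cW).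
rewrite eq1 in key.
have := le_modc_sub (F x0 * ((sqn mu W)%:C)%C)
  (cintegral mu (fun x : borel X => F x * (W x * (W x)^*%C))).
rewrite modcM modc_real ger0_norm ?sqn_ge0// => h1.
have h2 := hC W tW.
have h3 : d * sqn mu W <= (e * (1 + 2 * B)) * sqn mu W by rewrite /d; lra.
rewrite ler_pM2r// in h3; move: h3.
have -> : e * (1 + 2 * B) = d / 2 by rewrite /e; field; lra.
lra.
Qed.

End fourier_injective.

(** * Unconditional sums and bounded matrices *)

Section unconditional_sums.
Context {R : realType} {I : choiceType}.
Implicit Types (a b : I -> R[i]) (T : {fset I}).

(** Convergence of the net of finite partial sums, a relation that is linear by construction;
    [has_csum_csum] ties it to [csum] for absolutely summable families. *)
Definition has_csum a (z : R[i]) := forall e : R, 0 < e -> exists T0 : {fset I},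
  forall T : {fset I}, (T0 `<=` T)%fset -> modc (z - \sum_(i <- T) a i) <= e.

Lemma has_csum_eq a z z' : has_csum a z -> has_csum a z' -> z = z'.
Proof.
move=> h h'; apply/eqP; rewrite -subr_eq0; apply/eqP/modc_eq0.
apply/eqP; rewrite eq_le modc_ge0 andbT; apply/ler_addgt0Pr => e e0; rewrite add0r.
have e20 : 0 < e / 2 by rewrite divr_gt0.
have [T hT] := h _ e20; have [T' hT'] := h' _ e20.
have h1 := hT (T `|` T')%fset (fsubsetUl _ _); have h2 := hT' (T `|` T')%fset (fsubsetUr _ _).
rewrite (le_trans (le_modcBD (\sum_(i <- (T `|` T')%fset) a i) _ _))// [e]splitr lerD//.
by rewrite modcB.
Qed.

Lemma has_csumD a b z z' : has_csum a z -> has_csum b z' ->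
  has_csum (fun i => a i + b i) (z + z').
Proof.
move=> h h' e e0; have e20 : 0 < e / 2 by rewrite divr_gt0.
have [T hT] := h _ e20; have [T' hT'] := h' _ e20.
exists (T `|` T')%fset => U; rewrite fsubUset => /andP[TU T'U].
rewrite big_split /= opprD addrACA (le_trans (le_modcD _ _))// [e]splitr lerD//.
  exact: hT.
exact: hT'.
Qed.

Lemma has_csumZ c a z : has_csum a z -> has_csum (fun i => c * a i) (c * z).
Proof.
move=> h e e0; have e1 : 0 < e / (modc c + 1).
  by rewrite divr_gt0// ltr_wpDl// modc_ge0.
have [T hT] := h _ e1; exists T => U TU.
rewrite -mulr_sumr -mulrBr modcM (le_trans (ler_wpM2l (modc_ge0 c) (hT U TU)))//.
have m0 := modc_ge0 c; rewrite mulrCA ler_piMr ?(ltW e0)// ler_pdivrMr; lra.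
Qed.

Lemma has_csum0 : has_csum (fun=> 0) 0.
Proof. by move=> e e0; exists fset0 => T _; rewrite big1// subr0 modc0 ltW. Qed.

Lemma has_csum_sum (J : Type) (s : seq J) (a : J -> I -> R[i]) (z : J -> R[i]) :
  (forall j, has_csum (a j) (z j)) ->
  has_csum (fun i => \sum_(j <- s) a j i) (\sum_(j <- s) z j).
Proof.
move=> h; elim: s => [|j s ih].
  by rewrite big_nil; under eq_fun do rewrite big_nil; exact: has_csum0.
by rewrite big_cons; under eq_fun do rewrite big_cons; exact: has_csumD.
Qed.

Lemma has_csum_le a z (B : R) : has_csum a z ->
  (forall T : {fset I}, modc (\sum_(i <- T) a i) <= B) -> modc z <= B.
Proof.
move=> h hB; apply/ler_addgt0Pr => e e0; have [T hT] := h _ e0.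
have := hT T (fsubset_refl _); have := hB T.
by have := le_modc_sub z (\sum_(i <- T) a i); lra.
Qed.

Lemma has_csum_ge (a : I -> R[i]) (r : R) z (B : R) : has_csum a z -> modc z <= B ->
  (exists T0 : {fset I}, forall T : {fset I}, (T0 `<=` T)%fset ->
     r <= modc (\sum_(i <- T) a i)) -> r <= B.
Proof.
move=> h hB [T0 hT0]; apply/ler_addgt0Pr => e e0; have [T hT] := h _ e0.
have h1 := hT (T `|` T0)%fset (fsubsetUl _ _); have h2 := hT0 (T `|` T0)%fset (fsubsetUr _ _).
by rewrite modcB in h1; have := le_modc_sub (\sum_(i <- (T `|` T0)%fset) a i) z; lra.
Qed.

Lemma sum_fset_le (a : I -> R) (T U : {fset I}) : (forall i, 0 <= a i) ->
  (T `<=` U)%fset -> \sum_(i <- T) a i <= \sum_(i <- U) a i.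
Proof.
move=> a0 TU; rewrite [leRHS](bigID (mem T)) /= -[X in _ <= X + _]big_filter.
rewrite (_ : \sum_(i <- T) a i = \sum_(i <- [seq i <- U | i \in T]) a i).
  by rewrite lerDl sumr_ge0.
apply: perm_big; apply: uniq_perm; rewrite ?filter_uniq ?fset_uniq// => i.
rewrite mem_filter; case: (boolP (i \in T)) => //= iT.
by rewrite (fsubsetP TU).
Qed.

Lemma esum_fset_ge (a : I -> R) (T : {fset I}) :
  ((\sum_(i <- T) a i)%:E <= \esum_(i in setT) (a i)%:E)%E.
Proof.
apply: esum_ge; exists [set` T]; first by split => //; exact: finite_fset.
by rewrite fsbig_finite//= set_fsetK sumEFin.
Qed.

Lemma esum_le_bound (a : I -> R) (B : R) :
  (forall T : {fset I}, \sum_(i <- T) a i <= B) ->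
  (\esum_(i in setT) (a i)%:E <= B%:E)%E.
Proof.
move=> h; apply: ge_ereal_sup => _ [A [fA _] <-].
by rewrite fsbig_finite//= sumEFin lee_fin.
Qed.

Lemma esum_approx (a : I -> R) (B : R) : (forall i, 0 <= a i) ->
  (forall T : {fset I}, \sum_(i <- T) a i <= B) ->
  exists r : R, (\esum_(i in setT) (a i)%:E = r%:E)%E /\
  forall e, 0 < e -> exists T0 : {fset I}, forall T : {fset I}, (T0 `<=` T)%fset ->
    `|r - \sum_(i <- T) a i| <= e.
Proof.
move=> a0 hB; set S := (\esum_(i in setT) (a i)%:E)%E.
have S0 : (0 <= S)%E by apply: esum_ge0 => i _; rewrite lee_fin.
have fS : S \is a fin_num.
  by rewrite ge0_fin_numE// (le_lt_trans (esum_le_bound hB))// ltry.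
exists (fine S); rewrite fineK//; split=> // e e0.
have [_ [A [fA _] <-] hA] := ub_ereal_sup_adherent e0 fS.
rewrite fsbig_finite//= sumEFin in hA.
have hA' : fine S - e < \sum_(i <- fset_set A) a i.
  by rewrite -lte_fin EFinB fineK.
exists (fset_set A) => T AT; have h1 := sum_fset_le a0 AT.
have h2 : \sum_(i <- T) a i <= fine S by rewrite -lee_fin fineK// esum_fset_ge.
by rewrite ger0_norm ?subr_ge0//; lra.
Qed.

Lemma rsum_approx (a : I -> R) (B : R) :
  (forall T : {fset I}, \sum_(i <- T) `|a i| <= B) ->
  forall e, 0 < e -> exists T0 : {fset I}, forall T : {fset I}, (T0 `<=` T)%fset ->
    `|rsum a - \sum_(i <- T) a i| <= e.
Proof.
move=> hB.
pose p i := Num.max (a i) 0; pose n i := Num.max (- a i) 0.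
have p0 i : 0 <= p i by rewrite le_max lexx orbT.
have n0 i : 0 <= n i by rewrite le_max lexx orbT.
have pa i : p i <= `|a i| by rewrite ge_max ler_norm normr_ge0.
have na i : n i <= `|a i| by rewrite ge_max -normrN ler_norm normr_ge0.
have apn i : a i = p i - n i.
  by rewrite /p /n; case: (leP (a i) 0) => h; case: (leP (- a i) 0) => h'; lra.
have [|P [EP hP]] := @esum_approx p B p0.
  by move=> T; rewrite (le_trans _ (hB T))// ler_sum.
have [|N [EN hN]] := @esum_approx n B n0.
  by move=> T; rewrite (le_trans _ (hB T))// ler_sum.
have -> : rsum a = P - N.
  rewrite /rsum (_ : (EFin \o a)^\+ = fun i => (p i)%:E)%E; last first.
    by apply/funext => i; rewrite funeposE /= -EFin_max.
  rewrite (_ : (EFin \o a)^\- = fun i => (n i)%:E)%E; last first.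
    by apply/funext => i; rewrite funenegE /= -EFin_max.
  by rewrite EP EN.
move=> e e0; have e20 : 0 < e / 2 by rewrite divr_gt0.
have [T hT] := hP _ e20; have [T' hT'] := hN _ e20.
exists (T `|` T')%fset => U; rewrite fsubUset => /andP[TU T'U].
under eq_bigr do rewrite apn.
rewrite sumrB opprB addrACA [- N + _]addrC -[X in _ + X]opprB -opprB.
have := hT U TU; have := hT' U T'U; rewrite !ler_norml => /andP[k1 k2] /andP[k3 k4].
by apply/andP; split; lra.
Qed.

Lemma has_csum_csum a (B : R) : (forall T : {fset I}, \sum_(i <- T) modc (a i) <= B) ->
  has_csum a (csum a).
Proof.
move=> hB e e0; have e20 : 0 < e / 2 by rewrite divr_gt0.
have [|T hT] := @rsum_approx (@complex.Re R \o a) B _ _ e20.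
  by move=> T; rewrite (le_trans _ (hB T))// ler_sum// => i _; exact: ler_modc_Re.
have [|T' hT'] := @rsum_approx (@complex.Im R \o a) B _ _ e20.
  by move=> T'; rewrite (le_trans _ (hB T'))// ler_sum// => i _; exact: ler_modc_Im.
exists (T `|` T')%fset => U; rewrite fsubUset => /andP[TU T'U].
have := hT U TU; have := hT' U T'U => h1 h2.
have Esum : (\sum_(i <- U) a i) = ((\sum_(i <- U) complex.Re (a i)) +i*
    (\sum_(i <- U) complex.Im (a i)))%C.
  elim/big_rec3 : _ => // i x y z _ ->.
  by apply: complexP; rewrite !cE.
rewrite (le_trans (le_modc_ReIm _))// !cE Esum /= [e]splitr lerD//.
Qed.

Lemma has_csum_bij (h : I -> I) a z : bijective h ->
  has_csum (a \o h) z -> has_csum a z.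
Proof.
move=> [g hK gK] ha e e0; have [T hT] := ha e e0.
exists [fset h i | i in T]%fset => U TU.
have := hT [fset g i | i in U]%fset;
rewrite (_ : \sum_(i <- [fset g i | i in U]%fset) _ = \sum_(i <- U) a i).
  apply; apply/fsubsetP => i iT; apply/imfsetP; exists (h i) => //=.
  by apply: (fsubsetP TU); apply/imfsetP; exists i.
have -> : \sum_(i <- U) a i = \sum_(i <- [seq g i | i <- U]) (a \o h) i.
  by rewrite big_map; apply: eq_bigr => i _ /=; rewrite gK.
apply: perm_big; apply: uniq_perm.
- exact: fset_uniq.
- by rewrite map_inj_uniq ?fset_uniq//; exact: can_inj gK.
- by move=> i; apply/imfsetP/mapP => /= -[j jU ->]; exists j.
Qed.

End unconditional_sums.

(** * Bounded matrices, tested on finitely supported vectors *)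

Section bounded_forms.
Context {R : realType} {I : choiceType}.
Implicit Types (M : I -> I -> R[i]) (S T : seq I) (z w : I -> R[i]) (C : R).

Definition sqsum S z : R := \sum_(i <- S) modc (z i) ^+ 2.

Definition bilin M S T z w : R[i] := \sum_(x <- S) \sum_(y <- T) z x * M x y * w y.

(* |<M w, z>| <= C |z| |w| on finitely supported vectors, stated without square *)
(* roots.                                                                      *)
Definition bounded_form C M := forall S T z w (t : R), uniq S -> uniq T -> 0 < t ->
  2 * modc (bilin M S T z w) <= C * (t * sqsum S z + t^-1 * sqsum T w).

Definition apply_mx M T w x : R[i] := \sum_(y <- T) M x y * w y.

Definition bounded_mx C M := forall S T w, uniq S -> uniq T ->
  sqsum S (apply_mx M T w) <= C ^+ 2 * sqsum T w.

Lemma sqsum_ge0 S z : 0 <= sqsum S z.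
Proof. by apply: sumr_ge0 => i _; exact: sqr_ge0. Qed.

Lemma formE M S T z w : bilin M S T z w = \sum_(x <- S) z x * apply_mx M T w x.
Proof.
apply: eq_bigr => x _; rewrite /apply_mx mulr_sumr.
by apply: eq_bigr => y _; rewrite mulrA.
Qed.

Lemma bounded_form_le C C' M : C <= C' -> bounded_form C M -> bounded_form C' M.
Proof.
move=> CC h S T z w t uS uT t0; rewrite (le_trans (h _ _ _ _ _ uS uT t0))//.
by rewrite ler_wpM2r// addr_ge0// mulr_ge0 ?sqsum_ge0 ?invr_ge0// ltW.
Qed.

Lemma le_of_gt0 (a c b : R) : 0 <= c -> 0 <= b ->
  (forall d, c < d -> a <= d * b) -> a <= c * b.
Proof.
move=> c0 b0 h; apply/ler_addgt0Pr => e e0.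
have e1 : 0 < e / (b + 1) by rewrite divr_gt0//; lra.
have := h (c + e / (b + 1)); rewrite ltrDl => /(_ e1) /le_trans; apply.
rewrite mulrDl lerD2l mulrAC ler_pdivrMr ?ler_wpM2l; lra.
Qed.

Lemma bounded_form_inf C M : (forall C', C < C' -> bounded_form C' M) -> 0 <= C ->
  bounded_form C M.
Proof.
move=> h C0 S T z w t uS uT t0; apply: le_of_gt0 => //.
  by rewrite addr_ge0// mulr_ge0 ?sqsum_ge0 ?invr_ge0// ltW.
by move=> d Cd; exact: h.
Qed.

(** Test the form on z = conj(M w) with t = 1/D; taking D above C makes this parameter available
    also when C = 0. *)
Lemma bounded_form_mx C M : 0 <= C -> bounded_form C M -> bounded_mx C M.
Proof.
move=> C0 h S T w uS uT; apply: le_of_gt0; [exact: sqr_ge0|exact: sqsum_ge0|] => d Cd.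
have d0 : 0 < d by rewrite (le_lt_trans _ Cd)// sqr_ge0.
set D := Num.sqrt d; have D0 : 0 < D by rewrite sqrtr_gt0.
have D2 : D ^+ 2 = d by rewrite sqr_sqrtr// ltW.
have CD : C <= D by rewrite -ler_sqr ?nnegrE ?D2// ltW.
set v := apply_mx M T w.
have := bounded_form_le CD h (fun x => (v x)^*%C) w uS uT (_ : 0 < D^-1).
rewrite invr_gt0 => /(_ D0).
have -> : bilin M S T (fun x => (v x)^*%C) w = ((sqsum S v)%:C)%C.
  rewrite formE /sqsum rmorph_sum; apply: eq_bigr => x _.
  by rewrite -/(v x) mulrC mulc_conj.
have -> : sqsum S (fun x => (v x)^*%C) = sqsum S v.
  by apply: eq_bigr => x _; rewrite modc_conj.
rewrite modc_real ger0_norm ?sqsum_ge0// invrK mulrDr mulrA mulfV ?gt_eqF// mul1r.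
by rewrite mulrA -expr2 D2; lra.
Qed.

(** Young's inequality with weight C t between the entries of z and of M w; the weight has to be
    positive, so C = 0 is treated apart. *)
Lemma bounded_mx_form C M : 0 <= C -> bounded_mx C M -> bounded_form C M.
Proof.
move=> C0 h; have [C00|Cn0] := eqVneq C 0.
  rewrite C00 in h *.
  move=> S T z w t uS uT t0; rewrite formE big1_seq ?modc0 ?mulr0 ?mul0r// => x /andP[_ xS].
  have := h S T w uS uT; rewrite expr2 !mul0r => h0.
  have : modc (apply_mx M T w x) ^+ 2 <= 0.
    apply: le_trans h0; rewrite /sqsum (big_rem x)//= lerDl.
    by apply: sumr_ge0 => i _; exact: sqr_ge0.
  rewrite le_eqVlt ltNge sqr_ge0 orbF sqrf_eq0 => /eqP/modc_eq0 ->.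
  by rewrite mulr0.
have Cp : 0 < C by rewrite lt0r Cn0.
move=> S T z w t uS uT t0; rewrite formE.
have Ct : 0 < C * t by rewrite mulr_gt0.
have h1 : 2 * modc (\sum_(x <- S) z x * apply_mx M T w x) <=
    \sum_(x <- S) (C * t * modc (z x) ^+ 2 + (C * t)^-1 * modc (apply_mx M T w x) ^+ 2).
  rewrite (le_trans (ler_wpM2l _ (modc_sum _ _ _)))// mulr_sumr; apply: ler_sum => x _.
  rewrite modcM; set a := modc (z x); set b := modc _.
  rewrite -(ler_pM2l Ct) mulrDr (mulrA _ _ (b ^+ 2)) mulfV ?gt_eqF// mul1r.
  by have := sqr_ge0 (C * t * a - b); lra.
apply: le_trans h1 _; rewrite big_split /= -!mulr_sumr mulrDr mulrA lerD2l.
rewrite -/(sqsum S (apply_mx M T w)).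
rewrite (le_trans (ler_wpM2l _ (h S T w uS uT)))//; first by rewrite invr_ge0 ltW.
rewrite invfM; set u := sqsum T w.
have -> : C^-1 / t * (C ^+ 2 * u) = C * (t^-1 * u) by field; rewrite Cn0 gt_eqF.
by [].
Qed.

Lemma formD M N S T z w :
  bilin (fun x y => M x y + N x y) S T z w = bilin M S T z w + bilin N S T z w.
Proof.
rewrite /bilin -big_split; apply: eq_bigr => x _; rewrite -big_split.
by apply: eq_bigr => y _; rewrite mulrDr mulrDl.
Qed.

Lemma formZ c M S T z w :
  bilin (fun x y => c * M x y) S T z w = c * bilin M S T z w.
Proof.
rewrite /bilin mulr_sumr; apply: eq_bigr => x _; rewrite mulr_sumr.
by apply: eq_bigr => y _; ring.
Qed.

Lemma bounded_formD C C' M N : bounded_form C M -> bounded_form C' N ->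
  bounded_form (C + C') (fun x y => M x y + N x y).
Proof.
move=> h h' S T z w t uS uT t0; rewrite formD [leRHS]mulrDl.
apply: le_trans _ (lerD (h S T z w t uS uT t0) (h' S T z w t uS uT t0)).
by rewrite -[leRHS]mulrDr ler_wpM2l// le_modcD.
Qed.

Lemma bounded_formZ c C M : bounded_form C M ->
  bounded_form (modc c * C) (fun x y => c * M x y).
Proof.
move=> h S T z w t uS uT t0; rewrite formZ modcM mulrCA -mulrA.
by rewrite ler_wpM2l ?modc_ge0//; exact: h.
Qed.

Lemma bounded_formB C C' M N : bounded_form C M -> bounded_form C' N ->
  bounded_form (C + C') (fun x y => M x y - N x y).
Proof.
move=> h h'; have := bounded_formD h (bounded_formZ (-1) h').
by rewrite modcN modc1 mul1r; under eq_fun do under eq_fun do rewrite mulN1r.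
Qed.

Lemma bounded_form_entry C M x y : bounded_form C M -> modc (M x y) <= C.
Proof.
move=> h; have := h [:: x] [:: y] (fun=> 1) (fun=> 1) 1 isT isT ltr01.
rewrite /bilin /sqsum !big_seq1 mul1r mulr1 modc1 expr1n invr1 !mul1r; lra.
Qed.

Lemma near_sum (J K : Type) (F : set_system J) (FF : Filter F) (s : seq K)
    (a : K -> J -> R[i]) (p : K -> R[i]) :
  (forall k (e : R), 0 < e -> \forall j \near F, modc (a k j - p k) <= e) ->
  forall e : R, 0 < e ->
    \forall j \near F, modc (\sum_(k <- s) a k j - \sum_(k <- s) p k) <= e.
Proof.
move=> h; elim: s => [|k s ih] e e0.
  by apply: filterE => j; rewrite !big_nil subr0 modc0 ltW.
have e20 : 0 < e / 2 by rewrite divr_gt0.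
apply: filterS2 (h k _ e20) (ih _ e20) => j h1 h2.
by rewrite !big_cons opprD addrACA (le_trans (le_modcD _ _))// [e]splitr lerD.
Qed.

Lemma form_cvg (J : Type) (F : set_system J) (FF : Filter F) (Mj : J -> I -> I -> R[i]) M :
  (forall x y (e : R), 0 < e -> \forall j \near F, modc (Mj j x y - M x y) <= e) ->
  forall S T z w (e : R), 0 < e ->
    \forall j \near F, modc (bilin (Mj j) S T z w - bilin M S T z w) <= e.
Proof.
move=> hM S T z w.
apply: near_sum => x; apply: near_sum => y e e0.
have e1 : 0 < e / (modc (z x) * modc (w y) + 1).
  by rewrite divr_gt0// ltr_wpDl// mulr_ge0 ?modc_ge0.
apply: filterS (hM x y _ e1) => j h.
rewrite -mulrBl -mulrBr !modcM mulrAC.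
have m0 : 0 <= modc (z x) * modc (w y) by rewrite mulr_ge0 ?modc_ge0.
rewrite (le_trans (ler_wpM2l m0 h))// mulrCA ler_piMr ?(ltW e0)//.
by rewrite ler_pdivrMr; lra.
Qed.

(** Each test involves finitely many entries, so entrywise convergence is enough to keep the
    bound. *)
Lemma bounded_form_cvg (J : Type) (F : set_system J) (FF : ProperFilter F)
    (Mj : J -> I -> I -> R[i]) M C :
  (forall x y (e : R), 0 < e -> \forall j \near F, modc (Mj j x y - M x y) <= e) ->
  (\forall j \near F, bounded_form C (Mj j)) -> bounded_form C M.
Proof.
move=> hM hC S T z w t uS uT t0; apply/ler_addgt0Pr => e e0.
have e20 : 0 < e / 2 by rewrite divr_gt0.
have [j [h1 h2]] := filter_ex (filterI (form_cvg _ hM S T z w e20) hC).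
have := h2 S T z w t uS uT t0; have := le_modc_sub (bilin M S T z w) (bilin (Mj j) S T z w).
by rewrite modcB; lra.
Qed.

Lemma form_conj M S T z w :
  bilin (fun x y => (M y x)^*%C) S T z w =
  ((bilin M T S (fun y => (w y)^*%C) (fun x => (z x)^*%C))^*)%C.
Proof.
rewrite /bilin exchange_big /= rmorph_sum; apply: eq_bigr => y _.
rewrite rmorph_sum; apply: eq_bigr => x _.
by apply: complexP; rewrite !cE; ring.
Qed.

Lemma bounded_form_adj C M : bounded_form C M ->
  bounded_form C (fun x y => (M y x)^*%C).
Proof.
move=> h S T z w t uS uT t0; rewrite form_conj modc_conj.
have ti0 : 0 < t^-1 by rewrite invr_gt0.
have := h T S (fun y => (w y)^*%C) (fun x => (z x)^*%C) _ uT uS ti0.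
rewrite invrK addrC.
have sqc U v : sqsum U (fun x => (v x)^*%C) = sqsum U v.
  by apply: eq_bigr => x _; rewrite modc_conj.
by rewrite !sqc.
Qed.

Definition is_mxprod (M A B : I -> I -> R[i]) :=
  forall x y, has_csum (fun k => A x k * B k y) (M x y).

(** A is tested against finite truncations of B w, whose norms are controlled uniformly; summability
    of the product entries removes the truncation. *)
Lemma bounded_form_prod CA CB (A B M : I -> I -> R[i]) : 0 <= CA -> 0 <= CB ->
  bounded_form CA A -> bounded_form CB B -> is_mxprod M A B ->
  bounded_form (CA * CB) M.
Proof.
move=> CA0 CB0 hA hB hM; apply: bounded_form_inf; last exact: mulr_ge0.
move=> D hD.
(* CB is enlarged to a positive C, so that t * C is an admissible parameter; the room comes from D >
   CA * CB. *)
have [C [C0 CBC CAC]] : exists C, [/\ 0 < C, CB <= C & CA * C <= D].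
  have d0 : 0 < (D - CA * CB) / (CA + 1) by rewrite divr_gt0 ?subr_gt0//; lra.
  exists (CB + (D - CA * CB) / (CA + 1)).
  split; [lra|lra|].
  rewrite mulrDr -lerBrDl mulrCA ler_piMr ?subr_ge0 ?ltW//.
  by rewrite ltr_pdivrMr; lra.
have hC := bounded_form_mx (ltW C0) (bounded_form_le CBC hB).
apply: bounded_form_le CAC _ => S T z w t uS uT t0.
have hs : has_csum (fun k => \sum_(x <- S) \sum_(y <- T) (z x * w y) * (A x k * B k y))
    (bilin M S T z w).
  have -> : bilin M S T z w = \sum_(x <- S) \sum_(y <- T) (z x * w y) * M x y.
    by apply: eq_bigr => x _; apply: eq_bigr => y _; ring.
  by apply: has_csum_sum => x; apply: has_csum_sum => y; exact: has_csumZ.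
rewrite -ler_pdivlMl//; apply: (has_csum_le hs) => K; rewrite ler_pdivlMl//.
have -> : \sum_(k <- K) \sum_(x <- S) \sum_(y <- T) z x * w y * (A x k * B k y) =
    bilin A S K z (apply_mx B T w).
  rewrite exchange_big; apply: eq_bigr => x _; apply: eq_bigr => k _.
  by rewrite /apply_mx mulr_sumr; apply: eq_bigr => y _; ring.
have tC : 0 < t * C by rewrite mulr_gt0.
apply: le_trans (hA _ _ _ _ _ uS (fset_uniq K) tC) _; rewrite -[leRHS]mulrA ler_wpM2l//.
rewrite mulrDr mulrA [C * t]mulrC lerD2l invfM -mulrA.
rewrite [C * _]mulrCA ler_pM2l ?invr_gt0//.
by rewrite ler_pdivrMl// mulrA -expr2; exact: hC (fset_uniq K) uT.
Qed.

(** |A w|^2 = <A* A w, w> <= C |w|^2, which is the nontrivial half of the C*-identity. *)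
Lemma bounded_form_sqrt C (A M : I -> I -> R[i]) : 0 <= C ->
  is_mxprod M (fun x y => (A y x)^*%C) A -> bounded_form C M ->
  bounded_form (Num.sqrt C) A.
Proof.
move=> C0 hM hC; apply: bounded_mx_form; first exact: sqrtr_ge0.
move=> S T w uS uT; rewrite sqr_sqrtr//.
have hs : has_csum (fun k => \sum_(x <- T) \sum_(y <- T)
    ((w x)^*%C * w y) * ((A k x)^*%C * A k y)) (bilin M T T (fun x => (w x)^*%C) w).
  have -> : bilin M T T (fun x => (w x)^*%C) w =
    \sum_(x <- T) \sum_(y <- T) ((w x)^*%C * w y) * M x y.
    by apply: eq_bigr => x _; apply: eq_bigr => y _; ring.
  by apply: has_csum_sum => x; apply: has_csum_sum => y; exact: has_csumZ.
have termE k : \sum_(x <- T) \sum_(y <- T) ((w x)^*%C * w y) * ((A k x)^*%C * A k y) =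
    ((modc (apply_mx A T w k) ^+ 2)%:C)%C.
  rewrite -mulc_conj mulrC /apply_mx rmorph_sum mulr_suml; apply: eq_bigr => x _.
  rewrite mulr_sumr; apply: eq_bigr => y _.
  by apply: complexP; rewrite !cE; ring.
have hb : modc (bilin M T T (fun x => (w x)^*%C) w) <= C * sqsum T w.
  have := hC T T (fun x => (w x)^*%C) w 1 uT uT ltr01.
  rewrite invr1 !mul1r (_ : sqsum T (fun x => (w x)^*%C) = sqsum T w); first lra.
  by apply: eq_bigr => x _; rewrite modc_conj.
apply: (has_csum_ge hs hb); exists [fset x in S]%fset => K SK.
under eq_bigr do rewrite termE.
have -> : \sum_(k <- K) ((modc (apply_mx A T w k) ^+ 2)%:C)%C =
    ((\sum_(k <- K) modc (apply_mx A T w k) ^+ 2)%:C)%C :> R[i].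
  by rewrite rmorph_sum.
rewrite modc_real ger0_norm; last first.
  by apply: sumr_ge0 => k _; exact: sqr_ge0.
apply: le_trans (sum_fset_le _ SK); last by move=> k; exact: sqr_ge0.
rewrite le_eqVlt; apply/orP; left; apply/eqP; apply: perm_big.
by apply: uniq_perm => // x; rewrite inE.
Qed.

End bounded_forms.

(** * The crossed product and its Schrodinger matrices *)

Section schrodinger.
Context {R : realType} {G : zmodType}.
Implicit Types (Phi Psi : G -> G -> R[i]).

(** The matrix of [sch_l1 Psi] in the canonical basis of l^2(G); it is genuinely Toeplitz when Psi
    does not depend on its second variable. *)
Definition toep Psi : G -> G -> R[i] := fun xi eta => Psi (xi - eta) eta.

Lemma toep_shift Psi xi zeta : toep Psi (xi + zeta) zeta = Psi xi zeta.
Proof. by rewrite /toep addrK. Qed.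

Lemma sum_uniq_fset (I : choiceType) (s : seq I) (a : I -> R) : uniq s ->
  \sum_(i <- s) a i = \sum_(i <- [fset x in s]%fset) a i.
Proof.
move=> us; apply: perm_big; apply: uniq_perm => //.
by move=> x; rewrite inE.
Qed.

Lemma l1_dominated Psi : Psi \in l1_pred R G -> exists (g : G -> R) (N : R),
  [/\ forall xi, 0 <= g xi, forall xi zeta, modc (Psi xi zeta) <= g xi &
      forall T : seq G, uniq T -> \sum_(xi <- T) g xi <= N].
Proof.
move=> /asboolP hPsi.
have fin xi : supnorm (Psi xi) \is a fin_num.
  rewrite ge0_fin_numE ?supnorm_ge0// (le_lt_trans _ hPsi)//.
  apply: esum_ge; exists [set xi]; last by rewrite fsbig_set1.
  by split=> //; exact: finite_set1.
have gE xi : (fine (supnorm (Psi xi)))%:E = supnorm (Psi xi) by rewrite fineK.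
have l1E : l1norm Psi = (\esum_(xi in setT) (fine (supnorm (Psi xi)))%:E)%E.
  by apply: eq_esum => xi _; rewrite gE.
have l1f : l1norm Psi \is a fin_num.
  by rewrite ge0_fin_numE//; apply: esum_ge0 => xi _; exact: supnorm_ge0.
exists (fun xi => fine (supnorm (Psi xi))), (fine (l1norm Psi)); split.
- by move=> xi; rewrite fine_ge0// supnorm_ge0.
- move=> xi zeta; rewrite -lee_fin gE; apply: ereal_sup_ubound; by exists zeta.
- move=> T uT; rewrite (sum_uniq_fset _ uT) -lee_fin fineK// l1E.
  exact: esum_fset_ge.
Qed.

(** Schur's test: rows and columns are dominated by translates and reflections of one summable
    function g. *)
Lemma toep_bounded Psi : Psi \in l1_pred R G ->
  exists2 C, 0 <= C & bounded_form C (toep Psi).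
Proof.
move=> /l1_dominated [g [N [g0 hg hN]]].
have N0 : 0 <= N by have := hN [::] isT; rewrite big_nil.
exists N => // S T z w t uS uT t0.
have ti0 : 0 < t^-1 by rewrite invr_gt0.
pose P x y := g (x - y) * (t * modc (z x) ^+ 2 + t^-1 * modc (w y) ^+ 2).
have h1 : 2 * modc (bilin (toep Psi) S T z w) <= \sum_(x <- S) \sum_(y <- T) P x y.
  rewrite (le_trans (ler_wpM2l _ (modc_sum _ _ _)))// mulr_sumr; apply: ler_sum => x _.
  rewrite (le_trans (ler_wpM2l _ (modc_sum _ _ _)))// mulr_sumr; apply: ler_sum => y _.
  rewrite /P !modcM; have h := hg (x - y) y; rewrite -/(toep Psi x y) in h.
  have a0 := modc_ge0 (z x); have b0 := modc_ge0 (w y).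
  set a := modc (z x) in a0 *; set b := modc (w y) in b0 *.
  have ab : 2 * (a * b) <= t * a ^+ 2 + t^-1 * b ^+ 2.
    rewrite -(ler_pM2l t0) mulrDr (mulrA t t^-1) mulfV ?gt_eqF// mul1r.
    by have := sqr_ge0 (t * a - b); lra.
  have := ler_pM (modc_ge0 _) (mulr_ge0 (ler0n _ 2) (mulr_ge0 a0 b0)) h ab.
  by apply: le_trans; rewrite le_eqVlt; apply/orP; left; apply/eqP; ring.
apply: le_trans h1 _.
have split_sum : \sum_(x <- S) \sum_(y <- T) P x y =
    t * (\sum_(x <- S) modc (z x) ^+ 2 * \sum_(y <- T) g (x - y)) +
    t^-1 * (\sum_(y <- T) modc (w y) ^+ 2 * \sum_(x <- S) g (x - y)).
  rewrite mulr_sumr mulr_sumr.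
  have -> : \sum_(y <- T) t^-1 * (modc (w y) ^+ 2 * \sum_(x <- S) g (x - y)) =
    \sum_(x <- S) \sum_(y <- T) t^-1 * (modc (w y) ^+ 2 * g (x - y)).
    by rewrite exchange_big; apply: eq_bigr => y _; rewrite mulr_sumr mulr_sumr.
  rewrite -big_split; apply: eq_bigr => x _ /=.
  rewrite mulr_sumr mulr_sumr -big_split; apply: eq_bigr => y _ /=.
  by rewrite /P; ring.
rewrite split_sum mulrDr ![N * (_ * _)]mulrCA; apply: lerD; rewrite ler_pM2l//.
  rewrite /sqsum mulr_sumr; apply: ler_sum => x _.
  rewrite [leRHS]mulrC ler_wpM2l ?sqr_ge0//.
  rewrite -(big_map (fun y => x - y) xpredT g); apply: hN.
  by rewrite map_inj_uniq// => y y' /addrI /oppr_inj.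
rewrite /sqsum mulr_sumr; apply: ler_sum => y _.
rewrite [leRHS]mulrC ler_wpM2l ?sqr_ge0//.
rewrite -(big_map (fun x => x - y) xpredT g); apply: hN.
by rewrite map_inj_uniq// => x x' /addIr.
Qed.

(* The norm of the operator sch Psi on l^2(G). *)
Definition sch_norm Psi : R := inf [set C | 0 <= C /\ bounded_form C (toep Psi)].

Lemma sch_norm_le Psi C : 0 <= C -> bounded_form C (toep Psi) -> sch_norm Psi <= C.
Proof.
move=> C0 hC; apply: ge_inf; last by split.
by exists 0 => D [].
Qed.

Lemma sch_normP Psi C : 0 <= C -> bounded_form C (toep Psi) ->
  0 <= sch_norm Psi /\ bounded_form (sch_norm Psi) (toep Psi).
Proof.
move=> C0 hC.
have ne : [set C | 0 <= C /\ bounded_form C (toep Psi)] !=set0 by exists C.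
have n0 : 0 <= sch_norm Psi by apply: lb_le_inf => // D [].
split=> //; apply: bounded_form_inf => // D hD.
have hi : has_inf [set C | 0 <= C /\ bounded_form C (toep Psi)].
  by split=> //; exists 0 => E [].
have e0 : 0 < D - sch_norm Psi by rewrite subr_gt0.
have [E [E0 hE] hED] := inf_adherent e0 hi.
by apply: bounded_form_le hE; rewrite ltW// (lt_le_trans hED)// addrC subrK.
Qed.

Lemma sch_norm_l1 Psi : Psi \in l1_pred R G ->
  0 <= sch_norm Psi /\ bounded_form (sch_norm Psi) (toep Psi).
Proof. by move=> /toep_bounded [C C0 hC]; exact: sch_normP hC. Qed.

Lemma toep_mul Phi Psi (B : R) : (forall xi zeta, modc (Phi xi zeta) <= B) ->
  Psi \in l1_pred R G -> is_mxprod (toep (l1_mul Phi Psi)) (toep Phi) (toep Psi).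
Proof.
move=> hB /l1_dominated [g [N [g0 hg hN]]] xi eta.
have B0 : 0 <= B by apply: le_trans (hB 0 0); exact: modc_ge0.
have bij : bijective (fun k : G => k + eta).
  by exists (fun k => k - eta) => k; rewrite ?addrK ?subrK.
apply: (has_csum_bij bij).
have -> : (fun k => toep Phi xi k * toep Psi k eta) \o (fun k => k + eta) =
    (fun k => Phi (xi - eta - k) (eta + k) * Psi k eta).
  by apply/funext => k /=; rewrite /toep addrK opprD addrAC addrA [k + eta]addrC.
apply: (@has_csum_csum _ _ _ (B * N)) => T.
apply: (@le_trans _ _ (\sum_(k <- T) B * g k)).
  by apply: ler_sum => k _; rewrite modcM ler_pM ?modc_ge0.
by rewrite -mulr_sumr ler_wpM2l// hN// fset_uniq.
Qed.

Lemma toep_star Psi xi eta : toep (l1_star Psi) xi eta = ((toep Psi eta xi)^*)%C.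
Proof. by rewrite /toep /l1_star opprB [eta + (xi - eta)]addrC subrK. Qed.

Lemma l1_entry Psi : Psi \in l1_pred R G ->
  exists B, forall xi zeta, modc (Psi xi zeta) <= B.
Proof.
move=> /l1_dominated [g [N [g0 hg hN]]]; exists N => xi zeta.
by rewrite (le_trans (hg _ _))//; have := hN [:: xi] isT; rewrite big_seq1.
Qed.

(** [toep] turns [l1_mul] into the matrix product and [l1_star] into the adjoint, so the axioms are
    those of the operator norm. Being one of the competitors in the supremum [env_norm], this
    seminorm is dominated by it. *)
Lemma sch_norm_cstar : cstar_seminorm sch_norm.
Proof.
split.
- by move=> Psi /sch_norm_l1 [].
- move=> Phi Psi /sch_norm_l1 [p0 p1] /sch_norm_l1 [q0 q1].
  by apply: sch_norm_le; [exact: addr_ge0|exact: bounded_formD].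
- have le z Psi : Psi \in l1_pred R G ->
      sch_norm (fun xi zeta => z * Psi xi zeta) <= modc z * sch_norm Psi.
    move=> /sch_norm_l1 [p0 p1]; apply: sch_norm_le.
      by rewrite mulr_ge0 ?modc_ge0.
    exact: bounded_formZ.
  move=> z Psi hPsi; apply/eqP; rewrite eq_le le//=.
  have [p0 p1] := sch_norm_l1 hPsi.
  have zp := bounded_formZ z p1.
  have [n0 n1] := @sch_normP (fun xi zeta => z * Psi xi zeta) _
    (mulr_ge0 (modc_ge0 z) p0) zp.
  have [z0|z0] := eqVneq z 0; first by apply: le_trans n0; rewrite z0 modc0 mul0r.
  have mz : 0 < modc z by rewrite lt0r modc_ge0 andbT; apply: contra_neq z0 => /modc_eq0.
  rewrite -ler_pdivlMl//; apply: sch_norm_le.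
    by rewrite mulr_ge0// invr_ge0 modc_ge0.
  have := bounded_formZ z^-1 n1; rewrite ComplexField.Normc.normcV.
  rewrite (_ : (fun x y : G => z^-1 * _) = toep Psi)//.
  by apply/funext => x; apply/funext => y; rewrite /toep mulKf.
- move=> Phi Psi hPhi hPsi; have [B hB] := l1_entry hPhi.
  have [p0 p1] := sch_norm_l1 hPhi; have [q0 q1] := sch_norm_l1 hPsi.
  apply: sch_norm_le; first exact: mulr_ge0.
  exact: bounded_form_prod p0 q0 p1 q1 (toep_mul hB hPsi).
- move=> Psi hPsi; have [B hB] := l1_entry hPsi.
  have [p0 p1] := sch_norm_l1 hPsi.
  have hBs xi zeta : modc (l1_star Psi xi zeta) <= B by rewrite modc_conj.
  have hm := toep_mul hBs hPsi.
  have adj : bounded_form (sch_norm Psi) (toep (l1_star Psi)).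
    have := bounded_form_adj p1.
    by under eq_fun do under eq_fun do rewrite -toep_star.
  have hprod := bounded_form_prod p0 p0 adj p1 hm.
  apply/eqP; rewrite eq_le; apply/andP; split.
    by rewrite expr2; apply: sch_norm_le => //; exact: mulr_ge0.
  have [n0 n1] := sch_normP (mulr_ge0 p0 p0) hprod.
  have hm' : is_mxprod (toep (l1_mul (l1_star Psi) Psi))
      (fun x y => (toep Psi y x)^*%C) (toep Psi).
    by move=> x y; under eq_fun do rewrite -toep_star; exact: hm.
  have := sch_norm_le (sqrtr_ge0 _) (bounded_form_sqrt n0 hm' n1).
  by rewrite -(@ler_pXn2r _ 2)// ?nnegrE ?sqrtr_ge0// sqr_sqrtr.
Qed.

Lemma env_bounded Psi (e : R) : Psi \in l1_pred R G -> (env_norm Psi <= e%:E)%E ->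
  bounded_form e (toep Psi).
Proof.
move=> hPsi he; have [p0 p1] := sch_norm_l1 hPsi; apply: bounded_form_le p1.
rewrite -lee_fin (le_trans _ he)//; apply: ereal_sup_ubound.
by exists sch_norm => //; exact: sch_norm_cstar.
Qed.

End schrodinger.

Lemma ccauchy_cvg (R : realType) (s : nat -> R[i]) :
  (forall e : R, 0 < e -> exists N : nat, forall m n : nat,
     (N <= m)%N -> (N <= n)%N -> modc (s m - s n) <= e) -> cvgn s.
Proof.
move=> hs; have [F [FU subF]] := ultraFilterLemma (_ : ProperFilter \oo).
have FP : ProperFilter F := @ultra_proper _ _ FU.
have [N hN] := hs 1 ltr01.
(* Raising the index to at least N makes the sequence bounded by the Cauchy estimate with tolerance
   1. *)
have [|z hz] := @ultra_lim R nat F FU (fun n => s (maxn n N)) (modc (s N) + 1).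
  move=> n; rewrite (le_trans (le_modc_sub _ (s N)))// lerD2l.
  by apply: hN => //; rewrite leq_maxr.
apply/cvg_ex; exists z; apply/cvgcP => e e0.
have e20 : 0 < e / 2 by rewrite divr_gt0.
have [M hM] := hs _ e20.
have hF : \forall n \near F, (M <= n)%N by apply: subF; exists M.
have [n [h1 h2]] := filter_ex (filterI (hz _ e20) hF).
exists M => // m /= Mm; rewrite (le_trans (le_modcBD (s (maxn n N)) _ _))//.
rewrite [e]splitr lerD//; first by rewrite modcB.
by apply: hM => //; rewrite leq_max h2.
Qed.

Lemma climP (R : realType) (s : nat -> R[i]) : cvgn s ->
  forall e : R, 0 < e -> \forall n \near \oo, modc (s n - limn s) <= e.
Proof.
move=> /cvgcP hs e e0; apply: filterS (hs e e0) => n.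
by rewrite modcB.
Qed.

Lemma clim_eq (R : realType) (s : nat -> R[i]) z :
  (forall e : R, 0 < e -> \forall n \near \oo, modc (s n - z) <= e) -> limn s = z.
Proof.
move=> h; apply: cvg_lim => //; apply/cvgcP => e e0; apply: filterS (h e e0) => n.
by rewrite modcB.
Qed.

(** A basic neighbourhood is given by finitely many members of p, and a principal ultrafilter lies
    in it exactly when its point lies in all of them. *)
Lemma beta_nbhs (I : Type) (p : beta I) (V : set (beta I)) : nbhs p V ->
  beta_sets p (beta_pt @^-1` V).
Proof.
have pF : Filter (beta_sets p) by exact: (@ultra_proper _ _ (beta_ultra p)).
rewrite nbhsE => -[U [[D sD <-] [W DW Wp]] UV].
have [E _ EW] := sD W DW.
apply: (@filterS _ _ pF (beta_pt @^-1` W)).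
  by move=> i Wi; apply: UV; exists W.
rewrite -EW in Wp *.
have : \forall i \near beta_sets p, forall A, A \in E -> A i.
  apply: (@filterS _ _ pF (\bigcap_(A in [set` E]) A)) => [i h A AE|]; first exact: h.
  apply: filter_bigI => A AE; exact: Wp AE.
by apply: (@filterS _ _ pF) => i h A AE; apply/principal_filterP; exact: (h A AE).
Qed.

Lemma beta_open (I : Type) (A : set I) : open [set p : beta I | beta_sets p A].
Proof.
exists [set [set p : beta I | beta_sets p A]]; last by rewrite bigcup_set1.
move=> _ ->; exists [fset A]%fset; first by move=> B _; exact: mem_set.
by rewrite set_fset1 bigcap_set1.
Qed.

Lemma ideal_vanish (R : realType) (G : zmodType) (Omega : set (beta G)) p
    (psi : G -> R[i]) (e : R) : linfty_ideal Omega psi -> Omega p -> 0 < e ->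
  \forall zeta \near beta_sets p, modc (psi zeta) <= e.
Proof.
move=> [_ [tpsi [ct ext] t0]] Op e0.
have pF : Filter (beta_sets p) by exact: (@ultra_proper _ _ (beta_ultra p)).
have /cvgcP/(_ e e0)/beta_nbhs := ct p.
apply: (@filterS _ _ pF) => zeta /=.
by rewrite t0// ext sub0r modcN.
Qed.

(** * Coefficients and matrices of elements of the crossed product *)

Section crossed_coefficients.
Context {R : realType} {G : zmodType}.
Implicit Types (u : cauchy_seq R G) (a : crossed R G).

Definition close (e : R) (M N : G -> G -> R[i]) :=
  bounded_form e (fun xi eta => toep M xi eta - toep N xi eta).

Lemma close_entry (e : R) (M N : G -> G -> R[i]) xi zeta : close e M N ->
  modc (M xi zeta - N xi zeta) <= e.
Proof.
move=> h; have := bounded_form_entry (xi + zeta) zeta h.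
by rewrite !toep_shift.
Qed.

Lemma closeC (e : R) (M N : G -> G -> R[i]) : close e M N -> close e N M.
Proof.
move=> h; have := bounded_formZ (-1) h; rewrite modcN modc1 mul1r.
by rewrite /close; under eq_fun do under eq_fun do rewrite mulN1r opprB.
Qed.

Lemma close_trans (e e' : R) (L M N : G -> G -> R[i]) :
  close e L M -> close e' M N -> close (e + e') L N.
Proof.
move=> h h'; have := bounded_formD h h'.
by rewrite /close; under eq_fun do under eq_fun do rewrite addrA subrK.
Qed.

Lemma cauchy_close u (e : R) : 0 < e -> exists N : nat, forall m n : nat,
  (N <= m)%N -> (N <= n)%N -> close e (u m) (u n).
Proof.
move=> e0; have /asboolP/(_ e e0)[N hN] := valP u; exists N => m n Nm Nn.
exact: env_bounded (valP (cauchy_val u m - cauchy_val u n)) (hN m n Nm Nn).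
Qed.

Lemma null_close u (e : R) : u \in @env_null R G -> 0 < e ->
  \forall n \near \oo, bounded_form e (toep (u n)).
Proof.
move=> /asboolP hu e0; have [N hN] := hu e e0; exists N => // n /= Nn.
exact: env_bounded (valP (cauchy_val u n)) (hN n Nn).
Qed.

Lemma coef_cvg a xi zeta (e : R) : 0 < e ->
  \forall n \near \oo, modc ((repr a : cauchy_seq R G) n xi zeta - crossed_coef a xi zeta) <= e.
Proof.
apply: climP; apply: ccauchy_cvg => d d0.
have [N hN] := cauchy_close (repr a) d0; exists N => m n Nm Nn.
exact: close_entry (hN m n Nm Nn).
Qed.

(** In the Cauchy estimate n is fixed and m tends to infinity. So the coefficients, defined as
    entrywise limits, give a limit in operator norm. *)
Lemma repr_close a (e : R) : 0 < e ->
  \forall n \near \oo, close e ((repr a : cauchy_seq R G) n) (crossed_coef a).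
Proof.
move=> e0; have [N hN] := cauchy_close (repr a) e0; exists N => // n /= Nn.
apply: (@bounded_form_cvg _ _ nat \oo _
  (fun m xi eta => toep ((repr a : cauchy_seq R G) n) xi eta -
                   toep ((repr a : cauchy_seq R G) m) xi eta)).
  move=> xi eta d d0; apply: filterS (coef_cvg a (xi - eta) eta d0) => m.
  have e3 (x y z : R[i]) : (x - y) - (x - z) = z - y by ring.
  by rewrite e3 modcB.
by exists N => // m /= Nm; exact: hN.
Qed.

(** Any representative computes the coefficients, not only the chosen one. This is required for the
    ideal, whose elements are described by some sequence u with values in it. *)
Lemma pi_close u (e : R) : 0 < e ->
  \forall n \near \oo, close e (u n) (crossed_coef (\pi_(Quotient.quot (@env_null R G)) u)%qT).
Proof.
move=> e0; have e20 : 0 < e / 2 by rewrite divr_gt0.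
set a := (\pi_(Quotient.quot (@env_null R G)) u)%qT.
have hnull : u - repr a \in @env_null R G.
  by rewrite Quotient.idealrBE; apply/eqP; rewrite reprK.
apply: filterS2 (null_close hnull e20) (repr_close a e20) => n h1 h2.
by rewrite [e]splitr; exact: close_trans h1 h2.
Qed.

Lemma crossed_bounded a : exists2 C, 0 <= C & bounded_form C (toep (crossed_coef a)).
Proof.
have [n hn] := filter_ex (repr_close a ltr01).
have [C C0 hC] := toep_bounded (valP ((repr a : cauchy_seq R G) n)).
exists (C + 1); first by lra.
have := bounded_formB hC hn.
by under eq_fun do under eq_fun do rewrite opprB addrC subrK.
Qed.

(** The entries of the approximating sequence vanish at p by continuity of their extensions, and
    matrix-norm closeness is uniform over entries. *)
Lemma ideal_coef Omega a p xi (e : R) : crossed_ideal Omega a -> Omega p -> 0 < e ->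
  \forall zeta \near beta_sets p, modc (crossed_coef a xi zeta) <= e.
Proof.
move=> [u hu ->] Op e0; have e20 : 0 < e / 2 by rewrite divr_gt0.
have pF : Filter (beta_sets p) by exact: (@ultra_proper _ _ (beta_ultra p)).
have [n hn] := filter_ex (pi_close u e20).
apply: (@filterS _ _ pF) (ideal_vanish (hu n xi) Op e20) => zeta h.
have := close_entry xi zeta (closeC hn); set c := crossed_coef _ xi zeta.
by have := le_modc_sub c (u n xi zeta); lra.
Qed.

Lemma crossed_coefN a xi zeta : crossed_coef (- a) xi zeta = - crossed_coef a xi zeta.
Proof.
have hN : (- a = \pi_(Quotient.quot (@env_null R G)) (- repr a))%qT.
  by rewrite raddfN /= reprK.
apply/eqP; rewrite -addr_eq0; apply/eqP/modc_eq0.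
apply: (@small_eq0 _ _ 2) => //; first exact: modc_ge0.
move=> e e0 _; have := pi_close (- repr a) e0; rewrite -hN => h1.
have [n [k1 k2]] := filter_ex (filterI h1 (repr_close a e0)).
have := close_entry xi zeta (closeC k1); have := close_entry xi zeta (closeC k2).
set c := crossed_coef (- a) xi zeta; set c' := crossed_coef a xi zeta.
have -> : (- repr a : cauchy_seq R G) n xi zeta = - (repr a : cauchy_seq R G) n xi zeta by [].
set r := (_ : cauchy_seq R G) n xi zeta => h2 h3.
have -> : c + c' = (c - - r) + (c' - r) by rewrite opprK addrACA subrr addr0.
by rewrite (le_trans (le_modcD _ _))//; lra.
Qed.

Lemma crossed_idealN Omega a : crossed_ideal Omega a -> crossed_ideal Omega (- a).
Proof.
move=> [u hu ->]; exists (- u); last by rewrite raddfN.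
move=> n xi; have [fin [tpsi [ct ext] t0]] := hu n xi; split.
  move: fin; rewrite /linfty /= /supnorm.
  have -> // : (fun zeta => (modc (u n xi zeta))%:E) =
    (fun zeta => (modc ((- u : cauchy_seq R G) n xi zeta))%:E).
  by apply/funext => zeta; rewrite [(- u : cauchy_seq R G) _ _ _]/(- u n xi zeta) modcN.
exists (fun p => - tpsi p) => [|p Op]; last by rewrite t0// oppr0.
split=> [p|zeta]; last by rewrite ext.
have /cvgcP h := ct p.
apply: (proj2 (@cvgcP R _ (nbhs (p : beta G)) (nbhs_filter _) _ _)) => e e0.
apply: filterS (h e e0) => q.
by rewrite -opprD modcN.
Qed.

Definition l2_bound (w : G -> R[i]) (B : R) :=
  forall T : seq G, uniq T -> sqsum T w <= B.

(** A row is a column of the adjoint up to conjugation, hence square-summable, so the row sum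
    against w converges absolutely. *)
Lemma row_csum (M : G -> G -> R[i]) C w B xi : 0 <= C -> bounded_form C M ->
  l2_bound w B ->
  has_csum (fun eta => M xi eta * w eta) (csum (fun eta => M xi eta * w eta)) /\
  modc (csum (fun eta => M xi eta * w eta)) ^+ 2 <= C ^+ 2 * B.
Proof.
move=> C0 hM hw.
have row T : uniq T -> sqsum T (M xi) <= C ^+ 2.
  move=> uT; have := bounded_form_mx C0 (bounded_form_adj hM) (fun=> 1) uT
    (isT : uniq [:: xi]).
  rewrite /sqsum big_seq1 modc1 expr1n mulr1; apply: le_trans.
  rewrite le_eqVlt; apply/orP; left; apply/eqP; apply: eq_bigr => eta _.
  by rewrite /apply_mx big_seq1 mulr1 modc_conj.
have hs : has_csum (fun eta => M xi eta * w eta) (csum (fun eta => M xi eta * w eta)).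
  apply: (@has_csum_csum _ _ _ (C ^+ 2 + B)) => T.
  apply: le_trans (lerD (row _ (fset_uniq T)) (hw _ (fset_uniq T))).
  rewrite /sqsum -big_split; apply: ler_sum => eta _ /=; rewrite modcM.
  have := sqr_ge0 (modc (M xi eta) - modc (w eta)).
  have := mulr_ge0 (modc_ge0 (M xi eta)) (modc_ge0 (w eta)); lra.
split=> //.
have B0 : 0 <= B by have := hw [::] isT; rewrite /sqsum big_nil.
rewrite -(@sqr_sqrtr _ (C ^+ 2 * B)); last by rewrite mulr_ge0 ?sqr_ge0.
rewrite ler_sqr ?nnegrE ?modc_ge0 ?sqrtr_ge0//.
apply: (has_csum_le hs) => T.
rewrite -ler_sqr ?nnegrE ?modc_ge0 ?sqrtr_ge0// sqr_sqrtr; last first.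
  by rewrite mulr_ge0 ?sqr_ge0.
have := bounded_form_mx C0 hM w (isT : uniq [:: xi]) (fset_uniq T).
rewrite {1}/sqsum big_seq1 => /le_trans; apply.
by rewrite ler_wpM2l ?sqr_ge0// hw// fset_uniq.
Qed.

(** [sch a] is a limit along the chosen representative. By [repr_close] and [row_csum] the row sums
    of the differences tend to 0, so it acts as the matrix of coefficients. *)
Lemma sch_coef a w B xi : l2_bound w B ->
  has_csum (fun eta => toep (crossed_coef a) xi eta * w eta) (sch a w xi).
Proof.
move=> hw; have [C C0 hC] := crossed_bounded a.
have [hs _] := row_csum xi C0 hC hw.
suff -> : sch a w xi = csum (fun eta => toep (crossed_coef a) xi eta * w eta) by [].
have B0 : 0 <= B by have := hw [::] isT; rewrite /sqsum big_nil.
apply: clim_eq => e e0.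
have e1 : 0 < e / (Num.sqrt B + 1) by rewrite divr_gt0// ltr_wpDl// sqrtr_ge0.
apply: filterS (repr_close a e1) => n hn.
have [D D0 hD] := toep_bounded (valP ((repr a : cauchy_seq R G) n)).
have [hsn _] := row_csum xi D0 hD hw.
have [hsd hd] := row_csum xi (ltW e1) hn hw.
have hdiff := has_csumD hsn (has_csumZ (-1) hs).
have Ed : csum (fun eta => (toep ((repr a : cauchy_seq R G) n) xi eta -
     toep (crossed_coef a) xi eta) * w eta) =
   sch_l1 ((repr a : cauchy_seq R G) n) w xi -
     csum (fun eta => toep (crossed_coef a) xi eta * w eta).
  apply: has_csum_eq hsd _; move: hdiff; rewrite mulN1r.
  by under eq_fun do rewrite mulN1r -mulrBl.
rewrite -Ed -ler_sqr ?nnegrE ?modc_ge0 ?(ltW e0)// (le_trans hd)//.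
have sB := sqrtr_ge0 B.
rewrite -[X in _ * X](sqr_sqrtr B0) -exprMn ler_sqr ?nnegrE ?(ltW e0)//; last first.
  by rewrite mulr_ge0 ?(ltW e1).
by rewrite mulrAC ler_pdivrMr ?ler_pM2l//; lra.
Qed.

End crossed_coefficients.

(** * Quantization *)

Section hilbert_space.
Variables (R : realType) (X : topologicalZmodType) (mu : probability (borel X) R).
Hypothesis compX : compact [set: X].
Hypothesis hausX : hausdorff_space X.
Hypothesis haar_mu : is_haar mu.
Local Notation Xi := (dual X R).
Implicit Types (f g h : X -> R[i]) (xi eta : Xi) (s : seq Xi) (w : Xi -> R[i]).

Lemma L2_predP f : f \in L2_pred mu <-> sqint_fun mu f.
Proof.
have E : (\int[mu]_x (modc (f x) ^+ 2)%:E = \int[mu]_x `|(modc (f x) ^+ 2)%:E|)%E.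
  by apply: eq_integral => x _; rewrite gee0_abs// lee_fin sqr_ge0.
split.
  move=> /asboolP[mr mi fin]; split=> //; apply/integrableP; split.
    exact/measurable_EFinP/measurable_modc_sqr.
  by rewrite -[X in (X < _)%E]E.
move=> [[mr mi] /integrableP[_ fin]]; apply/asboolP; split=> //.
by rewrite /sqint E.
Qed.

Lemma ae_subset (P Q : X -> Prop) : (forall x, P x -> Q x) ->
  {ae mu, forall x, P x} -> {ae mu, forall x, Q x}.
Proof. exact: (@filterS _ _ (ae_filter_ringOfSetsType mu)). Qed.

Lemma cintegral_ae f g : cmeasurable (f : borel X -> R[i]) ->
  cmeasurable (g : borel X -> R[i]) ->
  {ae mu, forall x, f x = g x} -> cintegral mu f = cintegral mu g.
Proof.
move=> [fr fi] [gr gi] fg; congr (_ +i* _)%C; congr fine; apply: ae_eq_integral => //.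
- exact/measurable_EFinP.
- exact/measurable_EFinP.
- by apply: ae_subset fg => x /= ->.
- exact/measurable_EFinP.
- exact/measurable_EFinP.
- by apply: ae_subset fg => x /= ->.
Qed.

Lemma sqn_ae f g : sqint_fun mu f -> sqint_fun mu g ->
  {ae mu, forall x, f x = g x} -> sqn mu f = sqn mu g.
Proof.
move=> [_ fi] [_ gi] fg; congr fine; apply: ae_eq_integral => //.
- exact/measurable_EFinP/rint_measurable/fi.
- exact/measurable_EFinP/rint_measurable/gi.
- by apply: ae_subset fg => x /= ->.
Qed.

Lemma character_cont xi : ccont xi.
Proof. by have [] := dualP xi. Qed.
Arguments character_cont xi : clear implicits.

Lemma character_modc xi x : modc (xi x) = 1.
Proof. by have [_ + _] := dualP xi; apply. Qed.

Lemma character_sub xi eta x : (xi - eta) x = xi x * (eta x)^*%C.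
Proof.
rewrite [LHS]/(xi x * (eta x)^-1); congr (_ * _).
apply: (mulfI (character_neq0 eta x)).
by rewrite mulfV ?character_neq0// mulc_conj character_modc expr1n.
Qed.

Lemma cmeasurable_character xi : cmeasurable (xi : borel X -> R[i]).
Proof. exact: ccont_measurable (character_cont xi). Qed.

Lemma sqint_character xi f : sqint_fun mu f -> sqint_fun mu (fun x => xi x * f x).
Proof.
apply: (@sqint_Mbounded _ _ _ _ _ _ 1); first exact: cmeasurable_character.
by move=> x; rewrite character_modc.
Qed.

Lemma fourier_cint f xi : sqint_fun mu f -> cint mu (fun x => (xi x)^*%C * f x).
Proof.
move=> /sqint_cint; apply: (@cint_Mbounded _ _ _ _ _ _ 1).
  exact: cmeasurable_conj (cmeasurable_character xi).
by move=> x; rewrite modc_conj character_modc.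
Qed.

Lemma fourier_ae f g xi : sqint_fun mu f -> sqint_fun mu g ->
  {ae mu, forall x, f x = g x} -> fourier mu f xi = fourier mu g xi.
Proof.
move=> hf hg fg; apply: cintegral_ae.
- exact: cint_measurable (fourier_cint xi hf).
- exact: cint_measurable (fourier_cint xi hg).
- by apply: ae_subset fg => x /= ->.
Qed.

Lemma fourier_modulation f xi eta :
  fourier mu (fun x => eta x * f x) xi = fourier mu f (xi - eta).
Proof.
congr cintegral; apply/funext => x; rewrite character_sub.
by rewrite mulrA; congr (_ * _); rewrite rmorphM /= conjcK.
Qed.

Lemma fourier_sum s (F : Xi -> X -> R[i]) xi : (forall eta, sqint_fun mu (F eta)) ->
  fourier mu (fun x => \sum_(eta <- s) F eta x) xi = \sum_(eta <- s) fourier mu (F eta) xi.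
Proof.
move=> hF; rewrite /fourier -cintegral_sum; last by move=> eta; exact: fourier_cint.
by congr cintegral; apply/funext => x; rewrite mulr_sumr.
Qed.

Lemma fourierZ f z xi : sqint_fun mu f ->
  fourier mu (fun x => z * f x) xi = z * fourier mu f xi.
Proof.
move=> hf; rewrite /fourier -cintegralZ; last exact: fourier_cint.
by congr cintegral; apply/funext => x; rewrite mulrCA.
Qed.

Lemma fourierN f xi : sqint_fun mu f ->
  fourier mu (fun x => - f x) xi = - fourier mu f xi.
Proof.
move=> hf; rewrite /fourier -cintegralN; last exact: fourier_cint.
by congr cintegral; apply/funext => x; rewrite mulrN.
Qed.

Lemma fourierB f g xi : sqint_fun mu f -> sqint_fun mu g ->
  fourier mu (fun x => f x - g x) xi = fourier mu f xi - fourier mu g xi.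
Proof.
move=> hf hg; rewrite /fourier -cintegralB; [|exact: fourier_cint..].
by congr cintegral; apply/funext => x; rewrite mulrBr.
Qed.

Lemma fourier_sup_le f g xi (e : R) : sqint_fun mu f -> sqint_fun mu g ->
  (forall x, modc (f x - g x) <= e) -> modc (fourier mu f xi - fourier mu g xi) <= e.
Proof.
move=> hf hg h; rewrite -fourierB//; apply: modc_cintegral_bound.
  exact: cint_measurable (fourier_cint xi (sqintB hf hg)).
by move=> x; rewrite modcM modc_conj character_modc mul1r.
Qed.

Lemma cintegral_character xi : cintegral mu xi = (xi == 0)%:R.
Proof.
have [->|xi0] := eqVneq xi 0; first exact: cintegral_cst.
have [x hx] : exists x, xi x != 1.
  apply: contrapT => hn; move/eqP: xi0; apply; apply/val_inj/funext => x.
  by apply/eqP/negPn/negP => h; apply: hn; exists x.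
have ci : cint mu xi := ccont_cint mu compX (character_cont xi).
have := cintegral_shift haar_mu x ci.
have -> : (fun t : X => xi (t + x)) = (fun t => xi x * xi t).
  by apply/funext => t; have [_ _ ->] := dualP xi; rewrite mulrC.
rewrite cintegralZ// => /eqP; rewrite -subr_eq0 -[X in _ - X]mul1r -mulrBl mulf_eq0.
by rewrite subr_eq0 (negPf hx) /= => /eqP.
Qed.

Lemma fourier_character eta xi : fourier mu eta xi = (eta == xi)%:R.
Proof.
have -> : fourier mu eta xi = cintegral mu (eta - xi).
  by congr cintegral; apply/funext => x; rewrite character_sub mulrC.
by rewrite cintegral_character subr_eq0.
Qed.

Lemma fourier_ip f s w : sqint_fun mu f ->
  ip mu f (fun x => \sum_(xi <- s) w xi * xi x) =
  \sum_(xi <- s) (w xi)^*%C * fourier mu f xi.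
Proof.
move=> hf; rewrite /ip; under eq_fun do rewrite rmorph_sum mulr_sumr.
rewrite cintegral_sum.
  apply: eq_bigr => xi _; rewrite /fourier -cintegralZ; last exact: fourier_cint.
  congr cintegral; apply/funext => x; rewrite rmorphM /= mulrCA.
  by congr (_ * _); rewrite mulrC.
move=> xi; rewrite (_ : (fun _ => _) = fun x : borel X => (w xi)^*%C * ((xi x)^*%C * f x)).
  exact/cintZ/fourier_cint.
by apply/funext => x; rewrite rmorphM /= mulrCA; congr (_ * _); rewrite mulrC.
Qed.

Lemma sqint_trig_term eta w : sqint_fun mu (fun x => w eta * eta x).
Proof. by apply: sqintZ; exact: ccont_sqint (character_cont eta). Qed.

Lemma sqint_trig s w : sqint_fun mu (fun x => \sum_(xi <- s) w xi * xi x).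
Proof. by apply: sqint_sum => xi; exact: sqint_trig_term. Qed.

Lemma fourier_trig s w xi : uniq s ->
  fourier mu (fun x => \sum_(eta <- s) w eta * eta x) xi = if xi \in s then w xi else 0.
Proof.
move=> us; rewrite fourier_sum; last by move=> eta; exact: sqint_trig_term.
under eq_bigr => eta _.
  rewrite fourierZ ?fourier_character; last exact: ccont_sqint (character_cont eta).
  over.
have [xs|xs] := boolP (xi \in s).
  rewrite (bigD1_seq xi)//= eqxx mulr1 big1 ?addr0// => eta /negPf ->.
  by rewrite mulr0.
rewrite big_seq big1// => eta es; case: eqVneq => [E|]; last by rewrite mulr0.
by rewrite -E es in xs.
Qed.

Lemma re_sum_conj s (z w : Xi -> R[i]) : (forall xi, xi \in s -> z xi = w xi) ->
  \sum_(xi <- s) (w xi)^*%C * z xi = ((sqsum s w)%:C)%C.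
Proof.
move=> zw; rewrite /sqsum rmorph_sum big_seq [RHS]big_seq; apply: eq_bigr => xi xs.
by rewrite zw// mulrC mulc_conj.
Qed.

Lemma sqn_trig s w : uniq s ->
  sqn mu (fun x => \sum_(xi <- s) w xi * xi x) = sqsum s w.
Proof.
move=> us; apply: complexI; rewrite -ip_self; last exact: sqint_trig.
rewrite fourier_ip; last exact: sqint_trig.
by rewrite (@re_sum_conj _ _ w)// => xi xs; rewrite fourier_trig// xs.
Qed.

Lemma bessel f s : sqint_fun mu f -> uniq s -> sqsum s (fourier mu f) <= sqn mu f.
Proof.
move=> hf us; set w := fourier mu f.
pose g x := \sum_(xi <- s) w xi * xi x.
have hg : sqint_fun mu g := sqint_trig s w.
have := sqn_ge0 mu (fun x => 1 * f x + (-1) * g x).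
rewrite sqn_lin// fourier_ip// (@re_sum_conj s w w)// sqn_trig//.
rewrite modcN modc1 expr1n !mul1r rmorphN rmorph1 mulN1r cRe_N /=; lra.
Qed.

Definition toL2 f (hf : sqint_fun mu f) : L2 mu :=
  (\pi_(Quotient.quot (@L2_null _ _ _ mu)) (L2Fun (proj2 (L2_predP f) hf)))%qT.

Lemma L2_repr (u : L2 mu) : exists f (hf : sqint_fun mu f), u = toL2 hf.
Proof.
have hf := proj1 (L2_predP _) (valP (repr u : L2fun mu)).
exists (repr u : L2fun mu), hf; rewrite -[LHS]reprK; congr (\pi_ _)%qT.
exact: val_inj.
Qed.

Lemma repr_toL2 f (hf : sqint_fun mu f) :
  sqint_fun mu (repr (toL2 hf) : L2fun mu) /\
  {ae mu, forall x, (repr (toL2 hf) : L2fun mu) x = f x}.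
Proof.
split; first exact: proj1 (L2_predP _) (valP (repr (toL2 hf) : L2fun mu)).
have : repr (toL2 hf) - L2Fun (proj2 (L2_predP f) hf) \in @L2_null _ _ _ mu.
  by rewrite Quotient.idealrBE; apply/eqP; rewrite reprK.
move=> /asboolP; apply: ae_subset => x.
by rewrite -[X in X = 0]/(_ - f x) => /eqP; rewrite subr_eq0 => /eqP.
Qed.

Lemma toL2_ae f g (hf : sqint_fun mu f) (hg : sqint_fun mu g) :
  {ae mu, forall x, f x - g x = 0} -> toL2 hf = toL2 hg.
Proof.
by move=> fg; apply/eqP; rewrite -Quotient.idealrBE; apply/asboolP.
Qed.

Lemma toL2B f g (hf : sqint_fun mu f) (hg : sqint_fun mu g) :
  toL2 hf - toL2 hg = toL2 (sqintB hf hg).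
Proof. by rewrite -raddfB; congr (\pi_ _)%qT; exact: val_inj. Qed.

Lemma toL2N f (hf : sqint_fun mu f) : - toL2 hf = toL2 (sqintN hf).
Proof. by rewrite -raddfN; congr (\pi_ _)%qT; exact: val_inj. Qed.

Lemma L2norm_toL2 f (hf : sqint_fun mu f) : L2norm (toL2 hf) = Num.sqrt (sqn mu f).
Proof. by have [h /(sqn_ae h hf) E] := repr_toL2 hf; rewrite -E. Qed.

Lemma fourierL2_toL2 f (hf : sqint_fun mu f) : fourierL2 (toL2 hf) = fourier mu f.
Proof.
by have [h fh] := repr_toL2 hf; apply/funext => xi; exact: fourier_ae.
Qed.

(** Makes [fourierL2_inv], which is defined by choice, a left inverse of the transform, so that [Op]
    can be computed on coefficients. *)
Lemma fourierL2_inj : injective (@fourierL2 R X mu).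
Proof.
move=> u v; have [f [hf ->]] := L2_repr u; have [g [hg ->]] := L2_repr v.
rewrite !fourierL2_toL2 => E; apply: toL2_ae.
apply: (fourier_eq0 compX hausX haar_mu (sqintB hf hg)) => chi.
by rewrite fourierB// E subrr.
Qed.

Lemma fourierL2K (u : L2 mu) : fourierL2_inv mu (fourierL2 u) = u.
Proof. by apply: xget_unique => // v /fourierL2_inj. Qed.

Lemma fourierL2N (u : L2 mu) xi : fourierL2 (- u) xi = - fourierL2 u xi.
Proof.
by have [f [hf ->]] := L2_repr u; rewrite toL2N !fourierL2_toL2 fourierN.
Qed.

(** The range is closed under negation, so off the range both sides take the default value 0. *)
Lemma fourierL2_invN w : fourierL2_inv mu (fun xi => - w xi) = - fourierL2_inv mu w.
Proof.
have [[u E]|h] := pselect (exists u : L2 mu, fourierL2 u = w).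
  rewrite -E fourierL2K -[RHS]fourierL2K; congr fourierL2_inv.
  by apply/funext => xi; rewrite fourierL2N.
have -> : fourierL2_inv mu w = 0 by apply: xgetPN => u E; apply: h; exists u.
rewrite oppr0; apply: xgetPN => u E; apply: h; exists (- u).
by apply/funext => xi; rewrite fourierL2N E opprK.
Qed.

Lemma fourierL2_bound (u : L2 mu) : exists B, l2_bound (fourierL2 u) B.
Proof.
have [f [hf ->]] := L2_repr u; exists (sqn mu f) => T uT.
by rewrite fourierL2_toL2 bessel.
Qed.


Lemma has_csum_finite (I : choiceType) (s : seq I) (a : I -> R[i]) : uniq s ->
  (forall i, i \notin s -> a i = 0) -> has_csum a (\sum_(i <- s) a i).
Proof.
move=> us a0 e e0; exists [fset i in s]%fset => T sT.
suff -> : \sum_(i <- T) a i = \sum_(i <- s) a i by rewrite subrr modc0 ltW.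
rewrite (bigID (fun i => i \in s))/= [X in _ + X]big1 ?addr0; last by move=> i /a0.
rewrite -big_filter; apply: perm_big; apply: uniq_perm => //.
  by rewrite filter_uniq// fset_uniq.
move=> i; rewrite mem_filter; case: (boolP (i \in s)) => //= si.
by apply: (fsubsetP sT); rewrite inE.
Qed.

Implicit Types F : X -> Xi -> R[i].

Lemma symbol_sqint F a zeta : is_symbol_of mu a F -> sqint_fun mu (F^~ zeta).
Proof. by move=> [/(_ zeta) /L2_predP]. Qed.

Lemma partial_fourierP F : frakD mu F -> is_symbol_of mu (partial_fourier mu F) F.
Proof. exact: xgetPex. Qed.

(** The pseudodifferential formula applied to a trigonometric polynomial, where the sum over
    frequencies is finite. *)
Definition Op_poly F s w : X -> R[i] :=
  fun x => \sum_(eta <- s) w eta * (eta x * F x eta).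

Lemma sqint_Op_poly F s w : frakD mu F -> sqint_fun mu (Op_poly F s w).
Proof.
move=> [a hF]; apply: sqint_sum => eta; apply: sqintZ.
exact: sqint_character (symbol_sqint eta hF).
Qed.

Lemma fourier_Op_poly F s w xi : frakD mu F ->
  fourier mu (Op_poly F s w) xi =
  \sum_(eta <- s) fourier mu (F^~ eta) (xi - eta) * w eta.
Proof.
move=> [a hF]; have hs eta := sqint_character eta (symbol_sqint eta hF).
rewrite fourier_sum; last by move=> eta; exact: sqintZ.
by apply: eq_bigr => eta _; rewrite fourierZ// fourier_modulation mulrC.
Qed.

Lemma Op_toL2 F s w (hF : frakD mu F) : uniq s ->
  Op mu F (toL2 (sqint_trig s w)) = toL2 (sqint_Op_poly s w hF).
Proof.
move=> us; rewrite /Op -[RHS]fourierL2K; congr fourierL2_inv.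
apply/funext => xi; rewrite !fourierL2_toL2 fourier_Op_poly//.
have [_ hb] := partial_fourierP hF.
have hw : l2_bound (fourier mu (fun x => \sum_(xi <- s) w xi * xi x)) (sqsum s w).
  by move=> T uT; rewrite -sqn_trig// bessel//; exact: sqint_trig.
have hs := sch_coef (partial_fourier mu F) xi hw.
apply: has_csum_eq hs _; set v := fourier mu _ in hw *.
have -> : \sum_(eta <- s) fourier mu (F^~ eta) (xi - eta) * w eta =
    \sum_(eta <- s) toep (crossed_coef (partial_fourier mu F)) xi eta * v eta.
  rewrite big_seq [RHS]big_seq; apply: eq_bigr => eta es.
  by rewrite hb /v fourier_trig// es.
apply: has_csum_finite => // eta es.
by rewrite /v fourier_trig// (negPf es) mulr0.
Qed.

Lemma OpN F a : is_symbol_of mu a F ->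
  is_symbol_of mu (- a) (fun x zeta => - F x zeta) /\
  Op mu (fun x zeta => - F x zeta) = - Op mu F.
Proof.
move=> hF; have sN : is_symbol_of mu (- a) (fun x zeta => - F x zeta).
  split=> [zeta|xi zeta].
    by apply/L2_predP; apply: sqintN; exact: symbol_sqint hF.
  by rewrite (fourierN _ (symbol_sqint zeta hF)) crossed_coefN (proj2 hF).
split=> //; apply/funext => u.
transitivity (- fourierL2_inv mu (sch (partial_fourier mu F) (fourierL2 u))) => //.
rewrite -fourierL2_invN; congr fourierL2_inv.
apply/funext => xi; have [B hB] := fourierL2_bound u.
have [_ h1] := partial_fourierP (ex_intro _ a hF : frakD mu F).
have [_ h2] := partial_fourierP (ex_intro _ (- a) sN : frakD mu _).
apply: has_csum_eq (sch_coef _ xi hB) _.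
rewrite -mulN1r; have := has_csumZ (-1) (sch_coef (partial_fourier mu F) xi hB).
congr has_csum; apply/funext => eta; rewrite /toep -h1 -h2 fourierN ?mulN1r ?mulNr//.
exact: symbol_sqint hF.
Qed.

Lemma sqsum_pZ s w z : sqsum s (fun xi => z * w xi) = modc z ^+ 2 * sqsum s w.
Proof.
by rewrite /sqsum mulr_sumr; apply: eq_bigr => xi _; rewrite modcM exprMn.
Qed.

(** The inputs are trigonometric polynomials, on which [Op] is explicit, and Bessel's inequality
    extracts finitely many coefficients of the output. *)
Lemma opnorm_bounded_form F G (C : R) : frakD mu F -> frakD mu G -> 0 <= C ->
  (opnorm (Op mu F - Op mu G)%R <= C%:E)%E ->
  bounded_form C (fun xi eta => fourier mu (F^~ eta) (xi - eta) -
                                fourier mu (G^~ eta) (xi - eta)).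
Proof.
move=> hF hG C0 hC; set M := fun xi eta => _.
have unit_ball S T w : uniq S -> uniq T -> sqsum T w <= 1 ->
    sqsum S (apply_mx M T w) <= C ^+ 2.
  move=> uS uT w1.
  have : ((L2norm ((Op mu F - Op mu G)%R (toL2 (sqint_trig T w))))%:E <= C%:E)%E.
    apply: le_trans hC; apply: ereal_sup_ubound; exists (toL2 (sqint_trig T w)) => //=.
    by rewrite L2norm_toL2 sqn_trig// -(@sqrtr1 R) ler_wsqrtr.
  have -> : (Op mu F - Op mu G) (toL2 (sqint_trig T w)) =
      toL2 (sqintB (sqint_Op_poly T w hF) (sqint_Op_poly T w hG)).
    by rewrite -toL2B -!Op_toL2.
  rewrite L2norm_toL2 lee_fin.
  rewrite -ler_sqr ?nnegrE ?sqrtr_ge0// sqr_sqrtr ?sqn_ge0//; apply: le_trans.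
  apply: le_trans (bessel (sqintB (sqint_Op_poly T w hF) (sqint_Op_poly T w hG)) uS).
  rewrite le_eqVlt; apply/orP; left; apply/eqP; apply: eq_bigr => xi _.
  rewrite (fourierB _ (sqint_Op_poly T w hF) (sqint_Op_poly T w hG)) !fourier_Op_poly//.
  congr (modc _ ^+ 2); rewrite -sumrB; apply: eq_bigr => eta _.
  by rewrite mulrBl.
apply: bounded_mx_form => // S T w uS uT; rewrite mulrC.
apply: le_of_gt0; rewrite ?sqsum_ge0 ?sqr_ge0// => d hd.
have d0 : 0 < d := le_lt_trans (sqsum_ge0 _ _) hd.
(* Scales w into the unit ball; d is strictly above the squared norm of w, so w = 0 is covered. *)
pose r := ((Num.sqrt d)^-1)%:C%C : R[i].
have r2 : modc r ^+ 2 = d^-1.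
  by rewrite modc_real real_normK ?num_real// exprVn sqr_sqrtr// ltW.
have := unit_ball S T (fun xi => r * w xi) uS uT.
rewrite sqsum_pZ r2 mulrC ler_pdivrMr// mul1r => /(_ (ltW hd)).
have -> : apply_mx M T (fun xi => r * w xi) = fun xi => r * apply_mx M T w xi.
  apply/funext => xi; rewrite /apply_mx mulr_sumr; apply: eq_bigr => eta _.
  exact: mulrCA.
by rewrite sqsum_pZ r2 ler_pdivrMl.
Qed.


Lemma bounded_form_reindex (h : Xi -> Xi) (C : R) M : injective h ->
  bounded_form C M -> bounded_form C (fun xi eta => M (h xi) (h eta)).
Proof.
move=> ih hM S T z w t uS uT t0.
(* z and w are extended by an arbitrary value outside of the range of h. *)
pose k xi := xget 0 [set eta | h eta = xi].
have kK eta : k (h eta) = eta by apply: xget_unique => // ? /ih.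
have := hM (map h S) (map h T) (z \o k) (w \o k) t.
rewrite !map_inj_uniq// => /(_ uS uT t0).
rewrite /bilin /sqsum !big_map /=; under eq_bigr do rewrite big_map.
have E U v : \sum_(i <- U) modc (v (k (h i))) ^+ 2 = \sum_(i <- U) modc (v i : R[i]) ^+ 2.
  by apply: eq_bigr => i _; rewrite kK.
rewrite !E; congr (2 * modc _ <= _).
by apply: eq_bigr => i _; apply: eq_bigr => j _; rewrite !kK.
Qed.

(** * Limits of the symbol at the points of Omega *)

Section asymptotics.
Variables (Omega : set (beta Xi)) (f g : X -> Xi -> R[i]) (C : R).
Hypothesis Omega_inv : theta_invariant Omega.
Hypothesis f_VO : VO mu Omega f.
Hypothesis f_cont : continuous_linfty f.
Hypothesis g_ideal : frakD_ideal mu Omega g.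
Hypothesis C0 : 0 <= C.
Hypothesis hC : (opnorm (Op mu f - Op mu g)%R <= C%:E)%E.

Lemma linfty_bounded (psi : Xi -> R[i]) : linfty psi ->
  exists B, forall zeta, modc (psi zeta) <= B.
Proof.
move=> fin; exists (fine (supnorm psi)) => zeta; rewrite -lee_fin fineK; last first.
  by rewrite ge0_fin_numE ?supnorm_ge0.
by apply: ereal_sup_ubound; exists zeta.
Qed.

Lemma linfty_equicont x (e : R) : 0 < e ->
  \forall x' \near x, forall zeta, modc (f x' zeta - f x zeta) <= e.
Proof.
move=> e0; have : nbhs (f x : {uniform Xi -> R[i]})
    [set h | forall zeta, modc (h zeta - f x zeta) <= e].
  have ec0 : 0 < (e%:C)%C by rewrite ltcR.
  apply/uniform_nbhs; exists [set z : R[i] * R[i] | ball z.1 (e%:C)%C z.2].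
  split; first exact: (entourage_ball _ (PosNum ec0)).
  move=> h /= hh zeta; rewrite modcB -lecR modc_normE ltW//; exact: hh.
by move=> /(f_cont.2 x).
Qed.

Lemma slice_limit (p : beta Xi) : exists2 F, ccont F &
  forall e : R, 0 < e -> \forall zeta \near beta_sets p, forall x, modc (f x zeta - F x) <= e.
Proof.
apply: (equicont_ultra_lim compX (beta_ultra p) (phi := fun zeta x => f x zeta)).
  by move=> x; apply: linfty_bounded; exact: f_cont.1.
exact: linfty_equicont.
Qed.

(** Translating both indices by zeta keeps xi - eta and moves the slice to eta + zeta. Along p, each
    entry differs from the coefficient of F by an oscillation term, a term of g and the uniform
    error f(., zeta) - F, each eventually below e / 3. *)
Lemma slice_limit_form p (F : X -> R[i]) : Omega p -> ccont F ->
  (forall e : R, 0 < e -> \forall zeta \near beta_sets p, forall x, modc (f x zeta - F x) <= e) ->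
  bounded_form C (fun xi eta : Xi => fourier mu F (xi - eta)).
Proof.
move=> Omega_p cF hF; have [[a ha] osc] := f_VO; have [b b_ideal hb] := g_ideal.
have pP : ProperFilter (beta_sets p) := @ultra_proper _ _ (beta_ultra p).
have pF : Filter (beta_sets p) := @filter_filter _ _ pP.
have hfg := opnorm_bounded_form (ex_intro _ a ha : frakD mu f)
  (ex_intro _ b hb : frakD mu g) C0 hC.
apply: (@bounded_form_cvg _ _ Xi (beta_sets p) pP (fun zeta xi eta =>
    fourier mu (f^~ (eta + zeta)) (xi + zeta - (eta + zeta)) -
    fourier mu (g^~ (eta + zeta)) (xi + zeta - (eta + zeta)))); last first.
  apply: (@filterS _ _ pF setT); last exact: filterT.
  by move=> zeta _; apply: (bounded_form_reindex _ hfg) => ? ? /addIr.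
move=> xi eta e e0; have e30 : 0 < e / 3 by rewrite divr_gt0.
have [c c_ideal hc] := osc eta.
have h1 := hF _ e30.
have h2 := ideal_coef (xi - eta) c_ideal Omega_p e30.
(* Following zeta + eta along p amounts to following the translated ultrafilter, which stays in
   Omega by invariance. *)
have h3 : \forall zeta \near beta_sets p, modc (crossed_coef b (xi - eta) (zeta + eta)) <= e / 3.
  exact: (ideal_coef (xi - eta) b_ideal (Omega_inv eta Omega_p) e30).
apply: (@filterS _ _ pF) (@filterI _ _ pF _ _ h1 (@filterI _ _ pF _ _ h2 h3)).
move=> zeta [k1 [k2 k3]].
have -> : xi + zeta - (eta + zeta) = xi - eta by rewrite opprD addrACA subrr addr0.
have sf z : sqint_fun mu (f^~ z) := symbol_sqint z ha.
rewrite -(proj2 hc) [_ (xi - eta)](fourierB _ (sf (zeta + eta)) (sf zeta)) in k2.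
rewrite -(proj2 hb) in k3; rewrite (addrC zeta) in k2 k3.
have k4 := fourier_sup_le (xi - eta) (sf zeta) (ccont_sqint mu compX cF) k1.
move: (fourier mu (f^~ (eta + zeta)) _) (fourier mu (g^~ _) _) (fourier mu (f^~ zeta) _)
  (fourier mu F _) k2 k3 k4 => z1 z2 z3 z4 k2 k3 k4.
have -> : z1 - z2 - z4 = (z1 - z3) + ((z3 - z4) - z2) by ring.
rewrite (le_trans (le_modcD _ _))// (le_trans (lerD k2 (le_modcB _ _)))//; lra.
Qed.

(** At the coefficient vector of W the form of this matrix is the integral of F |W|^2, and by
    Parseval the norm of that vector is the L^2 norm of W. *)
Lemma slice_limit_le p (F : X -> R[i]) : Omega p -> ccont F ->
  (forall e : R, 0 < e -> \forall zeta \near beta_sets p, forall x, modc (f x zeta - F x) <= e) ->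
  forall x, modc (F x) <= C.
Proof.
move=> Omega_p cF hF; apply: (sup_le_trig compX hausX haar_mu cF C0) => W tW.
have [s [w [us ->]]] := trig_sum tW; rewrite sqn_trig//.
have := slice_limit_form Omega_p cF hF (fun xi => (w xi)^*%C) w us us ltr01.
have -> : cintegral mu (fun x : borel X => F x *
    ((\sum_(xi <- s) w xi * xi x) * (\sum_(xi <- s) w xi * xi x)^*%C)) =
  bilin (fun xi eta => fourier mu F (xi - eta)) s s (fun xi => (w xi)^*%C) w.
  pose H eta x := w eta * (eta x * F x).
  have hH eta : sqint_fun mu (H eta).
    by apply: sqintZ; apply: sqint_character; exact: ccont_sqint.
  have -> : (fun x : borel X => F x *
      ((\sum_(xi <- s) w xi * xi x) * (\sum_(xi <- s) w xi * xi x)^*%C)) =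
    (fun x => (\sum_(eta <- s) H eta x) * (\sum_(xi <- s) w xi * xi x)^*%C).
    apply/funext => x; rewrite mulrA; congr (_ * _).
    by rewrite mulr_sumr; apply: eq_bigr => eta _; rewrite /H mulrCA; congr (_ * _); rewrite mulrC.
  rewrite -[LHS]/(ip mu _ _) fourier_ip; last exact: sqint_sum.
  apply: eq_bigr => xi _; rewrite fourier_sum// mulr_sumr; apply: eq_bigr => eta _.
  rewrite fourierZ; last by apply: sqint_character; exact: ccont_sqint.
  by rewrite fourier_modulation mulrCA mulrC.
rewrite mul1r invr1 mul1r.
have -> : sqsum s (fun xi => (w xi)^*%C) = sqsum s w.
  by apply: eq_bigr => xi _; rewrite modc_conj.
lra.
Qed.

(** The ultrafilters containing A form an open set whose trace on the dual group is A; it contains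
    Omega because every limit slice is bounded by C. *)
Lemma limsup_le : (limsup_at Omega f <= C%:E)%E.
Proof.
apply/lee_addgt0Pr => e e0; rewrite -EFinD.
pose A := [set zeta | forall x, modc (f x zeta) <= C + e].
apply: ge_ereal_inf; exists (ereal_sup [set (modc (f z.1 z.2))%:E | z in
    [set z : X * Xi | A z.2]]); last first.
  by apply: ge_ereal_sup => _ [[x zeta] /= h <-]; rewrite lee_fin; exact: h.
exists [set p | beta_sets p A].
  move=> p Omega_p; apply: open_nbhs_nbhs; split; first exact: beta_open.
  have [F cF hF] := slice_limit p.
  have pF : Filter (beta_sets p) by exact: (@ultra_proper _ _ (beta_ultra p)).
  apply: (@filterS _ _ pF) (hF e e0) => zeta h x.
  have := le_modc_sub (f x zeta) (F x); have := h x.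
  by have := slice_limit_le Omega_p cF hF x; lra.
by congr ereal_sup; apply/seteqP; split => _ [z /= h <-]; exists z => //; apply/principal_filterP.
Qed.

End asymptotics.

Lemma opnorm_ge0 (A : L2 mu -> L2 mu) : (0 <= opnorm A)%E.
Proof.
have z0 : sqint_fun mu (fun=> 0) := sqint_cst mu 0.
apply: (@le_trans _ _ (L2norm (A (toL2 z0)))%:E); first by rewrite lee_fin sqrtr_ge0.
apply: ereal_sup_ubound; exists (toL2 z0) => //=; rewrite L2norm_toL2 /sqn.
have -> : (fun _ : borel X => modc (0 : R[i]) ^+ 2) = fun=> 0.
  by apply/funext => _; rewrite modc0 expr0n.
by rewrite mean_cst sqrtr0 ler01.
Qed.

(** Cosets are formed with A + L and the distance with A - L; this symmetry reconciles them. *)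
Lemma bbD_idealN Omega (L : L2 mu -> L2 mu) :
  bbD_ideal mu Omega L -> bbD_ideal mu Omega (- L).
Proof.
move=> [g [a ia ha] <-]; have [sN oN] := OpN ha.
exists (fun x zeta => - g x zeta) => //; exists (- a) => //.
exact: crossed_idealN.
Qed.

End hilbert_space.

Theorem theorem3p1 (R : realType) (X : topologicalZmodType)
    (mu : probability (borel X) R)
    (Omega : set (beta (dual X R))) (f : X -> dual X R -> R[i])
    (compX : compact [set: X]) (hausX : hausdorff_space X)
    (haar_mu : is_haar mu)
    (closedOmega : closed Omega) (Omega_corona : Omega `<=` corona)
    (Omega_inv : theta_invariant Omega)
    (f_VO : VO mu Omega f) (f_cont : continuous_linfty f) :
  quot_norm (quot_class mu Omega (Op mu f)) = opdist (Op mu f) (bbD_ideal mu Omega)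
  /\ (limsup_at Omega f <= opdist (Op mu f) (bbD_ideal mu Omega))%E.
Proof.
split.
  congr ereal_inf; apply/seteqP; split.
    move=> _ [_ [L hL <-] <-]; exists (- L); first exact: bbD_idealN.
    by rewrite opprK.
  move=> _ [L hL <-]; exists (Op mu f - L) => //; exists (- L) => //.
  exact: bbD_idealN.
apply: le_ereal_inf_tmp => _ [L [g hg <-] <-].
have := opnorm_ge0 (Op mu f - Op mu g).
(* Nonnegativity excludes the value -oo, and an infinite norm bounds everything. *)
case E : opnorm => [C| |] // C0; last by rewrite leey.
apply: (limsup_le compX hausX haar_mu Omega_inv f_VO f_cont hg C0).
by rewrite E.
Qed.
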